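(* Let $X$ be a Mumford curve of genus $g(X)>0$ over $\mathbb{Q}_p$, let $F\subset\mathbb{Q}_p$ be a good fundamental domain of $X$, and let $V(T_F)$ be the vertex set of the tree $T_F=T(F)$ associated with $F$. Let $G$ be the complete graph on $V(T_F)$, including all loop-edges, with vertex sets $U_v$ the holed discs decomposing $F$. Let $\alpha>0$, and let $d^\alpha_G=d^\alpha$, $D^\alpha$, $\Delta^\alpha_\rho$, their heat kernels and the index be those attached to $G$ as in the context. Then $$\operatorname{ind}(d_G^\alpha)=\lim_{t\to\infty}\left(\operatorname{tr}(p_{D^\alpha,t})-\operatorname{tr}(p_{\Delta_\rho^\alpha,t})\right)=-\tfrac12|V(T_F)|^2+\tfrac32|V(T_F)|.$$
   Context: Mumford curve data. $X$ is the quotient of the ordinary points of a Schottky group $\Gamma\subset\mathrm{PGL}_2(\mathbb{Q}_p)$, free of rank $g=g(X)>0$. A good fundamental domain $F$ for $\Gamma$ (Gerritzen–van der Put) is the complement in the projective line of $2g$ open discs $B_1,\dots,B_g,C_1,\dots,C_g$, whose associated closed discs $B_i^+,C_i^+$ are pairwise disjoint, such that $\Gamma$ has free generators $\gamma_1,\dots,\gamma_g$ with $\gamma_i(\mathbb{P}^1\setminus B_i)=C_i^+$ and $\gamma_i(\mathbb{P}^1\setminus B_i^+)=C_i$. It is taken in $\mathbb{Q}_p$ (the point $\infty$ lies in one of the removed discs); the other removed discs are the inner holes of $F$. $T_F=T(F)$ is the finite subtree of the Bruhat–Tits tree of $\mathbb{Q}_p$ associated with $F$ (the dendrogram for finitely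 many points, one from each inner hole). Its vertices $v$ index a decomposition $F=\bigsqcup_v U_v$ into holed discs $U_v\subset\mathbb{Q}_p$ (discs with finitely many subdiscs removed). Operators. $p$ is a prime, $dx$ the Haar measure on $\mathbb{Q}_p$ with $\int_{\mathbb{Z}_p}dx=1$, functions are complex-valued. The sets $U_v$ are pairwise disjoint non-empty compact open and satisfy, for $v\neq w$, $x\in U_v$, $y\in U_w$: $|x-y|_p=\operatorname{dist}(U_v,U_w)$, where $\operatorname{dist}(A,B)=\inf\{|x-y|_p: x\in A,\,y\in B\}$. $\Omega_V=\bigsqcup_v U_v$ and $\Omega_E=\Omega_V\times\Omega_V$. $L^2(\Omega_E)_\sigma=\{h\in L^2(\Omega_E): h(x,y)=-h(y,x)\}$. For $\alpha>0$: $d^\alpha: L^2(\Omega_V)\to L^2(\Omega_E)_\sigma$, $(d^\alpha f)(x,y)=\dfrac{f(x)-f(y)}{2|x-y|_p^\alpha}$; $\delta^\alpha: L^2(\Omega_E)_\sigma\to L^2(\Omega_V)$, $(\delta^\alpha h)(x)=\int_{\Omega_V}h(x,y)|x-y|_p^{-\alpha}dy$; both are possibly unbounded, given by these formulas on locally constant functions and extended by closure. $D^\alpha=\delta^\alpha d^\alpha$ is the closed, non-negative self-adjoint operator on $L^2(\Omega_V)$ determined by its action on locally constant functions. $L^2(\Omega_E)_\rho$ is the finite-dimensional space of $h\in L^2(\Omega_E)_\sigma$ constant on $U_v\times U_w$ for all vertices $v,w$; $\delta^\alpha_\rho$ is the restriction of $\delta^\alpha$ to it, and $\Delta_\rho^\alpha=d^\alpha\delta_\rho^\alpha$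 on $L^2(\Omega_E)_\rho$. $\operatorname{ind}(d^\alpha)=\dim\ker d^\alpha-\dim\ker\delta_\rho^\alpha$. For $A\in\{D^\alpha,\Delta^\alpha_\rho\}$ the heat kernel is $p_{A,t}=\sum_\lambda e^{-\lambda t}f_\lambda(x)\overline{f_\lambda(y)}$ over an orthonormal eigenbasis (eigenvalues with multiplicity), with trace $\operatorname{tr}(p_{A,t})=\sum_\lambda e^{-\lambda t}$.
   Formalization: The equality of the index with the limit of the trace difference is stated only for α ≥ 1/2: for 0 < α < 1/2, D^α is bounded on an infinite-dimensional space, so its heat trace is infinite for all t and the limit is +∞. The index formula is stated for all α > 0. *)

(* Defs.v *)
(* MathComp-Analysis; complex numbers are R[i] of mathcomp-real-closed. *)
From HB Require Import structures.
From mathcomp Require Import all_boot all_order all_algebra.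
From mathcomp Require Import finmap.
From mathcomp Require Import all_classical all_reals all_analysis.
From mathcomp Require Import complex.

Set Implicit Arguments.
Unset Strict Implicit.
Unset Printing Implicit Defensive.

Import Order.TTheory GRing.Theory Num.Theory.
Import numFieldNormedType.Exports.

Local Open Scope classical_set_scope.
Local Open Scope ring_scope.
Local Open Scope complex_scope.

(* The field Q_p, characterised (up to a unique isometric isomorphism) as a
   completion of the rationals for the p-adic absolute value. By [pabs_nat] and
   multiplicativity, |q| = p ^ - v_p(q) for every rational q. *)
Record padic_field (R : realType) (p : nat) := PadicField {
  psort :> fieldType;
  pabs : psort -> R;
  pabs_ge0 : forall x, 0 <= pabs x;
  pabs_eq0 : forall x, pabs x = 0 <-> x = 0;
  pabsM : forall x y, pabs (x * y) = pabs x * pabs y;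
  pabs_ultra : forall x y, pabs (x + y) <= Num.max (pabs x) (pabs y);
  pabs_nat : forall n : nat, (0 < n)%N ->
    pabs n%:R = (p%:R : R) ^- logn p n;
  pabs_dense : forall (x : psort) (e : R), 0 < e ->
    exists q : rat, pabs (x - ratr q) < e;
  pabs_complete : forall u : nat -> psort,
    (forall e : R, 0 < e -> exists N : nat, forall m n : nat,
      (N <= m)%N -> (N <= n)%N -> pabs (u m - u n) < e) ->
    exists l : psort, forall e : R, 0 < e -> exists N : nat, forall n : nat,
      (N <= n)%N -> pabs (u n - l) < e }.

Section PadicBasics.
Context {R : realType} {p : nat} (K : padic_field R p).

Definition padic_open : set (set K) :=
  [set A | forall x, A x -> exists2 e : R, 0 < e &
     forall y : K, pabs (y - x) < e -> A y].

Definition padic_ball (a : K) (k : int) : set K :=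
  [set x | pabs (x - a) <= (p%:R : R) ^ k].

(* Q_p with its Borel sigma-algebra *)
Definition padic_points : Type := psort K.
HB.instance Definition _ := Choice.on padic_points.
HB.instance Definition _ := isPointed.Build padic_points (0 : K).

Definition borel :=
  g_sigma_algebraType (padic_open : set (set padic_points)).
HB.instance Definition _ := Measurable.on borel.

(* dx; sigma-finiteness is automatic and is bundled in the type of mu only
   because the product measure requires it. *)
Definition haar_measure (mu : {sigma_finite_measure set borel -> \bar R}) :=
  (forall (a : K) (A : set borel), measurable A ->
     mu [set (a + x : K) | x in (A : set K)] = mu A) /\
  mu (padic_ball 0 0) = 1%E.

End PadicBasics.

(* The projective line over Q_p is [option K], with None as the point oo. A
   subgroup of PGL_2(Q_p) is given by its preimage in GL_2(Q_p). *)
Section Schottky.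
Context {R : realType} {p : nat} (K : padic_field R p).

Definition mobius (M : 'M[K]_2) (z : option K) : option K :=
  let a := M ord0 ord0 in let b := M ord0 ord_max in
  let c := M ord_max ord0 in let d := M ord_max ord_max in
  match z with
  | Some x => if c * x + d == 0 then None else Some ((a * x + b) / (c * x + d))
  | None => if c == 0 then None else Some (a / c)
  end.

Definition same_in_PGL2 (M N : 'M[K]_2) :=
  exists2 c : K, c != 0 & N = c *: M.

(* The letter (i, true) stands for gamma_i and (i, false) for its inverse. *)
Definition word_value g (gamma : 'I_g -> 'M[K]_2) (w : seq ('I_g * bool)) :
  'M[K]_2 :=
  \prod_(l <- w) (if l.2 then gamma l.1 else invmx (gamma l.1)).

Definition reduced_word g (w : seq ('I_g * bool)) : bool :=
  sorted (fun l l' => ~~ ((l.1 == l'.1) && (l.2 != l'.2))) w.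

Definition free_generators g (gamma : 'I_g -> 'M[K]_2)
    (Gamma : set 'M[K]_2) :=
  [/\ forall i, gamma i \in unitmx,
      forall M, Gamma M <-> exists w, same_in_PGL2 (word_value gamma w) M
    & forall w, reduced_word w -> w != [::] ->
        ~ same_in_PGL2 1%:M (word_value gamma w)].

Definition P1_near (a : option K) (e : R) (z : option K) : Prop :=
  match a, z with
  | Some x, Some y => pabs (y - x) < e
  | Some _, None => False
  | None, Some y => e^-1 < pabs y
  | None, None => True
  end.

Definition limit_point (Gamma : set 'M[K]_2) (a : option K) :=
  exists (b : option K) (M : nat -> 'M[K]_2),
  [/\ forall n, Gamma (M n),
      forall m n, m <> n -> ~ same_in_PGL2 (M m) (M n)
    & forall e : R, 0 < e -> exists N : nat, forall n : nat, (N <= n)%N ->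
        P1_near a e (mobius (M n) b)].

Definition ordinary_point (Gamma : set 'M[K]_2) (a : option K) :=
  ~ limit_point Gamma a.

(* Discontinuous (some point is ordinary) and free of rank g. The closures of
   the orbits are compact because P^1(Q_p) is. *)
Definition schottky_group (Gamma : set 'M[K]_2) (g : nat) :=
  (exists gamma : 'I_g -> 'M[K]_2, free_generators gamma Gamma) /\
  (exists a, ordinary_point Gamma a).

Record mumford_curve := MumfordCurve {
  genus : nat;
  uniformization : set 'M[K]_2;
  uniformizationP : schottky_group uniformization genus }.

(* The points of X are the orbits of the ordinary points. *)
Definition mumford_points (X : mumford_curve) : set (set (option K)) :=
  [set [set mobius M a | M in uniformization X]
     | a in ordinary_point (uniformization X)].

(* [Disc a k] has radius p ^ k; [CoDisc a k] is a disc around oo. Over Q_p the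
   open disc of radius p ^ k is as a set the closed one of radius p ^ (k - 1),
   so discs carry their radius. *)
Inductive disc := Disc of K & int | CoDisc of K & int.

Definition open_disc (D : disc) : set (option K) :=
  match D with
  | Disc a k => [set z | if z is Some x then pabs (x - a) < (p%:R : R) ^ k
                         else False]
  | CoDisc a k => [set z | if z is Some x then (p%:R : R) ^ k < pabs (x - a)
                           else True]
  end.

Definition closed_disc (D : disc) : set (option K) :=
  match D with
  | Disc a k => [set z | if z is Some x then pabs (x - a) <= (p%:R : R) ^ k
                         else False]
  | CoDisc a k => [set z | if z is Some x then (p%:R : R) ^ k <= pabs (x - a)
                           else True]
  end.

(* hole (true, i) is B_i and hole (false, i) is C_i. *)
Record good_fundamental_domain (X : mumford_curve) := GoodFundamentalDomain {
  generator : 'I_(genus X) -> 'M[K]_2;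
  hole : bool * 'I_(genus X) -> disc;
  generatorP : free_generators generator (uniformization X);
  hole_disjoint : forall h h', h <> h' ->
    closed_disc (hole h) `&` closed_disc (hole h') = set0;
  generator_open : forall i,
    mobius (generator i) @` (~` open_disc (hole (true, i)))
    = closed_disc (hole (false, i));
  generator_closed : forall i,
    mobius (generator i) @` (~` closed_disc (hole (true, i)))
    = open_disc (hole (false, i));
  hole_infty : exists h, open_disc (hole h) None }.

End Schottky.

Section Tree.
Context {R : realType} {p : nat} {K : padic_field R p} {X : mumford_curve K}
  (F : good_fundamental_domain X).

Definition domain_set : set K :=
  [set x | forall h, ~ open_disc (hole F h) (Some x)].

(* A vertex of the Bruhat-Tits tree of Q_p is a ball. Those of T_F are the
   balls that contain the closed disc of some inner hole and do not meet the
   hole around oo: the convex hull of the vertices attached to the 2g closed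
   discs, or the dendrogram of one point in each inner hole cut off at the
   boundary of F. *)
Definition tree_vertices : set (set K) :=
  [set v | [/\ exists (a : K) (k : int), v = padic_ball a k,
     exists h, ~ open_disc (hole F h) None /\
       (forall x, closed_disc (hole F h) (Some x) -> v x)
   & forall h, open_disc (hole F h) None ->
       forall x, v x -> ~ open_disc (hole F h) (Some x)]].

(* U_v: the points of F for which v is the smallest ball of T_F around them,
   that is v minus the holes and the smaller balls of T_F. *)
Definition holed_disc (v : set K) : set K :=
  [set x | [/\ v x, domain_set x
    & forall w, tree_vertices w -> w `<=` v -> w <> v -> ~ w x]].

Definition OmegaV : set K := \bigcup_(v in tree_vertices) holed_disc v.

(* the union of the U_v `*` U_w over all edges of the complete graph with
   loops *)
Definition OmegaE : set (K * K) := OmegaV `*` OmegaV.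

Definition card_vertices : nat := #|` fset_set tree_vertices|%fset.

End Tree.

(* Complex L^2 spaces over a set D of a measure space: elements are represented
   by functions on the whole space, of which only the values on D matter, and
   up to equality almost everywhere on D. *)
Section L2.
Context {R : realType} {d : measure_display} {T : measurableType d}
  (m : {measure set T -> \bar R}) (D : set T).
Implicit Types (f g : T -> R[i]) (H : set (T -> R[i])).

Definition cintegral f : R[i] :=
  (Rintegral m D (fun x => complex.Re (f x)) +i* Rintegral m D (fun x => complex.Im (f x))).

Definition normsq (z : R[i]) : R := complex.Re z ^+ 2 + complex.Im z ^+ 2.

Definition L2normsq f : \bar R := (\int[m]_(x in D) (normsq (f x))%:E)%E.

Definition L2 : set (T -> R[i]) :=
  [set f | [/\ measurable_fun D (fun x => complex.Re (f x)),
               measurable_fun D (fun x => complex.Im (f x)) & (L2normsq f < +oo)%E]].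

Definition L2inner f g : R[i] := cintegral (fun x => f x * (g x)^*).

Definition L2eq f g := {ae m, forall x, D x -> f x = g x}.

Definition L2cvg (u : nat -> T -> R[i]) f :=
  (fun n => L2normsq (fun x => u n x - f x)) @ \oo --> 0%E.

Definition L2independent n (b : 'I_n -> T -> R[i]) :=
  forall c : 'I_n -> R[i],
    L2eq (fun x => \sum_(i < n) c i * b i x) (fun=> 0) -> forall i, c i = 0.

Definition dimension H : \bar R :=
  ereal_sup [set (n%:R : R)%:E | n in [set n : nat |
    exists b : 'I_n -> T -> R[i], (forall i, H (b i)) /\ L2independent b]].

(* An operator on the subspace H of L^2(D) is given by its graph A. *)
Definition eigenbasis H (A : set ((T -> R[i]) * (T -> R[i])))
    (I : choiceType) (phi : I -> T -> R[i]) (lambda : I -> R) :=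
  [/\ forall i, H (phi i),
      forall i, A (phi i, fun x => (lambda i)%:C * phi i x),
      forall i j, L2inner (phi i) (phi j) = (i == j)%:R
    & forall f, H f -> (forall i, L2inner f (phi i) = 0) -> L2eq f (fun=> 0)].

(* Trace of the heat kernel sum_i e^(- lambda_i t) phi_i(x) (phi_i(y))^*; the
   sum does not depend on the eigenbasis, and may be +oo. *)
Definition heat_trace H A (t : R) : \bar R :=
  xget 0%E [set s | exists (I : choiceType) (phi : I -> T -> R[i])
      (lambda : I -> R),
    eigenbasis H A phi lambda /\
    s = (\esum_(i in [set: I]) (expR (- (lambda i * t)))%:E)%E].

End L2.

Section Operators.
Context {R : realType} {p : nat} {K : padic_field R p} {X : mumford_curve K}
  (mu : {sigma_finite_measure set (borel K) -> \bar R})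
  (F : good_fundamental_domain X) (alpha : R).
Let T : measurableType _ := borel K.
Let C : Type := R[i].

Definition L2V : set (T -> C) := L2 mu (OmegaV F).

Definition muE : {measure set (T * T) -> \bar R} := (mu \x mu)%E.

Definition L2E_sigma : set (T * T -> C) :=
  [set h | L2 muE (OmegaE F) h /\
    L2eq muE (OmegaE F) h (fun z => - h (z.2, z.1))].

(* constant on the U_v `*` U_w; antisymmetry holds everywhere on OmegaE since
   these sets have positive measure. *)
Definition L2E_rho : set (T * T -> C) :=
  [set h | [/\ L2E_sigma h,
    forall x y, OmegaE F (x, y) -> h (x, y) = - h (y, x)
  & forall v w, tree_vertices F v -> tree_vertices F w ->
      forall x x' y y', holed_disc F v x -> holed_disc F v x' ->
        holed_disc F w y -> holed_disc F w y' -> h (x, y) = h (x', y')]].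

Definition locally_constant (f : K -> C) :=
  forall x, OmegaV F x -> exists2 e : R, 0 < e &
    forall y, OmegaV F y -> pabs (y - x) < e -> f y = f x.

(* On the diagonal the value is 0 / 0 = 0. *)
Definition d_formula (f : K -> C) (z : K * K) : C :=
  (f z.1 - f z.2) / (2 * pabs (z.1 - z.2) `^ alpha)%:C.

Definition delta_formula (h : K * K -> C) (x : K) : C :=
  cintegral mu (OmegaV F)
    (fun y : T => h (x, y) * ((pabs (x - y : K)) `^ (- alpha))%:C).

(* Closures, in L^2 x L^2, of the operators on locally constant functions. *)
Definition d_graph : set ((T -> C) * (T * T -> C)) :=
  [set fh | [/\ L2V fh.1, L2E_sigma fh.2
  & exists u : nat -> T -> C, [/\ forall n, locally_constant (u n),
      L2cvg mu (OmegaV F) u fh.1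
    & L2cvg muE (OmegaE F) (fun n => d_formula (u n)) fh.2]]].

Definition D_graph : set ((T -> C) * (T -> C)) :=
  [set fg | [/\ L2V fg.1, L2V fg.2
  & exists u : nat -> T -> C, [/\ forall n, locally_constant (u n),
      L2cvg mu (OmegaV F) u fg.1
    & L2cvg mu (OmegaV F)
        (fun n => delta_formula (d_formula (u n))) fg.2]]].

(* On L2E_rho, d and delta are only applied to locally constant functions. *)
Definition Delta_rho_graph : set ((T * T -> C) * (T * T -> C)) :=
  [set hk | [/\ L2E_rho hk.1, L2E_rho hk.2
    & L2eq muE (OmegaE F) hk.2 (d_formula (delta_formula hk.1))]].

Definition ker_d : set (T -> C) := [set f | d_graph (f, fun=> 0)].

Definition ker_delta_rho : set (T * T -> C) :=
  [set h | L2E_rho h /\ L2eq mu (OmegaV F) (delta_formula h) (fun=> 0)].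

Definition index_d : \bar R :=
  (dimension mu (OmegaV F) ker_d - dimension muE (OmegaE F) ker_delta_rho)%E.

(* For alpha < 1/2 the operator D is bounded on an infinite-dimensional space,
   so that this trace is +oo for every t. It is finite for all t > 0 when
   alpha > 1/2, and for all large t when alpha = 1/2. *)
Definition trace_D (t : R) : \bar R := heat_trace mu (OmegaV F) L2V D_graph t.

Definition trace_Delta_rho (t : R) : \bar R :=
  heat_trace muE (OmegaE F) L2E_rho Delta_rho_graph t.

End Operators.

(* Main.v *)
Require Import Defs.
From mathcomp Require Import all_boot all_order all_algebra.
From mathcomp Require Import finmap.
From mathcomp Require Import sesquilinear spectral.
From mathcomp Require Import all_classical all_reals all_analysis.
From mathcomp Require Import measurable_realfun.
From mathcomp Require Import complex.
From mathcomp Require Import ring lra zify.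

Import Order.TTheory GRing.Theory Num.Theory.
Import numFieldNormedType.Exports.
Local Open Scope classical_set_scope.
Local Open Scope ring_scope.

(** Both operators are diagonalised explicitly. Write Om for OmegaV F, n for the
number of vertices and N = n (n - 1) / 2 for the number of pairs of distinct
vertices. The claim reduces to four facts: ker d is a line, ker delta_rho has
dimension N - (n - 1), and the heat traces of D, when alpha >= 1 / 2, and of
Delta_rho tend to these same numbers, the multiplicities of the eigenvalue 0.
Then 1 - (N - (n - 1)) is the stated
polynomial in n.

Geometry. The hole around infinity confines Om to a ball B0. A point of B0 is
described by the digits of its p-adic expansion: [dig n x] encodes the first n
digits, and two points share them exactly when they lie in the same ball of
radius p ^ (k0 - n), called a cell. The inner holes and the vertices are finitely
many balls, so the sets U_v are unions of cells of one level
([holed_stable]); by the ultrametric inequality the distance between points of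
U_v and U_w depends on the pair v, w only ([holed_dist]). Compactness of B0
([koenig_cells], from completeness) makes every locally constant function on Om
depend on finitely many digits ([lconst_scale]).

The operator D. On such functions the kernel |x - y| ^ (- 2 alpha) is a
combination of the indicators of sharing j digits, for j = 0, 1, ...
([kernel_layers]). So D is a combination of the operators taking u to the
function whose value at x is the mass of the cell of x times u x, minus the
integral of u over that cell ([DopE]). Compare
every cell with the union of those of its siblings that precede it: the
resulting Haar functions [wav r] and the constant are eigenvectors of D
([Dop_wav]), orthonormal, and complete, because a function orthogonal to all of
them has integral 0 over every cell ([wav_complete]). The eigenvalues at level n
are at least c (n + 1) when alpha >= 1 / 2 ([ev_ge]), whereas at most p ^ (n + 1)
wavelets have level n; this squeezes the trace between 1 and
1 + p ^ 2 e ^ (- c t) for large t ([trace_le]). That the trace may be computed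
from this particular eigenbasis is [heat_traceE]: an eigenvector of the closure
of D is orthogonal to the wavelets with another eigenvalue, and Parseval's
identity then matches multiplicities.

The kernel of d. As |x - y| is bounded on Om, the norm of u x - u y over the
edges is at most a constant times that of d u; this passes to the closure and
forces an element of ker d to be constant ([d_kernel_cst]).

The edge space. An antisymmetric function constant on the U_v `*` U_w has one
coordinate for each pair {v, w}. Since distances between distinct U_v and U_w
are constant, delta becomes an explicit N x n matrix in orthonormal coordinates
and d, on functions constant on the U_v, its transpose ([delta_edge_synE],
[dE_synV]). The graph being complete, d kills only the constants, so this matrix
has rank n - 1 ([rank_Dmx]); the spectral theorem for its Gram matrix
([gram_spectral]) gives an eigenbasis of Delta_rho with non-negative eigenvalues
of which exactly N - (n - 1) vanish. *)

(** * Complex numbers and complex integrals *)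

Section ComplexParts.
Context {R : realType}.
Local Open Scope complex_scope.
Implicit Types (z w : R[i]) (r : R).

Lemma ReD z w : complex.Re (z + w) = complex.Re z + complex.Re w.
Proof. by case: z => a b; case: w. Qed.
Lemma ImD z w : complex.Im (z + w) = complex.Im z + complex.Im w.
Proof. by case: z => a b; case: w. Qed.
Lemma ReN z : complex.Re (- z) = - complex.Re z.
Proof. by case: z. Qed.
Lemma ImN z : complex.Im (- z) = - complex.Im z.
Proof. by case: z. Qed.
Lemma ReM z w : complex.Re (z * w)
  = complex.Re z * complex.Re w - complex.Im z * complex.Im w.
Proof. by case: z => a b; case: w. Qed.
Lemma ImM z w : complex.Im (z * w)
  = complex.Re z * complex.Im w + complex.Im z * complex.Re w.
Proof. by case: z => a b; case: w. Qed.
Lemma ReJ z : complex.Re (z^*) = complex.Re z.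
Proof. by case: z. Qed.
Lemma ImJ z : complex.Im (z^*) = - complex.Im z.
Proof. by case: z. Qed.
Lemma ReC r z : complex.Re (r%:C * z) = r * complex.Re z.
Proof. by rewrite ReM /= mul0r subr0. Qed.
Lemma ImC r z : complex.Im (r%:C * z) = r * complex.Im z.
Proof. by rewrite ImM /= mul0r addr0. Qed.
Lemma complex_eqP z w :
  complex.Re z = complex.Re w -> complex.Im z = complex.Im w -> z = w.
Proof. by case: z => a b; case: w => c d /= -> ->. Qed.

Lemma normsq_ge0 z : 0 <= normsq z.
Proof. by rewrite /normsq addr_ge0 ?sqr_ge0. Qed.
Lemma normsq_eq0 z : normsq z = 0 -> z = 0.
Proof.
move=> /eqP; rewrite /normsq paddr_eq0 ?sqr_ge0// !sqrf_eq0.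
by move=> /andP[/eqP rz /eqP iz]; apply: complex_eqP.
Qed.
Lemma normsq0 : normsq (0 : R[i]) = 0.
Proof. by rewrite /normsq /= expr0n /= addr0. Qed.
Lemma normsqE z : (normsq z)%:C = z * z^*.
Proof.
by apply: complex_eqP; rewrite ?ReM ?ImM ReJ ImJ /normsq /=; ring.
Qed.
Lemma normsqM z w : normsq (z * w) = normsq z * normsq w.
Proof. by rewrite /normsq ReM ImM; ring. Qed.
Lemma normsqN z : normsq (- z) = normsq z.
Proof. by rewrite /normsq ReN ImN !sqrrN. Qed.
Lemma normsqR r : normsq (r%:C) = r ^+ 2.
Proof. by rewrite /normsq /= expr0n /= addr0. Qed.
Lemma normsqJ z : normsq (z^*) = normsq z.
Proof. by rewrite /normsq ReJ ImJ sqrrN. Qed.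
Lemma normsqD z w : normsq (z + w) <= 2 * (normsq z + normsq w).
Proof.
rewrite /normsq ReD ImD -subr_ge0.
set a := complex.Re z; set b := complex.Re w.
set c := complex.Im z; set d := complex.Im w.
have -> : 2 * (a ^+ 2 + c ^+ 2 + (b ^+ 2 + d ^+ 2)) -
  ((a + b) ^+ 2 + (c + d) ^+ 2) = (a - b) ^+ 2 + (c - d) ^+ 2 by ring.
by rewrite addr_ge0 ?sqr_ge0.
Qed.

End ComplexParts.

Section ComplexIntegral.
Context {R : realType} {d : measure_display} {T : measurableType d}
  (m : {measure set T -> \bar R}) (D : set T) (mD : measurable D).
Implicit Types (f g h : T -> R[i]).
Local Open Scope complex_scope.

Definition cintegrable f :=
  m.-integrable D (EFin \o (fun x => complex.Re (f x))) /\
  m.-integrable D (EFin \o (fun x => complex.Im (f x))).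

Lemma eq_cintegral f g : (forall x, D x -> f x = g x) ->
  cintegral m D f = cintegral m D g.
Proof.
by move=> fg; rewrite /cintegral; congr (_ +i* _);
  apply: eq_Rintegral => x /set_mem /fg ->.
Qed.

Lemma eq_cintegrable f g : (forall x, D x -> f x = g x) ->
  cintegrable f -> cintegrable g.
Proof.
by move=> fg [h1 h2]; split; [move: h1|move: h2]; apply: eq_integrable => //;
  move=> x /set_mem /fg /= ->.
Qed.

Lemma cintegrableD f g : cintegrable f -> cintegrable g ->
  cintegrable (fun x => f x + g x).
Proof.
move=> [rf imf] [rg img]; split.
- have := integrableD mD rf rg; apply: eq_integrable => // x _ /=.
  by rewrite ReD EFinD.
- have := integrableD mD imf img; apply: eq_integrable => // x _ /=.
  by rewrite ImD EFinD.
Qed.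

Lemma cintegralD f g : cintegrable f -> cintegrable g ->
  cintegral m D (fun x => f x + g x) = cintegral m D f + cintegral m D g.
Proof.
move=> [rf imf] [rg img]; apply: complex_eqP.
- rewrite ReD /= -RintegralD//.
  by apply: eq_Rintegral => x _; rewrite ReD.
- rewrite ImD /= -RintegralD//.
  by apply: eq_Rintegral => x _; rewrite ImD.
Qed.

Lemma cintegrableZ (c : R[i]) f : cintegrable f ->
  cintegrable (fun x => c * f x).
Proof.
move=> [rf imf]; split.
- have := integrableB mD (integrableZl mD (complex.Re c) rf)
    (integrableZl mD (complex.Im c) imf).
  by apply: eq_integrable => // x _ /=; rewrite ReM EFinB !EFinM.
- have := integrableD mD (integrableZl mD (complex.Re c) imf)
    (integrableZl mD (complex.Im c) rf).
  by apply: eq_integrable => // x _ /=; rewrite ImM EFinD !EFinM.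
Qed.

Let RintZ (r : R) (u : T -> R) : m.-integrable D (EFin \o u) ->
  m.-integrable D (EFin \o (fun x => r * u x)).
Proof.
move=> iu; have := integrableZl mD r iu.
by apply: eq_integrable => // x _ /=; rewrite EFinM.
Qed.

Lemma cintegralZ (c : R[i]) f : cintegrable f ->
  cintegral m D (fun x => c * f x) = c * cintegral m D f.
Proof.
move=> [rf imf]; apply: complex_eqP.
- rewrite ReM /= -!RintegralZl// -RintegralB//; [|exact: RintZ..].
  by apply: eq_Rintegral => x _; rewrite ReM.
- rewrite ImM /= -!RintegralZl// -RintegralD//; [|exact: RintZ..].
  by apply: eq_Rintegral => x _; rewrite ImM.
Qed.

Lemma cintegrable0 : cintegrable (fun=> 0).
Proof. by split; exact: integrable0. Qed.

Lemma cintegral0 : cintegral m D (fun=> 0) = 0.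
Proof.
rewrite -[RHS](mul0r (cintegral m D (fun=> 0))) -(cintegralZ _ _ cintegrable0).
by apply: eq_cintegral => x _; rewrite mul0r.
Qed.

Lemma cintegrable_sum (J : Type) (s : seq J) (F : J -> T -> R[i]) :
  (forall j, cintegrable (F j)) ->
  cintegrable (fun x => \sum_(j <- s) F j x).
Proof.
move=> iF; elim: s => [|j s IH].
  by apply: eq_cintegrable cintegrable0 => x _; rewrite big_nil.
apply: eq_cintegrable (cintegrableD (F j) _ (iF j) IH) => x _.
by rewrite big_cons.
Qed.

Lemma cintegral_sum (J : Type) (s : seq J) (F : J -> T -> R[i]) :
  (forall j, cintegrable (F j)) ->
  cintegral m D (fun x => \sum_(j <- s) F j x)
  = \sum_(j <- s) cintegral m D (F j).
Proof.
move=> iF; elim: s => [|j s IH].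
  rewrite big_nil -[RHS]cintegral0.
  by apply: eq_cintegral => x _; rewrite big_nil.
rewrite big_cons -IH -cintegralD//; last exact: cintegrable_sum.
by apply: eq_cintegral => x _; rewrite big_cons.
Qed.

Lemma cintegrableB f g : cintegrable f -> cintegrable g ->
  cintegrable (fun x => f x - g x).
Proof.
move=> fi gi; apply: eq_cintegrable (cintegrableD f _ fi (cintegrableZ (-1) g gi)).
by move=> x _; rewrite mulN1r.
Qed.

Lemma cintegralB f g : cintegrable f -> cintegrable g ->
  cintegral m D (fun x => f x - g x) = cintegral m D f - cintegral m D g.
Proof.
move=> fi gi; rewrite -[- cintegral m D g]mulN1r -cintegralZ// -cintegralD//.
  by apply: eq_cintegral => x _; rewrite mulN1r.
exact: cintegrableZ.
Qed.

Lemma cintegral_conj f : cintegrable f ->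
  cintegral m D (fun x => (f x)^*) = (cintegral m D f)^*.
Proof.
move=> [rf imf]; apply: complex_eqP; rewrite ?ReJ ?ImJ /=.
  by apply: eq_Rintegral => x _; rewrite ReJ.
rewrite -mulN1r -RintegralZl//.
by apply: eq_Rintegral => x _; rewrite ImJ mulN1r.
Qed.

Lemma ae_eq_cintegral f g : cintegrable f -> cintegrable g ->
  L2eq m D f g -> cintegral m D f = cintegral m D g.
Proof.
move=> [rf imf] [rg img] fg; rewrite /cintegral /Rintegral.
congr (fine _ +i* fine _); apply: ae_eq_integral => //.
- exact: (measurable_int m).
- exact: (measurable_int m).
- by apply: filterS fg => x + Dx => /(_ Dx) /= ->.
- exact: (measurable_int m).
- exact: (measurable_int m).
- by apply: filterS fg => x + Dx => /(_ Dx) /= ->.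
Qed.

End ComplexIntegral.

Arguments cintegrableD {R d T m D}.
Arguments cintegrableB {R d T m D}.
Arguments cintegrableZ {R d T m D}.
Arguments eq_cintegrable {R d T m D}.

(** * Complex L2 spaces *)

Section L2Theory.
Context {R : realType} {d : measure_display} {T : measurableType d}
  (m : {measure set T -> \bar R}) (D : set T) (mD : measurable D).
Implicit Types (f g h : T -> R[i]).
Local Open Scope complex_scope.
Local Notation L2 := (L2 m D).
Local Notation inner := (L2inner m D).
Local Notation nsq := (L2normsq m D).

Lemma eq_L2 f g : (forall x, D x -> f x = g x) -> L2 f -> L2 g.
Proof.
move=> fg [rf imf nf]; split.
- by apply: eq_measurable_fun rf => x /set_mem /fg ->.
- by apply: eq_measurable_fun imf => x /set_mem /fg ->.
- rewrite (_ : nsq g = nsq f)//; apply: eq_integral => x /set_mem /fg ->//.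
Qed.

Lemma eq_nsq f g : (forall x, D x -> f x = g x) -> nsq f = nsq g.
Proof. by move=> fg; apply: eq_integral => x /set_mem /fg ->. Qed.

Lemma eq_inner f g f' g' : (forall x, D x -> f x = f' x) ->
  (forall x, D x -> g x = g' x) -> inner f g = inner f' g'.
Proof. by move=> ff gg; apply: eq_cintegral => x Dx; rewrite ff ?gg. Qed.

Lemma measurable_normsq f : measurable_fun D (fun x => complex.Re (f x)) ->
  measurable_fun D (fun x => complex.Im (f x)) ->
  measurable_fun D (fun x => (normsq (f x))%:E).
Proof.
move=> rf imf; apply/measurable_EFinP; apply: measurable_funD;
  exact: measurable_funX.
Qed.

Lemma L2_integrable_normsq f : L2 f ->
  m.-integrable D (fun x => (normsq (f x))%:E).
Proof.
move=> [rf imf nf]; apply/integrableP; split; first exact: measurable_normsq.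
rewrite (le_lt_trans _ nf)// le_eqVlt; apply/orP; left; apply/eqP.
by apply: eq_integral => x _; rewrite gee0_abs// lee_fin normsq_ge0.
Qed.

Let mulR_integrable f g (a b : R[i] -> R) : L2 f -> L2 g ->
  measurable_fun D (fun x => a (f x)) -> measurable_fun D (fun x => b (g x)) ->
  (forall z, (a z) ^+ 2 <= normsq z) -> (forall z, (b z) ^+ 2 <= normsq z) ->
  m.-integrable D (EFin \o (fun x => a (f x) * b (g x))).
Proof.
move=> Lf Lg ma mb an bn.
have := integrableD mD (L2_integrable_normsq _ Lf) (L2_integrable_normsq _ Lg).
apply: (le_integrable mD).
  by apply/measurable_EFinP; exact: measurable_funM.
move=> x _ /=; rewrite lee_fin [leRHS]ger0_norm; last by apply: addr_ge0; exact: normsq_ge0.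
have := an (f x); have := bn (g x).
set u := a (f x); set v := b (g x) => vn un.
have h1 := sqr_ge0 (u - v); have h2 := sqr_ge0 (u + v).
have h3 := sqr_ge0 u; have h4 := sqr_ge0 v.
rewrite ler_norml; apply/andP; split; nra.
Qed.

Lemma L2_mul_conj f g : L2 f -> L2 g ->
  cintegrable m D (fun x => f x * (g x)^*).
Proof.
move=> Lf Lg; have [rf imf _] := Lf; have [rg img _] := Lg.
have Ren z : (complex.Re z : R) ^+ 2 <= normsq z.
  by rewrite /normsq lerDl sqr_ge0.
have Imn z : (complex.Im z : R) ^+ 2 <= normsq z.
  by rewrite /normsq lerDr sqr_ge0.
split.
- have := integrableD mD (mulR_integrable _ _ _ _ Lf Lg rf rg Ren Ren)
    (mulR_integrable _ _ _ _ Lf Lg imf img Imn Imn).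
  apply: eq_integrable => // x _ /=.
  by rewrite ReM ReJ ImJ -EFinD; congr EFin; ring.
- have := integrableB mD (mulR_integrable _ _ _ _ Lf Lg imf rg Imn Ren)
    (mulR_integrable _ _ _ _ Lf Lg rf img Ren Imn).
  apply: eq_integrable => // x _ /=.
  by rewrite ImM ReJ ImJ -EFinB; congr EFin; ring.
Qed.

Lemma L20 : L2 (fun=> 0).
Proof.
split; [exact: measurable_cst|exact: measurable_cst|].
rewrite (_ : nsq _ = 0%E) ?ltry//.
by apply: integral0_eq => x _; rewrite normsq0.
Qed.

(** Two-term substitute for the triangle inequality: it avoids square roots, and
only finiteness and convergence to 0 are deduced from it. *)
Lemma nsqD_le f g : measurable_fun D (fun x => complex.Re (f x)) ->
  measurable_fun D (fun x => complex.Im (f x)) ->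
  measurable_fun D (fun x => complex.Re (g x)) ->
  measurable_fun D (fun x => complex.Im (g x)) ->
  (nsq (fun x => f x + g x)%R
  <= 2%:E * (nsq f + nsq g))%E.
Proof.
move=> rf imf rg img.
rewrite /L2normsq -ge0_integralD//; first last.
- exact: measurable_normsq.
- by move=> x _; rewrite lee_fin normsq_ge0.
- exact: measurable_normsq.
- by move=> x _; rewrite lee_fin normsq_ge0.
rewrite -ge0_integralZl//; first last.
- by move=> x _; rewrite adde_ge0// lee_fin normsq_ge0.
- by apply: emeasurable_funD; exact: measurable_normsq.
apply: ge0_le_integral => //.
- by move=> x _; rewrite lee_fin normsq_ge0.
- apply: measurable_normsq.
    by apply: eq_measurable_fun (measurable_funD rf rg) => x _; rewrite ReD.
  by apply: eq_measurable_fun (measurable_funD imf img) => x _; rewrite ImD.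
- apply: emeasurable_funM; first exact: measurable_cst.
  by apply: emeasurable_funD; exact: measurable_normsq.
- by move=> x _; rewrite -EFinD -EFinM lee_fin normsqD.
Qed.

Lemma L2D f g : L2 f -> L2 g -> L2 (fun x => f x + g x).
Proof.
move=> Lf Lg; have [rf imf nf] := Lf; have [rg img ng] := Lg; split.
- by apply: eq_measurable_fun (measurable_funD rf rg) => x _; rewrite ReD.
- by apply: eq_measurable_fun (measurable_funD imf img) => x _; rewrite ImD.
- apply: le_lt_trans (nsqD_le f g _ _ _ _) _ => //.
  by rewrite lte_mul_pinfty// lte_add_pinfty.
Qed.

Lemma nsqZ (c : R[i]) f : measurable_fun D (fun x => complex.Re (f x)) ->
  measurable_fun D (fun x => complex.Im (f x)) ->
  (nsq (fun x => c * f x)%R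
  = (normsq c)%:E * nsq f)%E.
Proof.
move=> rf imf; rewrite /L2normsq -ge0_integralZl//.
- by apply: eq_integral => x _; rewrite normsqM EFinM.
- exact: measurable_normsq.
- by move=> x _; rewrite lee_fin normsq_ge0.
- by rewrite lee_fin normsq_ge0.
Qed.

Lemma L2Z (c : R[i]) f : L2 f -> L2 (fun x => c * f x).
Proof.
move=> [rf imf nf]; split.
- have := measurable_funB (measurable_funM (measurable_cst (complex.Re c)) rf)
    (measurable_funM (measurable_cst (complex.Im c)) imf).
  by apply: eq_measurable_fun => x _ /=; rewrite ReM.
- have := measurable_funD (measurable_funM (measurable_cst (complex.Re c)) imf)
    (measurable_funM (measurable_cst (complex.Im c)) rf).
  by apply: eq_measurable_fun => x _ /=; rewrite ImM.
- by rewrite nsqZ// lte_mul_pinfty// lee_fin normsq_ge0.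
Qed.

Lemma L2B f g : L2 f -> L2 g -> L2 (fun x => f x - g x).
Proof.
move=> Lf Lg; apply: eq_L2 (L2D _ _ Lf (L2Z (-1) _ Lg)) => x _.
by rewrite mulN1r.
Qed.

Lemma L2_sum (J : Type) (s : seq J) (F : J -> T -> R[i]) :
  (forall j, L2 (F j)) -> L2 (fun x => \sum_(j <- s) F j x).
Proof.
move=> LF; elim: s => [|j s IH].
  by apply: eq_L2 L20 => x _; rewrite big_nil.
by apply: eq_L2 (L2D _ _ (LF j) IH) => x _; rewrite big_cons.
Qed.

Lemma inner_conj f g : L2 f -> L2 g -> inner g f = (inner f g)^*.
Proof.
move=> Lf Lg; rewrite /L2inner -cintegral_conj//; last exact: L2_mul_conj.
by apply: eq_cintegral => x _; rewrite rmorphM /= conjcK mulrC.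
Qed.

Lemma innerBl f g h : L2 f -> L2 g -> L2 h ->
  inner (fun x => f x - g x) h = inner f h - inner g h.
Proof.
move=> Lf Lg Lh; rewrite /L2inner -cintegralB//; [|exact: L2_mul_conj..].
by apply: eq_cintegral => x _; rewrite mulrBl.
Qed.

Lemma innerZl (c : R[i]) f g : L2 f -> L2 g ->
  inner (fun x => c * f x) g = c * inner f g.
Proof.
move=> Lf Lg; rewrite /L2inner -cintegralZ//; last exact: L2_mul_conj.
by apply: eq_cintegral => x _; rewrite mulrA.
Qed.

Lemma inner_suml (J : Type) (s : seq J) (F : J -> T -> R[i]) g :
  (forall j, L2 (F j)) -> L2 g ->
  inner (fun x => \sum_(j <- s) F j x) g = \sum_(j <- s) inner (F j) g.
Proof.
move=> LF Lg; rewrite /L2inner -cintegral_sum//; last first.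
  by move=> j; exact: L2_mul_conj.
by apply: eq_cintegral => x _; rewrite mulr_suml.
Qed.

Lemma inner_lin (J : Type) (s : seq J) (c : J -> R[i]) (F : J -> T -> R[i]) g :
  (forall j, L2 (F j)) -> L2 g ->
  inner (fun x => \sum_(j <- s) c j * F j x) g
  = \sum_(j <- s) c j * inner (F j) g.
Proof.
move=> LF Lg; rewrite (inner_suml _ s (fun j x => c j * F j x))//.
  by apply: eq_bigr => j _; rewrite innerZl.
by move=> j; exact: L2Z.
Qed.

Lemma inner_self f : L2 f -> inner f f = (fine (nsq f))%:C.
Proof.
move=> Lf; apply: complex_eqP => /=.
  by apply: eq_Rintegral => x _; rewrite -normsqE.
rewrite -[RHS](mul0r (Rintegral m D (fun=> 0))) -RintegralZl//; last first.
  exact: integrable0.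
by apply: eq_Rintegral => x _; rewrite -normsqE /= mul0r.
Qed.

Lemma nsq_ge0 f : (0 <= nsq f)%E.
Proof. by apply: integral_ge0 => x _; rewrite lee_fin normsq_ge0. Qed.

Lemma fine_nsqK f : L2 f -> ((fine (nsq f))%:E = nsq f)%E.
Proof. by case=> _ _ nf; rewrite fineK// ge0_fin_numE// nsq_ge0. Qed.

Lemma nsq0_L2eq f : L2 f -> nsq f = 0%E -> L2eq m D f (fun=> 0).
Proof.
move=> Lf n0; have [rf imf _] := Lf.
have mn := measurable_normsq _ rf imf.
have h : ae_eq m D (EFin \o (fun x => normsq (f x))) (cst 0%E).
  apply/(ae_eq_integral_abs m mD mn); rewrite -n0.
  by apply: eq_integral => x _; rewrite gee0_abs// lee_fin normsq_ge0.
by apply: filterS h => x + Dx => /(_ Dx) [] /normsq_eq0.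
Qed.

Lemma L2eq0_inner f g : L2 f -> L2 g -> L2eq m D f (fun=> 0) -> inner f g = 0.
Proof.
move=> Lf Lg f0; rewrite -(cintegral0 m D mD); apply: ae_eq_cintegral => //.
- exact: L2_mul_conj.
- exact: cintegrable0.
- by apply: filterS f0 => x + Dx => /(_ Dx) ->; rewrite mul0r.
Qed.

(** Convergence in L2 is only used to approximate within a prescribed error. *)
Lemma L2cvg_small (u : nat -> T -> R[i]) f (e : R) : L2cvg m D u f -> 0 < e ->
  exists N, forall n, (N <= n)%N ->
    (nsq (fun x => u n x - f x)%R < e%:E)%E.
Proof.
move=> uf e0.
have nb : nbhs (0%E : \bar R) [set y | (y < e%:E)%E].
  by apply: open_nbhs_nbhs; split; [exact: open_ereal_lt_ereal|rewrite /= lte_fin].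
by have [N _ hN] := uf _ nb; exists N => n Nn; exact: hN.
Qed.

End L2Theory.
Arguments L2cvg_small {R d T m D} u f e.
Arguments L2Z {R d T m D} mD c f.
Arguments L2_sum {R d T m D} mD J s F.

(** * Heat traces do not depend on the eigenbasis *)

Lemma esum_ord (R : realType) k (F : 'I_k -> R) : (forall i, 0 <= F i) ->
  (\esum_(i in [set: 'I_k]) (F i)%:E)%E = (\sum_i F i)%:E.
Proof.
move=> F0; have fin : finite_set [set: 'I_k] by exact: finite_finset.
rewrite esum_fset; [|by []|by move=> i _; rewrite lee_fin].
rewrite fsbig_finite//= -sumEFin; apply: perm_big.
apply: uniq_perm; [exact: fset_uniq|exact: index_enum_uniq|move=> i].
rewrite mem_index_enum; apply/idP; rewrite in_fset_set//; exact/mem_set.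
Qed.

Section Bessel.
Context {R : realType} {d : measure_display} {T : measurableType d}
  (m : {measure set T -> \bar R}) (D : set T) (mD : measurable D).
Context {I : choiceType} (phi : I -> T -> R[i]).
Local Open Scope complex_scope.
Local Notation L2 := (L2 m D).
Local Notation inner := (L2inner m D).
Local Notation nsq := (L2normsq m D).
Hypothesis Lphi : forall i, L2 (phi i).
Hypothesis on : forall i j, inner (phi i) (phi j) = (i == j)%:R.

(** The component of f orthogonal to the finite part s of the system. *)
Definition residual (s : seq I) (f : T -> R[i]) : T -> R[i] :=
  fun x => f x - \sum_(i <- s) inner f (phi i) * phi i x.

Let Lsum (s : seq I) (f : T -> R[i]) :
  L2 (fun x => \sum_(i <- s) inner f (phi i) * phi i x).
Proof. by apply: (L2_sum mD) => i; exact: (L2Z mD). Qed.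

Lemma L2_residual s f : L2 f -> L2 (residual s f).
Proof. by move=> Lf; apply: (L2B _ _ mD). Qed.

Lemma inner_residual s f g : L2 f -> L2 g ->
  inner (residual s f) g
  = inner f g - \sum_(i <- s) inner f (phi i) * inner (phi i) g.
Proof.
by move=> Lf Lg; rewrite /residual innerBl// inner_lin.
Qed.

Lemma residual_orth s f i : L2 f -> uniq s ->
  inner (residual s f) (phi i) = if i \in s then 0 else inner f (phi i).
Proof.
move=> Lf us; rewrite inner_residual//.
have [si|si] := ifPn.
  rewrite (bigD1_seq i)//= on eqxx mulr1 big1 ?addr0 ?subrr// => k /negbTE ki.
  by rewrite on ki mulr0.
rewrite big_seq big1 ?subr0// => k ks.
by rewrite on (_ : k == i = false) ?mulr0//; apply: contraNF si => /eqP <-.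
Qed.

Lemma residual_self s f : L2 f ->
  inner (residual s f) f
  = (fine (nsq f) - \sum_(i <- s) normsq (inner f (phi i)))%:C.
Proof.
move=> Lf; rewrite inner_residual// inner_self// [RHS]rmorphB /=; congr (_ - _).
rewrite rmorph_sum /=; apply: eq_bigr => i _.
by rewrite normsqE [inner (phi i) f](inner_conj _ _ mD).
Qed.

(** The residual r is orthogonal to each subtracted term, so <r, r> = <r, f>, which
is the difference of the two sides. *)
Lemma bessel s f : L2 f -> uniq s ->
  \sum_(i <- s) normsq (inner f (phi i)) <= fine (nsq f).
Proof.
move=> Lf us; have Lr := L2_residual s f Lf.
have rr : inner (residual s f) (residual s f) = inner f (residual s f).
  rewrite [LHS]inner_residual// big_seq big1 ?subr0// => i si.
  by rewrite [inner (phi i) _](inner_conj _ _ mD)// residual_orth// si conjc0 mulr0.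
move: rr; rewrite [RHS](inner_conj _ _ mD)// residual_self// conjc_real.
by rewrite inner_self// => -[] h; rewrite -subr_ge0 -h fine_ge0// nsq_ge0.
Qed.

(** For an eigenvector only the phi i with the same eigenvalue contribute, and
these are finitely many: finite sums suffice for Parseval's identity. *)
Lemma parseval_finite s f : L2 f -> uniq s ->
  (forall i, i \notin s -> inner f (phi i) = 0) ->
  L2eq m D (residual s f) (fun=> 0) ->
  fine (nsq f) = \sum_(i <- s) normsq (inner f (phi i)).
Proof.
move=> Lf us fs r0; apply/eqP; rewrite -subr_eq0; apply/eqP/complexI.
by rewrite -residual_self// L2eq0_inner//; exact: L2_residual.
Qed.

End Bessel.

Section HeatTrace.
Context {R : realType} {d : measure_display} {T : measurableType d}
  (m : {measure set T -> \bar R}) (D : set T) (mD : measurable D).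
Local Open Scope complex_scope.
Local Notation L2 := (L2 m D).
Local Notation inner := (L2inner m D).
Local Notation nsq := (L2normsq m D).
Context (H : set (T -> R[i])) (A : set ((T -> R[i]) * (T -> R[i]))).
Hypothesis HL2 : forall f, H f -> L2 f.
Hypothesis Hlin : forall f g (c : R[i]), H f -> H g ->
  H (fun x => f x - c * g x).

Definition finite_multiplicities (I : choiceType) (lambda : I -> R) :=
  forall c, exists s : seq I, forall i, lambda i = c -> i \in s.

Lemma H_residual (I : choiceType) (phi : I -> T -> R[i]) s f :
  (forall i, H (phi i)) -> H f -> H (residual m D phi s f).
Proof.
move=> Hphi Hf; rewrite /residual.
pose c i := inner f (phi i).
elim: s => [|i s IH].
  by under eq_fun do rewrite big_nil subr0.
rewrite (_ : (fun x => _) = (fun x =>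
  (f x - \sum_(k <- s) c k * phi k x) - c i * phi i x)).
  exact: (Hlin (fun x => f x - \sum_(k <- s) c k * phi k x)).
by apply/funext => x; rewrite big_cons opprD addrCA addrC.
Qed.

Lemma unit_nsq f : L2 f -> inner f f = 1 -> fine (nsq f) = 1.
Proof. by move=> Lf; rewrite inner_self// => -[]. Qed.

Section TwoBases.
Context (I J : choiceType) (phi : I -> T -> R[i]) (lambda : I -> R)
  (psi : J -> T -> R[i]) (kappa : J -> R).
Hypothesis ephi : eigenbasis m D H A phi lambda.
Hypothesis epsi : eigenbasis m D H A psi kappa.
Hypothesis fin_lambda : finite_multiplicities I lambda.
Hypothesis cross : forall i j,
  inner (psi j) (phi i) != 0 -> kappa j = lambda i.

Let Hphi i : H (phi i). Proof. by have [+ _ _ _] := ephi; apply. Qed.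
Let Hpsi i : H (psi i). Proof. by have [+ _ _ _] := epsi; apply. Qed.
Let Lphi i : L2 (phi i). Proof. exact: HL2. Qed.
Let Lpsi i : L2 (psi i). Proof. exact: HL2. Qed.
Let onphi i j : inner (phi i) (phi j) = (i == j)%:R.
Proof. by have [_ _ + _] := ephi; apply. Qed.
Let onpsi i j : inner (psi i) (psi j) = (i == j)%:R.
Proof. by have [_ _ + _] := epsi; apply. Qed.

(** psi j lies in the span of the finitely many phi i that share its eigenvalue:
its residual is orthogonal to all phi i, hence null by completeness. *)
Lemma overlap_sum1 s j : uniq s -> (forall i, lambda i = kappa j -> i \in s) ->
  \sum_(i <- s) normsq (inner (psi j) (phi i)) = 1.
Proof.
move=> us sl.
have out i : i \notin s -> inner (psi j) (phi i) = 0.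
  move=> /negP si; apply/eqP/negPn/negP => /cross kl; apply: si.
  exact/sl/esym.
rewrite -(unit_nsq (psi j))//; last by rewrite onpsi eqxx.
apply/esym/(parseval_finite m D mD) => //.
have [_ _ _ +] := ephi; apply; first exact: H_residual.
move=> i; rewrite residual_orth//.
by case: ifPn => // /out.
Qed.

Lemma overlap_sum_le1 s i : uniq s ->
  \sum_(j <- s) normsq (inner (psi j) (phi i)) <= 1.
Proof.
move=> us; rewrite -(unit_nsq (phi i))//; last by rewrite onphi eqxx.
apply: le_trans (bessel m D mD psi Lpsi onpsi s (phi i) (Lphi i) us).
apply: ler_sum => j _; rewrite [inner (phi i) _](inner_conj _ _ mD)//.
by rewrite normsqJ.
Qed.

(** If kappa took the value c at more indices than lambda does, summing the
squared overlaps in both orders would contradict [overlap_sum1] and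
[overlap_sum_le1]. *)
Lemma finite_multiplicities_transfer : finite_multiplicities J kappa.
Proof.
move=> c; have [s0 s0c] := fin_lambda c.
(* Any s' is bounded by s: both sizes compare with the total of the overlaps. *)
pose s := undup s0.
have bound (s' : seq J) : uniq s' -> (forall j, j \in s' -> kappa j = c) ->
    (size s' <= size s)%N.
  move=> us' s'c; rewrite -(ler_nat R).
  have -> : ((size s')%:R : R) = \sum_(j <- s') 1.
    by rewrite big_const_seq count_predT iter_addr addr0.
  have -> : ((size s)%:R : R) = \sum_(i <- s) 1.
    by rewrite big_const_seq count_predT iter_addr addr0.
  rewrite big_seq (eq_bigr (fun j =>
      \sum_(i <- s) normsq (inner (psi j) (phi i)))); last first.
    move=> j js; rewrite overlap_sum1 ?undup_uniq// => i li.
    by rewrite mem_undup s0c// li s'c.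
  by rewrite -big_seq exchange_big; apply: ler_sum => i _; exact: overlap_sum_le1.
have fin : finite_set [set j | kappa j = c].
  apply: contrapT => /(infinite_set_fset (size s).+1)[B Bc].
  apply/negP; rewrite -ltnNge ltnS; apply: bound; first exact: fset_uniq.
  by move=> j jB; apply: Bc.
have /finite_seqP[s' s'E] := fin.
by exists s' => j jc; have : [set j | kappa j = c] j by []; rewrite s'E.
Qed.

(** The squared overlaps form a matrix, supported on pairs of equal eigenvalues,
with sums 1 along psi j and at most 1 along phi i; spreading each term of the
left side along it bounds every finite partial sum by the right side. *)
Lemma eigenbasis_trace_le (t : R) :
  (\esum_(j in [set: J]) (expR (- (kappa j * t)))%:E
   <= \esum_(i in [set: I]) (expR (- (lambda i * t)))%:E)%E.
Proof.
apply: ge_ereal_sup => _ [X [finX _] <-].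
rewrite fsbig_finite//=.
have us' := fset_uniq (fset_set X).
move: (enum_fset _) us' => s' us'.
have [s [us sc]] : exists s, uniq s /\
    forall i j, j \in s' -> lambda i = kappa j -> i \in s.
  elim: {us'} s' => [|j s' [s [us sc]]]; first by exists [::].
  have [s1 s1c] := fin_lambda (kappa j).
  exists (undup (s1 ++ s)); split; first exact: undup_uniq.
  move=> i k; rewrite inE mem_undup mem_cat => /orP[/eqP-> /s1c->//|ks' lk].
  by rewrite (sc _ _ ks' lk) orbT.
apply: esum_ge; exists [set i | i \in s]; first by split => //; exact: finite_seq.
rewrite -fsbig_seq// !sumEFin lee_fin.
rewrite [leLHS](_ : _ = \sum_(j <- s') \sum_(i <- s)
    expR (- (lambda i * t)) * normsq (inner (psi j) (phi i))); last first.
  apply: eq_big_seq => j js'.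
  rewrite -[LHS]mulr1 -(overlap_sum1 s j us); last by move=> i; exact: sc.
  rewrite mulr_sumr; apply: eq_bigr => i _.
  have [->|/cross ->//] := eqVneq (inner (psi j) (phi i)) 0.
  by rewrite normsq0 !mulr0.
rewrite exchange_big; apply: ler_sum => i _ /=.
by rewrite -mulr_sumr ler_piMr ?expR_ge0// overlap_sum_le1.
Qed.

End TwoBases.

(** The last hypothesis expresses symmetry of the operator. For an operator given
by the closure of its graph it cannot be read off the graph, and is easier to
verify for a basis of nice functions phi than for arbitrary eigenvectors. *)
Theorem heat_traceE (I : choiceType) (phi : I -> T -> R[i]) (lambda : I -> R)
    (t : R) :
  eigenbasis m D H A phi lambda ->
  finite_multiplicities I lambda ->
  (forall f (k : R) i, H f -> A (f, fun x => k%:C * f x) ->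
    inner f (phi i) != 0 -> k = lambda i) ->
  heat_trace m D H A t = (\esum_(i in [set: I]) (expR (- (lambda i * t)))%:E)%E.
Proof.
move=> ephi fin cross; rewrite /heat_trace.
case: xgetP => [s _|/(_ (\esum_(i in [set: I]) (expR (- (lambda i * t)))%:E)%E)].
  2: by move=> no; exfalso; apply: no; exists I, phi, lambda.
move=> [J [psi [kappa [epsi ->]]]].
have c1 i j : inner (psi j) (phi i) != 0 -> kappa j = lambda i.
  by have [Hp Ap _ _] := epsi => ?; apply: cross (Hp j) (Ap j) _.
have c2 i j : inner (phi j) (psi i) != 0 -> lambda j = kappa i.
  move=> h; apply/esym/c1; apply: contraNN h => /eqP h.
  rewrite (inner_conj _ _ mD) ?h ?conjc0//; apply: HL2.
    by have [+ _ _ _] := epsi; apply.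
  by have [+ _ _ _] := ephi; apply.
apply/eqP; rewrite eq_le; apply/andP; split.
- exact: (eigenbasis_trace_le I J phi lambda psi kappa).
- apply: (eigenbasis_trace_le J I psi kappa phi lambda) => //.
  exact: (finite_multiplicities_transfer I J phi lambda psi kappa).
Qed.

End HeatTrace.

(** * The p-adic absolute value *)

Section PadicAbs.
Context {R : realType} {p : nat} (p_prime : prime p) {K : padic_field R p}.
Local Notation q := (p%:R : R).
Implicit Types (x y z : K) (k : int).

Lemma q_gt1 : 1 < q. Proof. by rewrite ltr1n prime_gt1. Qed.
Lemma q_gt0 : 0 < q. Proof. exact: lt_trans ltr01 q_gt1. Qed.
Lemma q_neq0 : q != 0. Proof. by rewrite gt_eqF ?q_gt0. Qed.
Lemma qX_gt0 k : 0 < q ^ k. Proof. by rewrite exprz_gt0 ?q_gt0. Qed.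
Lemma le_qX k l : (q ^ k <= q ^ l) = (k <= l).
Proof. by rewrite ler_eXz2l ?q_gt1. Qed.
Lemma lt_qX k l : (q ^ k < q ^ l) = (k < l).
Proof. by rewrite ltr_eXz2l ?q_gt1. Qed.

Lemma pabs0 : pabs (0 : K) = 0. Proof. exact/pabs_eq0. Qed.
Lemma pabs1 : pabs (1 : K) = 1.
Proof. by rewrite -[1]/(1%:R) pabs_nat// logn1 expr0 invr1. Qed.
Lemma pabs_neq0 x : x != 0 -> 0 < pabs x.
Proof.
move=> x0; rewrite lt_neqAle pabs_ge0 andbT eq_sym.
by apply: contraNN x0 => /eqP/pabs_eq0 ->.
Qed.
Lemma pabsN x : pabs (- x) = pabs x.
Proof.
rewrite -mulN1r pabsM (_ : pabs (-1 : K) = 1) ?mul1r//.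
have /eqP : pabs (-1 : K) ^+ 2 = 1 by rewrite expr2 -pabsM mulrNN mulr1 pabs1.
rewrite sqrf_eq1 => /orP[/eqP//|/eqP h].
by have := pabs_ge0 (-1 : K); rewrite h ler0N1.
Qed.
Lemma pabsC x y : pabs (x - y) = pabs (y - x).
Proof. by rewrite -pabsN opprB. Qed.
Lemma pabsV x : pabs (x^-1) = (pabs x)^-1.
Proof.
have [->|x0] := eqVneq x 0; first by rewrite invr0 pabs0 invr0.
have xn : pabs x != 0 by rewrite gt_eqF ?pabs_neq0.
by apply: (mulfI xn); rewrite -pabsM divff// divff// pabs1.
Qed.
Lemma pabs_ultra_le x y (r : R) : pabs x <= r -> pabs y <= r -> pabs (x + y) <= r.
Proof. by move=> xr yr; rewrite (le_trans (pabs_ultra _ _))// ge_max xr. Qed.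
Lemma pabs_ultra_lt x y (r : R) : pabs x < r -> pabs y < r -> pabs (x + y) < r.
Proof. by move=> xr yr; rewrite (le_lt_trans (pabs_ultra _ _))// gt_max xr. Qed.
Lemma pabs_dist_le y x z (r : R) :
  pabs (x - y) <= r -> pabs (y - z) <= r -> pabs (x - z) <= r.
Proof. by move=> h1 h2; rewrite -(subrK y x) -addrA pabs_ultra_le. Qed.
Lemma pabs_dist_lt y x z (r : R) :
  pabs (x - y) < r -> pabs (y - z) < r -> pabs (x - z) < r.
Proof. by move=> h1 h2; rewrite -(subrK y x) -addrA pabs_ultra_lt. Qed.
Lemma pabs_isosceles x y : pabs x < pabs y -> pabs (x + y) = pabs y.
Proof.
move=> xy; apply/eqP; rewrite eq_le; apply/andP; split.
  by apply: pabs_ultra_le => //; exact: ltW.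
rewrite leNgt; apply/negP => h.
have : pabs y < pabs y.
  by rewrite -{1}(addKr x y) pabs_ultra_lt// pabsN.
by rewrite ltxx.
Qed.
Lemma pabsX x n : pabs (x ^+ n) = pabs x ^+ n.
Proof. by elim: n => [|n IH]; rewrite ?pabs1// !exprS pabsM IH. Qed.
Lemma pabs_p : pabs (p%:R : K) = q^-1.
Proof. by rewrite pabs_nat ?prime_gt0// logn_prime// eqxx expr1. Qed.
Lemma pabs_natr n : pabs (n%:R : K) <= 1.
Proof.
case: n => [|n]; first by rewrite pabs0.
by rewrite pabs_nat// invf_le1 ?exprn_gt0 ?q_gt0// exprn_ege1// ltW ?q_gt1.
Qed.
Lemma pabs_nat_lt1 n : (pabs (n%:R : K) < 1) = (p %| n)%N.
Proof.
case: n => [|n]; first by rewrite pabs0 ltr01 dvdn0.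
rewrite pabs_nat// invf_lt1 ?exprn_gt0 ?q_gt0//.
have -> : (p %| n.+1)%N = (0 < logn p n.+1)%N.
  by rewrite logn_gt0 mem_primes p_prime.
case: (posnP (logn p n.+1)) => [->|h]; first by rewrite expr0 ltxx.
by rewrite exprn_egt1 ?q_gt1// -lt0n.
Qed.
Lemma pabs_nat_eq1 n : ~~ (p %| n)%N -> pabs (n%:R : K) = 1.
Proof.
rewrite -pabs_nat_lt1 -leNgt => h; apply/eqP.
by rewrite eq_le h pabs_natr.
Qed.

Lemma pabs_int (z : int) : pabs (z%:~R : K) = pabs (`|z|%N%:R : K).
Proof. by case: z => n //=; rewrite NegzE mulrNz pabsN. Qed.

(** The value group: x is close to a rational number, whose absolute value is a
power of p, and an ultrametric absolute value is locally constant away from 0. *)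
Lemma pabs_value x : x != 0 -> exists k, pabs x = q ^ k.
Proof.
move=> x0; have [r xr] := pabs_dense x (pabs_neq0 x x0).
have xE : pabs (ratr r : K) = pabs x.
  rewrite -[ratr r](subrK x) pabs_isosceles// -pabsN opprB//.
have nat0 n : (0 < n)%N -> exists k, pabs (n%:R : K) = q ^ k.
  by move=> n0; exists (- (logn p n)%:Z); rewrite pabs_nat// exprnN.
have r0 : r != 0.
  by apply: contraNneq x0 => r0; apply/eqP/pabs_eq0; rewrite -xE r0 /ratr mul0r pabs0.
have [k1 e1] : exists k, pabs ((numq r)%:~R : K) = q ^ k.
  by rewrite pabs_int; apply: nat0; rewrite absz_gt0 numq_eq0.
have [k2 e2] : exists k, pabs ((denq r)%:~R : K) = q ^ k.
  by rewrite pabs_int; apply: nat0; rewrite absz_gt0 denq_eq0.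
exists (k1 - k2); rewrite -xE /ratr pabsM pabsV e1 e2.
by rewrite expfzDr ?q_neq0// invr_expz.
Qed.

(** The value group is discrete. *)
Lemma pabs_lt_le x k : (pabs x < q ^ k) = (pabs x <= q ^ (k - 1)).
Proof.
have [->|x0] := eqVneq x 0; first by rewrite pabs0 qX_gt0 ltW ?qX_gt0.
by have [l ->] := pabs_value x x0; rewrite lt_qX le_qX -ltzD1 subrK.
Qed.

(** Z_p / p Z_p is F_p. A rational r near x is a / b with b prime to p, and the
digit is a times an inverse of b modulo p. *)
Lemma digit_exists x : pabs x <= 1 ->
  exists2 d : nat, (d < p)%N & pabs (x - d%:R) <= q^-1.
Proof.
move=> x1; have [r xr] := pabs_dense x (@ltr01 R).
have r1 : pabs (ratr r : K) <= 1.
  rewrite -[ratr r](subrK x) pabs_ultra_le// pabsC ltW//.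
set a := numq r; set b := denq r.
have pb : coprimez b p%:Z.
  rewrite /coprimez /gcdz /= -[_ == _]/(coprime _ _) coprime_sym prime_coprime//.
  apply/negP => pb.
  have b1 : pabs (b%:~R : K) < 1 by rewrite pabs_int pabs_nat_lt1.
  have a1 : pabs (a%:~R : K) < 1.
    have -> : a%:~R = ratr r * b%:~R :> K.
      rewrite /ratr divfK//; apply/eqP => b0.
      have := pabs_neq0 (x - ratr r); move: r1.
      have : pabs (b%:~R : K) = 0 by rewrite b0 pabs0.
      rewrite pabs_int pabs_nat ?absz_gt0 ?denq_eq0//.
      by move/eqP; rewrite invr_eq0 expf_eq0 (negbTE q_neq0) andbF.
    by rewrite pabsM (le_lt_trans _ b1)// ler_piMl// pabs_ge0.
  move: a1; rewrite pabs_int pabs_nat_lt1 => pa.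
  have := coprime_num_den r; rewrite /coprime => /eqP g1.
  have : (p %| gcdn `|a| `|b|)%N by rewrite dvdn_gcd pa pb.
  by rewrite g1 dvdn1 => /eqP p1; move: p_prime; rewrite p1.
have [[u v]/= uv] := coprimezP _ _ pb.
have p0 : p%:Z != 0 by rewrite eqz_nat -lt0n prime_gt0.
have dpos : 0 <= ((u * a) %% p)%Z by rewrite modz_ge0.
exists `|((u * a) %% p)%Z|%N.
  by rewrite -ltz_nat gez0_abs// ltz_pmod// ltz_nat prime_gt0.
set d := `|_|%N.
have bn1 : pabs (b%:~R : K) = 1.
  rewrite pabs_int pabs_nat_eq1//; apply/negP => pb'.
  move: pb; rewrite /coprimez /gcdz /= -[_ == _]/(coprime _ _) coprime_sym.
  by rewrite prime_coprime// pb'.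
have b0 : (b%:~R : K) != 0.
  by apply/eqP => b0; move: bn1; rewrite b0 pabs0 => /esym/eqP; rewrite oner_eq0.
rewrite -(expr1z q) invr_expz -[- 1%Z]add0r -pabs_lt_le expr0z.
apply: (pabs_dist_lt (ratr r)) => //.
have -> : ratr r - d%:R = (a - d%:Z * b)%:~R / b%:~R :> K.
  by rewrite intrB intrM mulrBl mulfK// /ratr -/a -/b.
rewrite pabsM pabsV bn1 invr1 mulr1 pabs_int pabs_nat_lt1.
rewrite -[(p %| _)%N]/((p%:Z %| a - d%:Z * b)%Z).
rewrite /d gez0_abs//.
have -> : a - ((u * a) %% p)%Z * b
  = ((u * a) %/ p)%Z * b * p + a * v * p.
  have e := divz_eq (u * a) p.
  have -> : ((u * a) %% p)%Z = u * a - ((u * a) %/ p)%Z * p.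
    by rewrite {2}e addrAC subrr add0r.
  rewrite -[X in X - _](mulr1 a) -uv; ring.
by apply: rpredD; exact: dvdz_mull.
Qed.

(** * Truncated p-adic expansions *)

Lemma truncation_exists n x : pabs x <= 1 ->
  exists2 c : nat, (c < p ^ n)%N & pabs (x - c%:R) <= q ^- n.
Proof.
move=> x1; elim: n => [|n [c cn xc]].
  by exists 0%N => //; rewrite subr0 expr0 invr1.
have pn0 : (p%:R ^+ n : K) != 0.
  rewrite expf_eq0 negb_and -leqNgt; apply/orP; right.
  by apply/eqP => h; have := pabs_p; rewrite h pabs0 => /esym/eqP; rewrite invr_eq0 (negbTE q_neq0).
have [|d dp xd] := digit_exists ((x - c%:R) / p%:R ^+ n).
  rewrite pabsM pabsV pabsX pabs_p exprVn invrK.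
  by rewrite -ler_pdivlMr ?exprn_gt0 ?q_gt0// div1r.
exists (c + d * p ^ n)%N.
  rewrite expnS (@leq_trans (p ^ n + d * p ^ n))%N// ?ltn_add2r//.
  by rewrite -mulSn leq_mul2r dp orbT.
have -> : x - (c + d * p ^ n)%:R
  = ((x - c%:R) / p%:R ^+ n - d%:R) * p%:R ^+ n :> K.
  by rewrite mulrBl divfK// natrD natrM natrX opprD addrA.
rewrite pabsM pabsX pabs_p exprVn exprS invfM.
by rewrite ler_wpM2r// invr_ge0 exprn_ge0// ltW ?q_gt0.
Qed.

Lemma nat_close n c c' : (c < p ^ n)%N -> (c' < p ^ n)%N ->
  pabs (c%:R - c'%:R : K) <= q ^- n -> c = c'.
Proof.
wlog cc : c c' / (c' <= c)%N.
  move=> h cn cn' d; case: (leqP c' c) => [cc|/ltnW cc]; first exact: h.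
  by apply/esym/h => //; rewrite pabsC.
move=> cn cn'; rewrite -natrB//.
case: (posnP (c - c')) => [/eqP e _|e].
  by apply/eqP; rewrite eqn_leq cc andbT -subn_eq0.
rewrite pabs_nat// lef_pV2 ?posrE ?exprn_gt0 ?q_gt0//.
rewrite ler_eXn2l ?q_gt1// => /(dvdn_exp2l p) h.
have := dvdn_trans h (pfactor_dvdnn p (c - c')) => /(dvdn_leq e).
by rewrite leqNgt (leq_ltn_trans (leq_subr _ _) cn).
Qed.

(** The integer formed by the first n digits of x; meaningful when x is an integer
of the field. *)
Definition truncation n x : nat :=
  xget 0%N [set c | (c < p ^ n)%N /\ pabs (x - c%:R) <= q ^- n].

Lemma truncationP n x : pabs x <= 1 ->
  (truncation n x < p ^ n)%N /\ pabs (x - (truncation n x)%:R) <= q ^- n.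
Proof.
move=> x1; rewrite /truncation; case: xgetP => [c _ []//|no].
by have [c c1 c2] := truncation_exists n x x1; case: (no c); split.
Qed.

Lemma truncation_lt n x : pabs x <= 1 -> (truncation n x < p ^ n)%N.
Proof. by case/(truncationP n). Qed.

Lemma truncation_near n x : pabs x <= 1 -> pabs (x - (truncation n x)%:R) <= q ^- n.
Proof. by case/(truncationP n). Qed.

Lemma truncation_unique n x c : (c < p ^ n)%N ->
  pabs x <= 1 -> pabs (x - c%:R) <= q ^- n -> truncation n x = c.
Proof.
move=> cn x1 xc; apply: (@nat_close n) => //; first exact: truncation_lt.
apply: (pabs_dist_le x) => //; rewrite pabsC; exact: truncation_near.
Qed.

Lemma truncation_eq n x y : pabs x <= 1 -> pabs y <= 1 ->
  (truncation n x = truncation n y) <-> pabs (x - y) <= q ^- n.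
Proof.
move=> x1 y1; split=> [e|d].
  apply: (pabs_dist_le (truncation n x)%:R); first exact: truncation_near.
  by rewrite e pabsC; exact: truncation_near.
apply: truncation_unique => //; first exact: truncation_lt.
by apply: (pabs_dist_le y) => //; exact: truncation_near.
Qed.

Lemma truncation_nat n c : (c < p ^ n)%N -> truncation n c%:R = c.
Proof.
move=> cn; apply: truncation_unique => //; first exact: pabs_natr.
by rewrite subrr pabs0 invr_ge0 exprn_ge0// ltW ?q_gt0.
Qed.

Lemma qVX_le m n : (m <= n)%N -> q ^- n <= q ^- m.
Proof.
by move=> mn; rewrite lef_pV2 ?posrE ?exprn_gt0 ?q_gt0// ler_eXn2l ?q_gt1.
Qed.

Lemma pabs_pX_dvd n c : (p ^ n %| c)%N -> pabs (c%:R : K) <= q ^- n.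
Proof.
move=> /dvdnP[k ->]; rewrite natrM natrX pabsM pabsX pabs_p exprVn.
by rewrite ler_piMl ?pabs_natr// invr_ge0 exprn_ge0// ltW ?q_gt0.
Qed.

(** Coherence: the truncations of x refine one another, so that passing from level
n to a coarser level is reduction modulo a power of p. *)
Lemma truncation_mod m n x : (m <= n)%N -> pabs x <= 1 ->
  truncation m x = (truncation n x %% p ^ m)%N.
Proof.
move=> mn x1; apply: truncation_unique => //.
  by rewrite ltn_mod expn_gt0 prime_gt0.
apply: (pabs_dist_le (truncation n x)%:R).
  by apply: le_trans (truncation_near n x x1) (qVX_le _ _ mn).
rewrite -natrB ?leq_mod// pabs_pX_dvd//.
by rewrite {1}(divn_eq (truncation n x) (p ^ m)) addnK dvdn_mull.
Qed.

Lemma qVX_small (e : R) : 0 < e -> exists n, q ^- n < e.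
Proof.
move=> e0; exists (Num.bound e^-1).
rewrite invf_plt ?posrE ?exprn_gt0 ?q_gt0//.
have h := archi_boundP (ltW (_ : 0 < e^-1)); rewrite invr_gt0 in h.
apply: (lt_le_trans (h e0)).
by rewrite -natrX ler_nat ltnW// ltn_expl// prime_gt1.
Qed.

(** Koenig's lemma, in place of compactness of the unit ball. If no level works
for all x, some residue is bad at every level and the bad residues can be chosen
coherently; by completeness they converge to a point, at which Q must hold at
some level. *)
Lemma koenig (Q : nat -> nat -> Prop) :
  (forall n x, pabs x <= 1 -> Q n (truncation n x) -> Q n.+1 (truncation n.+1 x)) ->
  (forall x : K, pabs x <= 1 -> exists n, Q n (truncation n x)) ->
  exists N, forall x : K, pabs x <= 1 -> Q N (truncation N x).
Proof.
move=> Qmono Qall; apply: contrapT => noN.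
have Qm n m x : pabs x <= 1 -> (n <= m)%N -> Q n (truncation n x) -> Q m (truncation m x).
  move=> x1; elim: m => [|m IH]; first by rewrite leqn0 => /eqP ->.
  by rewrite leq_eqVlt => /predU1P[->//|nm] h; apply: Qmono => //; exact: IH.
(* No level works for the points whose truncation at level n is c. *)
pose bad n c := (c < p ^ n)%N /\
  ~ exists N, forall x : K, pabs x <= 1 -> truncation n x = c -> Q N (truncation N x).
have bad0 : bad 0%N 0%N.
  split=> // -[N h]; apply: noN; exists N => x x1; apply: h => //.
  by have := truncation_lt 0 x x1; rewrite ltnS leqn0 => /eqP.
have badS n c : bad n c -> exists c', bad n.+1 c' /\ (c' %% p ^ n = c)%N.
  move=> [cn nc]; apply: contrapT => no; apply: nc.
  have good c' : (c' < p ^ n.+1)%N -> (c' %% p ^ n = c)%N -> exists N,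
      forall x : K, pabs x <= 1 -> truncation n.+1 x = c' -> Q N (truncation N x).
    by move=> c1 c2; apply: contrapT => nb; apply: no; exists c'.
  have [f fP] : {f : nat -> nat & forall c', (c' < p ^ n.+1)%N ->
      (c' %% p ^ n = c)%N ->
      forall x : K, pabs x <= 1 -> truncation n.+1 x = c' -> Q (f c') (truncation (f c') x)}.
    apply: (@choice _ _ (fun c' N => (c' < p ^ n.+1)%N ->
      (c' %% p ^ n = c)%N ->
      forall x : K, pabs x <= 1 -> truncation n.+1 x = c' -> Q N (truncation N x))) => c'.
    case: (ltnP c' (p ^ n.+1)) => h1; last by exists 0%N.
    have [h2|h2] := eqVneq (c' %% p ^ n)%N c; last first.
      by exists 0%N => _ e; rewrite e eqxx in h2.
    by have [N hN] := good c' h1 h2; exists N.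
  exists (\max_(c' < p ^ n.+1) f c') => x x1 xc.
  have cl := truncation_lt n.+1 x x1.
  apply: (Qm (f (truncation n.+1 x))) => //.
    exact: (@leq_bigmax _ (fun i : 'I_(p ^ n.+1) => f i) (Ordinal cl)).
  by apply: fP => //; rewrite -xc -truncation_mod.
have [step stepP] : {step : nat -> nat -> nat & forall n c, bad n c ->
    bad n.+1 (step n c) /\ (step n c %% p ^ n = c)%N}.
  have : forall nc : nat * nat, exists c', bad nc.1 nc.2 ->
      bad nc.1.+1 c' /\ (c' %% p ^ nc.1 = nc.2)%N.
    move=> [n c] /=; have [b|nb] := pselect (bad n c).
      by have [c' h] := badS n c b; exists c'.
    by exists 0%N => b; exfalso; exact: nb.
  by move=> /choice[f h]; exists (fun n c => f (n, c)) => n c; exact: (h (n, c)).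
pose u := fix u n := if n is n'.+1 then step n' (u n') else 0%N.
have ub n : bad n (u n) by elim: n => //= n /stepP[].
have umod n m : (n <= m)%N -> (u m %% p ^ n = u n)%N.
  elim: m => [|m IH]; first by rewrite leqn0 => /eqP ->; rewrite modn_small.
  rewrite leq_eqVlt => /predU1P[->|].
    by rewrite modn_small//; case: (ub m.+1).
  rewrite ltnS => nm; rewrite -(IH nm) -[in RHS](proj2 (stepP m (u m) (ub m))).
  by rewrite modn_dvdm// dvdn_exp2l.
have udist n m : (n <= m)%N -> pabs ((u m)%:R - (u n)%:R : K) <= q ^- n.
  move=> nm; rewrite -(umod n m nm) -natrB ?leq_mod// pabs_pX_dvd//.
  by rewrite {1}(divn_eq (u m) (p ^ n)) addnK dvdn_mull.
have [e e0|l ul] := @pabs_complete _ _ K (fun n => (u n)%:R).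
  have [n ne] := qVX_small e e0; exists n => a b na nb.
  apply: le_lt_trans ne; apply: (pabs_dist_le (u n)%:R); first exact: udist.
  by rewrite pabsC; exact: udist.
have ln n : pabs (l - (u n)%:R) <= q ^- n.
  have [|N' hN'] := ul (q ^- n); first by rewrite invr_gt0 exprn_gt0 ?q_gt0.
  apply: (pabs_dist_le (u (maxn n N'))%:R).
    by rewrite pabsC ltW// hN'// leq_maxr.
  by apply: udist; rewrite leq_maxl.
have l1 : pabs l <= 1 by have := ln 0%N; rewrite subr0 expr0 invr1.
have lcode n : truncation n l = u n by apply: truncation_unique => //; case: (ub n).
have [n Qn] := Qall l l1.
have [_] := ub n; apply; exists n => x x1 xl.
by rewrite xl -lcode.
Qed.

End PadicAbs.

(** * The cells of a ball *)

Section Cells.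
Context {R : realType} {p : nat} (p_prime : prime p) {K : padic_field R p}
  (a0 : K) (k0 : int).
Local Notation q := (p%:R : R).
Implicit Types (x y : K).

(** A scalar of absolute value p ^ (- k). *)
Definition pi_pow (k : int) : K := (p%:R : K) ^ k.
Definition B0 : set K := padic_ball a0 k0.
(** The similarity taking B0 to the unit ball. *)
Definition coord x : K := (x - a0) * pi_pow k0.
Definition uncoord (z : K) : K := a0 + z * pi_pow (- k0).
Definition dig n x : nat := truncation n (coord x).
Definition rho (n : nat) : R := q ^ (k0 - n%:Z).
(** A subball of B0, addressed by its level and its first digits; cells of the same
level partition B0 and the cell c of level n has as its children the cells
c + j p ^ n of level n + 1, for j < p. *)
Definition cell n c : set K := [set x | B0 x /\ dig n x = c].

Lemma p_neq0 : (p%:R : K) != 0.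
Proof.
apply/eqP => h; have := @pabs_p R p p_prime K; rewrite h pabs0.
by move/esym/eqP; rewrite invr_eq0 (negbTE (q_neq0 p_prime)).
Qed.

Lemma pabs_pi_pow k : pabs (pi_pow k) = q ^ (- k).
Proof.
rewrite /pi_pow; case: k => n; first by rewrite -exprnP pabsX pabs_p// exprVn exprnN.
by rewrite NegzE opprK -exprnN pabsV pabsX pabs_p// exprVn invrK.
Qed.

Lemma pi_powK k : pi_pow k * pi_pow (- k) = 1.
Proof. by rewrite /pi_pow -expfzDr ?p_neq0// subrr expr0z. Qed.

Lemma uncoordK z : coord (uncoord z) = z.
Proof. by rewrite /uncoord /coord addrAC subrr add0r -mulrA [_ * pi_pow k0]mulrC pi_powK mulr1. Qed.

Lemma coordB x y : coord x - coord y = (x - y) * pi_pow k0.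
Proof. by rewrite /coord; ring. Qed.

Lemma B0E x : B0 x <-> pabs (coord x) <= 1.
Proof.
rewrite /B0 /padic_ball /coord /= pabsM pabs_pi_pow -invr_expz.
by rewrite ler_pdivrMr ?qX_gt0// mul1r.
Qed.

Lemma rhoE n : rho n = q ^ k0 * q ^- n.
Proof. by rewrite /rho expfzDr ?q_neq0// exprnN. Qed.

Lemma rho_gt0 n : 0 < rho n.
Proof. exact: qX_gt0. Qed.

Lemma rho_decr m n : (m <= n)%N -> rho n <= rho m.
Proof. by move=> mn; rewrite /rho le_qX// lerD2l lerN2 lez_nat. Qed.

Lemma rho_le n : rho n <= q ^ k0.
Proof. by rewrite /rho le_qX// gerBl. Qed.

Lemma pabs_lt_rho x n : (pabs x < rho n) = (pabs x <= rho n.+1).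
Proof. by rewrite /rho pabs_lt_le//; congr (_ <= q ^ _); rewrite intS; ring. Qed.

Lemma dig_lt n x : B0 x -> (dig n x < p ^ n)%N.
Proof. by move/B0E => h; exact: truncation_lt. Qed.

Lemma dig_eq n x y : B0 x -> B0 y -> dig n x = dig n y <-> pabs (x - y) <= rho n.
Proof.
move=> /B0E hx /B0E hy; rewrite /dig truncation_eq// coordB pabsM pabs_pi_pow -invr_expz.
by rewrite rhoE ler_pdivrMr ?qX_gt0// mulrC.
Qed.

Lemma dig_mod m n x : (m <= n)%N -> B0 x -> dig m x = (dig n x %% p ^ m)%N.
Proof. by move=> mn /B0E h; exact: truncation_mod. Qed.

Lemma dig_coarser m n x y : (m <= n)%N -> B0 x -> B0 y ->
  dig n x = dig n y -> dig m x = dig m y.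
Proof. by move=> mn Bx By e; rewrite !(@dig_mod m n)// e. Qed.

Lemma dig_surj n c : (c < p ^ n)%N -> exists2 x, B0 x & dig n x = c.
Proof.
move=> cn; exists (uncoord c%:R); last by rewrite /dig uncoordK truncation_nat.
by apply/B0E; rewrite uncoordK pabs_natr.
Qed.

Lemma dig0 x : B0 x -> dig 0 x = 0%N.
Proof. by move=> /(dig_lt 0); rewrite ltnS leqn0 => /eqP. Qed.

Lemma cell_ball n x : B0 x -> cell n (dig n x) = padic_ball x (k0 - n%:Z).
Proof.
move=> Bx; apply/seteqP; split => y; rewrite /cell /padic_ball /=.
  by move=> [By /(dig_eq _ _ _ By Bx)].
move=> yx; have By : B0 y.
  apply: (pabs_dist_le x) => //; apply: le_trans yx _.
  by rewrite le_qX// gerBl.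
by split => //; apply/(dig_eq _ _ _ By Bx).
Qed.

Lemma cell0E n c : (forall x, B0 x -> dig n x != c) -> cell n c = set0.
Proof.
move=> h; apply/seteqP; split => // x [Bx /eqP].
by rewrite (negbTE (h x Bx)).
Qed.

Lemma cell_dec n c : cell n c = set0 \/ exists2 x, B0 x & c = dig n x.
Proof.
have [[x [Bx e]]|no] := pselect (exists x, B0 x /\ dig n x = c).
  by right; exists x.
left; apply: cell0E => x Bx; apply/eqP => e; apply: no.
by exists x.
Qed.

Lemma koenig_cells (Q : nat -> nat -> Prop) :
  (forall n x, B0 x -> Q n (dig n x) -> Q n.+1 (dig n.+1 x)) ->
  (forall x, B0 x -> exists n, Q n (dig n x)) ->
  exists N, forall x, B0 x -> Q N (dig N x).
Proof.
move=> Qm Qa; have [n z z1|z z1|N h] := @koenig _ _ p_prime K Q.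
- by rewrite -(uncoordK z); apply: Qm; apply/B0E; rewrite uncoordK.
- have [|n] := Qa (uncoord z); first by apply/B0E; rewrite uncoordK.
  by rewrite /dig uncoordK => h; exists n.
- by exists N => x /B0E h'; exact: h.
Qed.

End Cells.

Arguments rho {R} p k0 n.

(** * The Borel sets and the Haar measure *)

Section Measurability.
Context {R : realType} {p : nat} (p_prime : prime p) {K : padic_field R p}.
Local Notation q := (p%:R : R).
Local Notation T := (borel K).
Implicit Types (a x y : K) (k : int).

Lemma padic_open_measurable (A : set T) : padic_open (A : set K) -> measurable A.
Proof. by move=> oA; exact: sub_gen_smallest. Qed.

Lemma padic_open_ball a k : padic_open (padic_ball a k).
Proof.
move=> x xa; exists (q ^ k); first exact: qX_gt0.
by move=> y yx; apply: (pabs_dist_le x) => //; exact: ltW.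
Qed.

Lemma padic_open_ballC a k : padic_open (~` padic_ball a k).
Proof.
move=> x xa; exists (q ^ k); first exact: qX_gt0.
move=> y yx ya; apply: xa; apply: (pabs_dist_le y) => //.
by rewrite pabsC ltW.
Qed.

Lemma measurable_padic_ball a k : measurable (padic_ball a k : set T).
Proof. by apply: padic_open_measurable; exact: padic_open_ball. Qed.

Lemma measurable_cell a k n c : measurable (cell a k n c : set T).
Proof.
have [->|[x Bx ->]] := cell_dec a k n c; first exact: measurable0.
by rewrite cell_ball//; exact: measurable_padic_ball.
Qed.

Lemma padic_openI (A B : set K) : padic_open A -> padic_open B ->
  padic_open (A `&` B).
Proof.
move=> oA oB x [/oA[e1 e10 h1] /oB[e2 e20 h2]].
exists (Num.min e1 e2); first by rewrite lt_min e10.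
by move=> y; rewrite lt_min => /andP[y1 y2]; split; [exact: h1|exact: h2].
Qed.

(** The Borel sets whose trace on B0 is empty or a cell form a pi-system, which
generates all Borel sets since an open set is, inside B0, the union of the
countably many cells it contains. The sets E satisfying the conclusion form a
Dynkin system. *)
Lemma cells_determine (mu : {measure set T -> \bar R}) a0 k0 (D : set T)
    (f : T -> R) : measurable D -> D `<=` B0 a0 k0 ->
  mu.-integrable D (EFin \o f) ->
  (forall n c, (\int[mu]_(x in D `&` cell a0 k0 n c) (f x)%:E = 0)%E) ->
  forall E, measurable E -> (\int[mu]_(x in D `&` E) (f x)%:E = 0)%E.
Proof.
move=> mD DB fi f0.
pose G : set (set T) := [set A : set T | measurable A /\
  ((A : set K) `&` B0 a0 k0 = set0 \/
   exists n c, (A : set K) `&` B0 a0 k0 = cell a0 k0 n c)].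
have cellsub n c : cell a0 k0 n c `<=` B0 a0 k0 by move=> x [].
have Gcell n c : G (cell a0 k0 n c).
  split; first exact: measurable_cell.
  by right; exists n, c; rewrite setIidl.
have GE : @measurable _ T = <<s G >>.
  apply/seteqP; split; last first.
    apply: smallest_sub => [|A []//].
    split; [exact: measurable0| |].
      by move=> A mA; rewrite setTD; exact: measurableC.
    by move=> F mF; exact: bigcupT_measurable.
  apply: smallest_sub; first exact: smallest_sigma_algebra.
  move=> U oU.
  have -> : U = (U `&` ~` B0 a0 k0) `|` \bigcup_n \bigcup_c
      (if `[< cell a0 k0 n c `<=` U >] then cell a0 k0 n c else set0).
    apply/seteqP; split=> [x Ux|x [[]//|[n _ [c _]]]]; last first.
      by case: asboolP => [h /h|_].
    have [Bx|nB] := pselect (B0 a0 k0 x); last by left.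
    right; have [e e0 he] := oU _ Ux.
    have [n h] := qVX_small p_prime (e / q ^ k0) (divr_gt0 e0 (qX_gt0 p_prime k0)).
    exists n => //; exists (dig a0 k0 n x) => //.
    case: asboolP => [_|[]]; first by split.
    move=> y [By yx]; apply: he; apply: (@le_lt_trans _ _ (rho p k0 n)).
      exact/(dig_eq p_prime _ _ _ _ _ By Bx).
    by rewrite rhoE// mulrC -ltr_pdivlMr ?qX_gt0.
  have sU (A B : set T) : <<s G >> A -> <<s G >> B -> <<s G >> (A `|` B).
    move=> sA sB; rewrite -bigcup2E; apply: sigma_algebra_bigcup => i.
    rewrite /bigcup2; case: ifP => // _; case: ifP => // _.
    by case: (@smallest_sigma_algebra _ setT G).
  apply: sU.
    apply: sub_gen_smallest; split; last by left; rewrite -setIA setICl setI0.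
    by apply: padic_open_measurable; apply: padic_openI => //; exact: padic_open_ballC.
  apply: sigma_algebra_bigcup => n; apply: sigma_algebra_bigcup => c.
  case: ifP => _; first exact: sub_gen_smallest.
  by case: (@smallest_sigma_algebra _ setT G).
have cellI n1 c1 n2 c2 : (n1 <= n2)%N ->
    cell a0 k0 n1 c1 `&` cell a0 k0 n2 c2 = set0 \/
    cell a0 k0 n1 c1 `&` cell a0 k0 n2 c2 = cell a0 k0 n2 c2.
  move=> n12; have [->|/eqP/set0P[x [[Bx e1] [_ e2]]]] :=
    pselect (cell a0 k0 n1 c1 `&` cell a0 k0 n2 c2 = set0); [by left|right].
  apply: setIidr => y [By e]; split => //; rewrite -e1.
  by apply: (dig_coarser p_prime _ _ _ n2) => //; rewrite e e2.
have fiI A : measurable A -> mu.-integrable (D `&` A) (EFin \o f).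
  move=> mA; apply: integrableS fi => //; exact: measurableI.
move=> E mE; have := mE; rewrite GE.
apply: (@dynkin_induction _ T G
  (fun S => (\int[mu]_(x in D `&` S) (f x)%:E = 0)%E) GE).
- move=> A B [mA hA] [mB hB]; split; first exact: measurableI.
  have -> : A `&` B `&` B0 a0 k0 = (A `&` B0 a0 k0) `&` (B `&` B0 a0 k0).
    by rewrite setIACA setIid.
  case: hA => [->|[n1 [c1 ->]]]; first by left; rewrite set0I.
  case: hB => [->|[n2 [c2 ->]]]; first by left; rewrite setI0.
  case: (leqP n1 n2) => [n12|/ltnW n21].
    by case: (cellI n1 c1 n2 c2 n12) => ->; [left|right; exists n2, c2].
  rewrite setIC.
  by case: (cellI n2 c2 n1 c1 n21) => ->; [left|right; exists n1, c1].
- rewrite setIT -(f0 0%N 0%N); congr integral; apply/esym/setIidl.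
  by move=> x Dx; split; [exact: DB|apply: dig0 => //; exact: DB].
- move=> A [mA hA]; have -> : D `&` A = D `&` (A `&` B0 a0 k0).
    by apply/seteqP; split => x [Dx]; [move=> Ax; split=> //; split=> //; exact: DB|case].
  by case: hA => [->|[n [c ->]]]; [rewrite setI0 integral_set0|exact: f0].
- move=> S mS iS.
  have iD : (\int[mu]_(x in D) (f x)%:E = 0)%E.
    rewrite -(f0 0%N 0%N); congr integral; apply/esym/setIidl.
    by move=> x Dx; split; [exact: DB|apply: dig0 => //; exact: DB].
  have : (\int[mu]_(x in (D `&` S) `|` (D `&` ~` S)) (f x)%:E = 0)%E.
    by rewrite -setIUr setUv setIT.
  rewrite integral_setU ?iS ?add0e//; try exact: measurableI.
  + by apply: measurableI => //; exact: measurableC.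
  + by rewrite -setIUr setUv setIT; exact: (measurable_int mu).
  + by apply/disj_setPS => x [[_ Sx] [_]].
- move=> F mF tF iF; rewrite setI_bigcupr integral_bigcup//.
  + by apply: eseries0 => i _ _; exact: iF.
  + exact: trivIset_setIl.
  + by move=> k; exact: measurableI.
  + rewrite -setI_bigcupr; apply: fiI; exact: bigcupT_measurable.
Qed.

Context (mu : {sigma_finite_measure set T -> \bar R}) (mu_haar : haar_measure mu).

Lemma haar_translate a k : mu (padic_ball a k) = mu (padic_ball 0 k).
Proof.
have [inv _] := mu_haar; rewrite -[RHS](inv a); last exact: measurable_padic_ball.
congr (mu _); apply/seteqP; split => [x xa|_ [y y0 <-]].
  exists (x - a); first by move: xa; rewrite /padic_ball /= subr0.
  exact: (subrKC a (x : K)).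
by move: y0; rewrite /padic_ball /= subr0 addrAC subrr add0r.
Qed.

(** A ball is the disjoint union of p translates of the next smaller one. *)
Lemma haar_step k : mu (padic_ball 0 k) = (q%:E * mu (padic_ball 0 (k - 1)))%E.
Proof.
have tr : trivIset setT (cell (0 : K) k 1).
  by move=> i j _ _ [x [[_ <-] [_ <-]]].
have mc i : measurable (cell (0 : K) k 1 i : set T) by exact: measurable_cell.
have -> : padic_ball (0 : K) k = \big[setU/set0]_(c < p) cell (0 : K) k 1 c.
  rewrite -bigcup_mkord; apply/seteqP; split => [x Bx|x [c _ []]//].
  have dl : (dig 0 k 1 x < p)%N by have := dig_lt p_prime 0 k 1 x Bx; rewrite expn1.
  by exists (dig 0 k 1 x).
rewrite (measure_bigsetU mu mc tr).
rewrite (eq_bigr (fun=> mu (padic_ball 0 (k - 1)))); last first.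
  move=> c _; have [|x Bx <-] := dig_surj p_prime (0 : K) k 1 c.
    by rewrite expn1.
  by rewrite cell_ball//; exact: haar_translate.
have : (0 <= mu (padic_ball 0 (k - 1)))%E by [].
move: (mu _) => e e0; clear -e0.
elim: p => [|n IH]; first by rewrite big_ord0 mul0e.
by rewrite big_ord_recr /= IH -natr1 EFinD ge0_muleDl ?lee_fin// mul1e.
Qed.

Lemma haar_ball a k : mu (padic_ball a k) = (q ^ k)%:E.
Proof.
have [_ mu1] := mu_haar; rewrite haar_translate.
have down l : mu (padic_ball 0 l) = (q ^ l)%:E ->
    mu (padic_ball 0 (l - 1)) = (q ^ (l - 1))%:E.
  rewrite haar_step => e.
  rewrite -[LHS](mul1e) -[X in (X%:E * _)%E](mulVf (q_neq0 p_prime)).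
  rewrite EFinM -muleA e -EFinM.
  by congr EFin; rewrite expfzDr ?q_neq0// exprN1 mulrC.
have up l : mu (padic_ball 0 l) = (q ^ l)%:E ->
    mu (padic_ball 0 (l + 1)) = (q ^ (l + 1))%:E.
  rewrite [in X in _ -> X]haar_step addrK => ->.
  by rewrite -EFinM; congr EFin; rewrite expfzDr ?q_neq0// mulrC expr1z.
case: k => n.
  elim: n => [|n /up]; first by rewrite mu1 expr0z.
  by rewrite -PoszD addn1.
rewrite NegzE; elim: n => [|n /down].
  by have := down 0; rewrite mu1 expr0z add0r; apply.
by rewrite -opprD -PoszD addn1.
Qed.

Lemma haar_cell a k n x : B0 a k x ->
  mu (cell a k n (dig a k n x)) = (rho p k n)%:E.
Proof. by move=> Bx; rewrite cell_ball// haar_ball. Qed.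

End Measurability.

(** * Spectra of Gram matrices *)

Section Gram.
Context {C : numClosedFieldType}.
Local Open Scope sesquilinear_scope.

Lemma row_normsq n (u : 'rV[C]_n) : (u *m u ^t* ) 0 0 = \sum_j `|u 0 j| ^+ 2.
Proof. by rewrite mxE; apply: eq_bigr => j _; rewrite !mxE normCK. Qed.

Lemma row_normsq_eq0 n (u : 'rV[C]_n) : (u *m u ^t* ) 0 0 = 0 -> u = 0.
Proof.
rewrite row_normsq => /eqP; rewrite psumr_eq0 => [/allP h|j _]; last first.
  by rewrite exprn_ge0.
apply/rowP => j; rewrite mxE; apply/eqP.
by have := h j (mem_index_enum j); rewrite /= sqrf_eq0 normr_eq0.
Qed.

Lemma gram_form m n (D : 'M[C]_(m, n)) (c : 'rV[C]_m) :
  c *m (D *m D ^t* ) *m c ^t* = (c *m D) *m (c *m D) ^t*.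
Proof. by rewrite trmx_mul map_mxM !mulmxA. Qed.

(** c D D^t = 0 makes the norm of c D vanish. *)
Lemma gram_ker m n (D : 'M[C]_(m, n)) (c : 'rV[C]_m) :
  c *m (D *m D ^t* ) = 0 -> c *m D = 0.
Proof.
by move=> h; apply: row_normsq_eq0; rewrite -gram_form h mul0mx mxE.
Qed.

Lemma rank_gram m n (D : 'M[C]_(m, n)) : \rank (D *m D ^t* ) = \rank D.
Proof.
have : \rank (kermx (D *m D ^t* )) = \rank (kermx D).
  apply/eqP; rewrite eqn_leq; apply/andP; split; apply: mxrankS; apply/sub_kermxP.
    apply/row_matrixP => i; rewrite row_mul row0; apply: gram_ker.
    by rewrite -row_mul mulmx_ker row0.
  by rewrite mulmxA mulmx_ker mul0mx.
rewrite !mxrank_ker => h.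
by rewrite -(subKn (rank_leq_row (D *m _))) h subKn// rank_leq_row.
Qed.

Lemma rank_diag n (d : 'rV[C]_n) :
  \rank (diag_mx d) = #|[pred i | d 0 i != 0]|.
Proof.
set S := [pred i | _]; set r := #|S|.
pose M1 : 'M[C]_(r, n) := \matrix_(k, j) (d 0 j *+ (enum_val k == j)).
have eM1 : M1 = (\matrix_(k, j) (enum_val k == j)%:R) *m diag_mx d.
  apply/matrixP => k j; rewrite !mxE (bigD1 j)//= big1 ?addr0 => [|i ij].
    by rewrite !mxE eqxx mulr1n mulr_natl.
  by rewrite !mxE (negbTE ij) mulr0n mulr0.
have eD : diag_mx d = (\matrix_(i, k) (i == enum_val k)%:R) *m M1.
  apply/matrixP => i j; rewrite !mxE.
  have [->|ij] := eqVneq i j; last first.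
    rewrite big1// => k _; rewrite !mxE; case: eqP => [<-|]; last by rewrite mul0r.
    by rewrite (negbTE ij) mulr0n mulr0.
  have [jS|jS] := boolP (j \in S).
    rewrite (bigD1 (enum_rank_in jS j))//= !mxE enum_rankK_in// eqxx mul1r mulr1n.
    rewrite big1 ?addr0// => k kj; rewrite !mxE.
    case: eqP => [e|]; last by rewrite mul0r.
    by case/eqP: kj; apply: enum_val_inj; rewrite enum_rankK_in.
  have d0 : d 0 j = 0 by apply/eqP; move: jS; rewrite inE negbK.
  by rewrite d0 mul0rn big1// => k _; rewrite !mxE d0 mul0rn mulr0.
have fM1 : row_free M1.
  apply/row_freeP; exists (\matrix_(j, k) ((d 0 j)^-1 *+ (j == enum_val k))).
  apply/matrixP => k l; rewrite !mxE (bigD1 (enum_val k))//= big1 ?addr0.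
    rewrite !mxE eqxx mulr1n (inj_eq enum_val_inj); case: eqP => _.
      by rewrite !mulr1n mulfV//; have := enum_valP k; rewrite inE.
    by rewrite !mulr0n mulr0.
  by move=> j jk; rewrite !mxE eq_sym (negbTE jk) mulr0n mul0r.
apply/eqP; rewrite eqn_leq; apply/andP; split.
  rewrite eD; apply: (leq_trans (mxrankM_maxr _ _)); exact: rank_leq_row.
move: fM1; rewrite /row_free => /eqP <-; rewrite eM1; exact: mxrankM_maxr.
Qed.

(** Singular value data of D: the rows of P are orthonormal eigenvectors of the
Gram matrix, and 0 has as multiplicity the dimension of the left kernel of D. *)
Lemma gram_spectral m n (D : 'M[C]_(m, n)) :
  exists (P : 'M[C]_m) (sp : 'rV[C]_m),
  [/\ P *m P ^t* = 1%:M, P *m (D *m D ^t* ) = diag_mx sp *m P,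
    forall i, 0 <= sp 0 i & #|[pred i | sp 0 i == 0]| = (m - \rank D)%N].
Proof.
set A := D *m D ^t*.
have Anormal : A \is normalmx.
  apply/normalmxP; rewrite /A trmx_mul map_mxM.
  by rewrite trmxCK.
have /orthomx_spectralP AE := Anormal.
exists (spectralmx A), (spectral_diag A).
have PU := spectral_unitarymx A; have Pu := spectral_unit A.
have PA : spectralmx A *m A = diag_mx (spectral_diag A) *m spectralmx A.
  by rewrite {2}AE -!mulmxA mulKVmx.
have PP : spectralmx A *m (spectralmx A) ^t* = 1%:M by exact/unitarymxP.
split => //.
- move=> i.
  have -> : spectral_diag A 0 i
      = ((spectralmx A *m D) *m (spectralmx A *m D) ^t* ) i i.
    rewrite trmx_mul map_mxM mulmxA -(mulmxA _ D) -/A PA -mulmxA PP mulmx1.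
    by rewrite mxE eqxx mulr1n.
  rewrite mxE sumr_ge0// => j _.
  by rewrite !mxE -normCK exprn_ge0.
- have <- : \rank (diag_mx (spectral_diag A)) = \rank D.
    have Pfree : row_free (spectralmx A) by rewrite row_free_unit.
    have Pfull : row_full (spectralmx A) by rewrite row_full_unit.
    transitivity (\rank (spectralmx A *m A)); first by rewrite PA mxrankMfree.
    by rewrite -[RHS]rank_gram (eqmxMfull _ Pfull).
  have := cardC [pred i | spectral_diag A 0 i == 0]; rewrite card_ord rank_diag.
  by move=> e; rewrite -[X in (X - _)%N]e addnK.
Qed.
End Gram.

(** * Locally constant functions on a compact open set *)

Section Clopen.
Context {R : realType} {p : nat} (p_prime : prime p) {K : padic_field R p}
  (mu : {sigma_finite_measure set (borel K) -> \bar R})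
  (mu_haar : haar_measure mu) (a0 : K) (k0 : int)
  (Om : set K) (Om_sub : Om `<=` B0 a0 k0) (n0 : nat)
  (Om_scale : forall x y, Om x -> B0 a0 k0 y ->
     dig a0 k0 n0 x = dig a0 k0 n0 y -> Om y).
Local Notation q := (p%:R : R).
Local Notation C := R[i].
Local Notation dig := (dig a0 k0).
Local Notation cell := (cell a0 k0).
Local Notation rho := (rho p k0).
Local Open Scope complex_scope.

Definition scale (N : nat) (u : K -> C) :=
  forall x y, Om x -> Om y -> dig N x = dig N y -> u x = u y.

Definition lconst (u : K -> C) :=
  forall x, Om x -> exists2 e : R, 0 < e &
    forall y, Om y -> pabs (y - x) < e -> u y = u x.

Lemma scaleS N N' u : (N <= N')%N -> scale N u -> scale N' u.
Proof.
move=> NN su x y Ox Oy e; apply: su => //.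
exact: (dig_coarser p_prime _ _ _ _ _ _ NN (Om_sub _ Ox) (Om_sub _ Oy) e).
Qed.

(** By [koenig_cells] it is enough to find, for each x, a cell around x on which u
is constant; around a point outside Om this is a cell that does not meet Om. *)
Lemma lconst_scale u : lconst u -> exists N, scale N u.
Proof.
move=> lu.
have [||N h] := koenig_cells p_prime a0 k0 (fun n c => forall x y, Om x -> Om y ->
  dig n x = c -> dig n y = c -> u x = u y).
- move=> n x Bx h y z Oy Oz ey ez; apply: h => //.
    by apply: (dig_coarser p_prime _ _ _ n.+1) => //; exact: Om_sub.
  by apply: (dig_coarser p_prime _ _ _ n.+1) => //; exact: Om_sub.
- move=> x Bx; have [Ox|nO] := pselect (Om x); last first.
    by exists n0 => y z Oy _ ey _; exfalso; apply: nO; exact: (Om_scale y).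
  have [e e0 he] := lu _ Ox.
  have [n h] := qVX_small p_prime (e / q ^ k0) (divr_gt0 e0 (qX_gt0 p_prime k0)).
  exists n.
  have ux y : Om y -> dig n y = dig n x -> u y = u x.
    move=> Oy ey; apply: he => //; apply: (@le_lt_trans _ _ (rho n)).
      exact/(dig_eq p_prime _ _ _ _ _ (Om_sub _ Oy) Bx).
    by rewrite rhoE// mulrC -ltr_pdivlMr ?qX_gt0.
  by move=> y z Oy Oz ey ez; rewrite !ux.
- by exists N => x y Ox Oy e; apply: (h x) => //; exact: Om_sub.
Qed.

Lemma scale_lconst N u : scale N u -> lconst u.
Proof.
move=> su x Ox; exists (rho N); first exact: rho_gt0.
move=> y Oy yx; apply: su => //.
by apply/(dig_eq p_prime _ _ _ _ _ (Om_sub _ Oy) (Om_sub _ Ox)); exact: ltW.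
Qed.

Lemma measurable_B0 : measurable (B0 a0 k0 : set (borel K)).
Proof. exact: measurable_padic_ball. Qed.

Lemma mOm : measurable (Om : set (borel K)).
Proof.
apply: padic_open_measurable => x Ox; exists (rho n0); first exact: rho_gt0.
move=> y yx; have By : B0 a0 k0 y.
  apply: (pabs_dist_le x); last exact: Om_sub.
  exact/ltW/(lt_le_trans yx)/rho_le.
apply: (Om_scale x) => //.
apply/(dig_eq p_prime _ _ _ _ _ (Om_sub _ Ox) By).
by rewrite pabsC ltW.
Qed.

Lemma Om_fin : (mu Om < +oo)%E.
Proof.
apply: (@le_lt_trans _ _ (mu (B0 a0 k0))).
  by apply: le_measure => //; rewrite inE; [exact: mOm|exact: measurable_B0].
by rewrite haar_ball// ltry.
Qed.

(** * Integrals over cells *)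

Definition cind (A : set K) (x : K) : C := (`[< A x >])%:R.
Definition pint (A : set K) (u : K -> C) : C :=
  cintegral mu Om (fun x => cind A x * u x).
Definition ms (A : set K) : R := fine (mu (Om `&` A)).

Local Notation cintb := (cintegrable mu Om).

Lemma cindT A x : A x -> cind A x = 1.
Proof. by move=> Ax; rewrite /cind asboolT. Qed.
Lemma cindF A x : ~ A x -> cind A x = 0.
Proof. by move=> Ax; rewrite /cind asboolF. Qed.
Lemma cind_real A x : cind A x = ((`[< A x >])%:R : R)%:C.
Proof. by rewrite /cind rmorph_nat. Qed.
Lemma conj_cind A x : (cind A x)^* = cind A x.
Proof. by rewrite cind_real conjc_real. Qed.

Lemma cindI A B x : cind A x * cind B x = cind (A `&` B) x.
Proof.
have [Ax|nA] := pselect (A x); last first.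
  by rewrite [cind A x]cindF// mul0r cindF// => -[].
rewrite [cind A x]cindT// mul1r.
have [Bx|nB] := pselect (B x); first by rewrite !cindT.
by rewrite !cindF// => -[].
Qed.

Lemma cintb_cind A u : measurable (A : set (borel K)) -> cintb u ->
  cintb (fun x => cind A x * u x).
Proof.
move=> mA [ru iu].
have h (v : K -> R) : mu.-integrable Om (EFin \o v) ->
    mu.-integrable Om (EFin \o (fun x => (`[< A x >])%:R * v x)).
  move=> iv; have : mu.-integrable Om ((EFin \o v) \_ A).
    apply/(integrable_restrict mu mA mOm).
    apply: (integrableS mOm _ _ iv) => //.
    by apply: measurableI => //; exact: mOm.
  apply: (eq_integrable mOm).
  move=> x _; rewrite /= patchE; have [Ax|nA] := pselect (A x).
    by rewrite mem_set// asboolT// mul1r.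
  by rewrite memNset// asboolF// mul0r.
split.
- apply: (eq_integrable mOm _ _ _ (h _ ru)) => x _ /=.
  by rewrite cind_real ReC.
- apply: (eq_integrable mOm _ _ _ (h _ iu)) => x _ /=.
  by rewrite cind_real ImC.
Qed.

Lemma fin_num_muOm (A : set K) : measurable (A : set (borel K)) ->
  mu (Om `&` A) \is a fin_num.
Proof.
move=> mA; rewrite ge0_fin_numE//; apply: le_lt_trans Om_fin.
apply: le_measure; rewrite ?inE; [|exact: mOm|by move=> x []].
by apply: measurableI => //; exact: mOm.
Qed.

Lemma ms_ge0 A : 0 <= ms A.
Proof. by rewrite /ms fine_ge0. Qed.

Lemma cintb_cst (c : C) : cintb (fun=> c).
Proof.
have h : mu.-integrable Om (EFin \o (fun=> 1 : R)).
  apply/integrableP; split; first exact: measurable_cst.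
  under eq_integral do rewrite /= normr1.
  by rewrite integral_cst ?mul1e; [exact: Om_fin|exact: mOm].
have h1 : cintb (fun=> 1).
  by split=> //; apply: (eq_integrable mOm _ _ _ (integrable0 mu Om)).
apply: eq_cintegrable (cintegrableZ mOm c _ h1); first exact: mOm.
by move=> x _; rewrite mulr1.
Qed.

Lemma eq_pint A u v : (forall x, Om x -> A x -> u x = v x) ->
  pint A u = pint A v.
Proof.
move=> uv; apply: eq_cintegral => x Ox.
have [Ax|nA] := pselect (A x); first by rewrite uv.
by rewrite cindF// !mul0r.
Qed.

Lemma eq_pint_set A B u : (forall x, Om x -> A x <-> B x) -> pint A u = pint B u.
Proof.
by move=> AB; apply: eq_cintegral => x /AB/propext e; rewrite /cind e.
Qed.

Section PintLinear.
Context (A : set K) (mA : measurable (A : set (borel K))).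

Lemma pintB u v : cintb u -> cintb v ->
  pint A (fun x => u x - v x) = pint A u - pint A v.
Proof.
move=> iu iv; rewrite /pint -(cintegralB _ _ mOm); [|exact: cintb_cind..].
by apply: eq_cintegral => x _; rewrite mulrBr.
Qed.

Lemma pintZ c u : cintb u -> pint A (fun x => c * u x) = c * pint A u.
Proof.
move=> iu; rewrite /pint -(cintegralZ _ _ mOm); last exact: cintb_cind.
by apply: eq_cintegral => x _; rewrite mulrCA.
Qed.

Lemma pint_sum (J : Type) (s : seq J) (F : J -> K -> C) :
  (forall j, cintb (F j)) ->
  pint A (fun x => \sum_(j <- s) F j x) = \sum_(j <- s) pint A (F j).
Proof.
move=> iF; rewrite /pint -(cintegral_sum _ _ mOm); last first.
  by move=> j; exact: cintb_cind.
by apply: eq_cintegral => x _; rewrite mulr_sumr.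
Qed.

Lemma pint1 : pint A (fun=> 1) = (ms A)%:C.
Proof.
rewrite /pint /ms; apply: complex_eqP => /=.
  rewrite /Rintegral; congr fine.
  rewrite setIC -(integral_indic mu mOm mA).
  apply: eq_integral => x _; rewrite mulr1 cind_real /= indicE.
  by congr ((nat_of_bool _)%:R%:E); rewrite asboolE.
under eq_Rintegral do rewrite mulr1 cind_real /=.
rewrite /Rintegral integral0_eq//.
Qed.

Lemma pint_cst c : pint A (fun=> c) = c * (ms A)%:C.
Proof.
rewrite -pint1 -pintZ; last exact: cintb_cst.
by apply: eq_pint => x _ _; rewrite mulr1.
Qed.

Lemma pint_null u : cintb u -> ms A = 0 -> pint A u = 0.
Proof.
move=> iu A0; rewrite /pint -(cintegral0 mu Om mOm).
apply: ae_eq_cintegral; [exact: mOm|exact: cintb_cind|exact: cintegrable0|].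
exists (Om `&` A); split.
- by apply: measurableI => //; exact: mOm.
- by rewrite -[LHS]fineK ?fin_num_muOm// -/(ms A) A0.
- move=> x /= h; apply: contrapT => nOA; apply: h => Ox.
  by rewrite cindF ?mul0r// => Ax; apply: nOA.
Qed.

End PintLinear.

Lemma pint_cindM A B u : pint A (fun x => cind B x * u x) = pint (A `&` B) u.
Proof. by apply: eq_cintegral => x _; rewrite mulrA cindI. Qed.

Lemma mcell n c : measurable (cell n c : set (borel K)).
Proof. exact: measurable_cell. Qed.

Lemma cell_partition n x : B0 a0 k0 x -> \sum_(c < p ^ n) cind (cell n c) x = 1.
Proof.
move=> Bx; rewrite (bigD1 (Ordinal (dig_lt p_prime a0 k0 n x Bx)))//= big1.
  by rewrite addr0 cindT.
move=> c /eqP cn; rewrite cindF// => -[_ e]; apply: cn; exact: val_inj.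
Qed.

Lemma pint_cells n A u : measurable (A : set (borel K)) -> cintb u ->
  pint A u = \sum_(c < p ^ n) pint (A `&` cell n c) u.
Proof.
move=> mA iu; transitivity (pint A (fun x => \sum_(c < p ^ n) cind (cell n c) x * u x)).
  apply: eq_pint => x Ox _.
  by rewrite -mulr_suml cell_partition ?mul1r//; exact: Om_sub.
rewrite pint_sum//; last by move=> c; apply: cintb_cind => //; exact: mcell.
by apply: eq_bigr => c _; rewrite pint_cindM.
Qed.

(** On a cell that misses Om the value is irrelevant. *)
Definition step_value (N : nat) (u : K -> C) (c : nat) : C :=
  u (xget a0 (Om `&` cell N c)).

Lemma scale_sum N u : scale N u -> forall x, Om x ->
  \sum_(c < p ^ N) step_value N u c * cind (cell N c) x = u x.
Proof.
move=> su x Ox; have Bx := Om_sub _ Ox.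
rewrite (bigD1 (Ordinal (dig_lt p_prime a0 k0 N x Bx)))//= big1.
  rewrite addr0 cindT// mulr1 /step_value.
  case: xgetP => [y _ [Oy [_ e]]|/(_ x)[]]; first by apply: su.
  by split.
move=> c /eqP cn; rewrite cindF ?mulr0// => -[_ e]; apply: cn; exact: val_inj.
Qed.

Lemma scale_cintb N u : scale N u -> cintb u.
Proof.
move=> su; apply: (eq_cintegrable mOm _ _ (scale_sum N u su)).
apply: cintegrable_sum => [|c]; first exact: mOm.
apply: cintegrableZ; first exact: mOm.
apply: (eq_cintegrable mOm (fun x => cind (cell N c) x * 1)).
  by move=> x _; rewrite mulr1.
by apply: cintb_cind; [exact: mcell|exact: cintb_cst].
Qed.

Lemma L2_cind A : measurable (A : set (borel K)) -> L2 mu Om (cind A).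
Proof.
move=> mA; have h : cintb (fun x => cind A x * 1).
  by apply: cintb_cind => //; exact: cintb_cst.
have {h} : cintb (cind A).
  by apply: (eq_cintegrable mOm _ _ _ h) => x _; rewrite mulr1.
move=> [rA iA]; split.
- by apply/measurable_EFinP; exact: (measurable_int mu rA).
- by apply/measurable_EFinP; exact: (measurable_int mu iA).
- have /integrableP[_] := rA; apply: le_lt_trans.
  rewrite le_eqVlt; apply/orP; left; apply/eqP.
  apply: eq_integral => x _ /=; congr EFin; rewrite cind_real /normsq /=.
  by case: asboolP => _ /=; rewrite ?expr1n ?expr0n /= ?addr0 ?normr1 ?normr0.
Qed.

Lemma scale_L2 N u : scale N u -> L2 mu Om u.
Proof.
move=> su; apply: (eq_L2 mu Om _ _ (scale_sum N u su)).
apply: (L2_sum mOm) => c; apply: (L2Z mOm); apply: L2_cind; exact: mcell.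
Qed.

Lemma L2_cintb u : L2 mu Om u -> cintb u.
Proof.
move=> Lu; have L1 : L2 mu Om (fun=> 1).
  by apply: eq_L2 (L2_cind setT measurableT) => x _; rewrite cindT.
by apply: (eq_cintegrable mOm _ _ _ (L2_mul_conj mu Om mOm _ _ Lu L1)) => x _; rewrite -[RHS]mulr1; congr (_ * _); exact: conjc1.
Qed.

(** * The kernel of D as a sum over levels *)

Section Kernel.
Context (alpha : R) (alpha_gt0 : 0 < alpha).

(** The kernel r ^ (- 2 alpha) of D, up to the factor 1/2, and its increments
between consecutive radii. *)
Definition kap (r : R) : R := (r `^ alpha)^-1 ^+ 2.
Definition wgt (j : nat) : R :=
  if j is i.+1 then kap (rho j) - kap (rho i) else kap (rho 0).

Lemma wgt_sum n : \sum_(j < n.+1) wgt j = kap (rho n).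
Proof.
elim: n => [|n IH]; first by rewrite big_ord1.
by rewrite big_ord_recr /= IH addrC subrK.
Qed.

Lemma kap_gt0 (r : R) : 0 < r -> 0 < kap r.
Proof. by move=> r0; rewrite /kap exprn_gt0// invr_gt0 powR_gt0. Qed.

Lemma wgt_ge0 j : 0 <= wgt j.
Proof.
case: j => [|j] /=; first by rewrite ltW// kap_gt0// rho_gt0.
rewrite subr_ge0 /kap lerXn2r ?nnegrE ?invr_ge0 ?powR_ge0//.
rewrite lef_pV2 ?posrE ?powR_gt0 ?rho_gt0// ge0_ler_powR ?nnegrE//.
- exact: ltW.
- by rewrite ltW ?rho_gt0.
- by rewrite ltW ?rho_gt0.
- exact: rho_decr.
Qed.

Lemma pabs_level x y n : B0 a0 k0 x -> B0 a0 k0 y ->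
  dig n x = dig n y -> dig n.+1 x <> dig n.+1 y -> pabs (x - y) = rho n.
Proof.
move=> Bx By /(dig_eq p_prime _ _ _ _ _ Bx By) h1 h2.
apply/eqP; rewrite eq_le h1 /=; rewrite leNgt; apply/negP => h3; apply: h2.
apply/(dig_eq p_prime _ _ _ _ _ Bx By).
by move: h3; rewrite pabs_lt_rho.
Qed.

(** |x - y| is rho l for the largest l such that x and y share l digits, and the
increments telescope up to level l. *)
Lemma kernel_layers N x y : B0 a0 k0 x -> B0 a0 k0 y -> dig N x <> dig N y ->
  kap (pabs (x - y)) = \sum_(j < N) wgt j * (dig j x == dig j y)%:R.
Proof.
move=> Bx By; elim: N => [|N IH]; first by rewrite !dig0.
move=> dN; rewrite big_ord_recr /=.
have [e|/eqP ne] := eqVneq (dig N x) (dig N y); last by rewrite mulr0 addr0 IH.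
rewrite (pabs_level x y N)// -wgt_sum big_ord_recr /= mulr1.
congr (_ + _); apply: eq_bigr => j _.
rewrite (dig_coarser p_prime _ _ j N x y (ltnW (ltn_ord j)) Bx By e) eqxx mulr1//.
Qed.

(** delta after d, written out. *)
Definition Dop (u : K -> C) (x : K) : C :=
  cintegral mu Om (fun y => (u x - u y) / (2 * pabs (x - y) `^ alpha)%:C *
    (pabs (x - y) `^ (- alpha))%:C).

(** The graph Laplacian of the relation of sharing j digits: the integral of
u x - u y over the y in the cell of x. *)
Definition layer j (u : K -> C) (x : K) : C :=
  (ms (cell j (dig j x)))%:C * u x - pint (cell j (dig j x)) u.

Lemma kernelE (x y : K) (z : C) : x != y ->
  z / (2 * pabs (x - y) `^ alpha)%:C * (pabs (x - y) `^ (- alpha))%:C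
  = (kap (pabs (x - y)) / 2)%:C * z.
Proof.
move=> xy; rewrite -mulrA [RHS]mulrC; congr (z * _).
rewrite -fmorphV -rmorphM /=; congr (_%:C).
rewrite powRN /kap invfM; set t := (_ `^ _)^-1.
by rewrite expr2; ring.
Qed.

(** The integrand vanishes when x and y share N digits, so only finitely many
levels contribute. *)
Lemma DopE N u x : scale N u -> Om x ->
  Dop u x = \sum_(j < N) (wgt j / 2)%:C * layer j u x.
Proof.
move=> su Ox; have Bx := Om_sub _ Ox; have iu := scale_cintb N u su.
have iuB : cintb (fun y => u x - u y).
  by apply: cintegrableB => //; [exact: mOm|exact: cintb_cst].
transitivity (cintegral mu Om (fun y => \sum_(j < N) (wgt j / 2)%:C *
    (cind (cell j (dig j x)) y * (u x - u y)))).
  apply: eq_cintegral => y Oy; have By := Om_sub _ Oy.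
  have [e|/eqP ne] := eqVneq (dig N x) (dig N y).
    by rewrite (su x y)// subrr !mul0r big1// => j _; rewrite !mulr0.
  have xy : x != y by apply/eqP => xy; apply: ne; rewrite xy.
  rewrite kernelE// (kernel_layers N)// mulr_suml rmorph_sum /= mulr_suml.
  apply: eq_bigr => j _; rewrite mulrA; congr (_ * _).
  rewrite cind_real -rmorphM /=; congr (_%:C).
  rewrite mulrAC; congr (_ * (nat_of_bool _)%:R).
  by apply/eqP/asboolP => [e|[_ e]]; [split|].
rewrite (cintegral_sum mu Om mOm); last first.
  move=> j; apply: cintegrableZ; first exact: mOm.
  by apply: cintb_cind => //; exact: mcell.
apply: eq_bigr => j _; rewrite (cintegralZ mu Om mOm); last first.
  by apply: cintb_cind => //; exact: mcell.
congr (_ * _).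
rewrite -/(pint _ _) pintB//; [|exact: mcell|exact: cintb_cst].
rewrite pint_cst; last exact: mcell.
by rewrite /layer [u x * _]mulrC.
Qed.

Lemma layer_cells j u x : Om x -> \sum_(c < p ^ j)
  cind (cell j c) x * ((ms (cell j c))%:C * u x - pint (cell j c) u) = layer j u x.
Proof.
move=> Ox; have Bx := Om_sub _ Ox.
rewrite (bigD1 (Ordinal (dig_lt p_prime a0 k0 j x Bx)))//= big1.
  by rewrite addr0 cindT// mul1r.
move=> c /eqP cn; rewrite cindF ?mul0r// => -[_ e]; apply: cn; exact: val_inj.
Qed.

Lemma cintb_affine (a b : C) u : cintb u -> cintb (fun x => a * u x - b).
Proof.
move=> iu; apply: cintegrableB; [exact: mOm| |exact: cintb_cst].
by apply: cintegrableZ; first exact: mOm.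
Qed.

Lemma layer_cintb j u : cintb u -> cintb (layer j u).
Proof.
move=> iu; apply: (eq_cintegrable mOm _ _ (layer_cells j u)).
apply: cintegrable_sum => [|c]; first exact: mOm.
apply: cintb_cind; first exact: mcell.
exact: cintb_affine.
Qed.

(** Over a union of cells of level j, the integrals of the two terms of a layer
agree cell by cell. *)
Lemma pint_layer_cells j A u : measurable (A : set (borel K)) -> cintb u ->
  (forall x y, B0 a0 k0 x -> B0 a0 k0 y -> dig j x = dig j y -> A x -> A y) ->
  pint A (layer j u) = 0.
Proof.
move=> mA iu Aj; rewrite (pint_cells j)//; last exact: layer_cintb.
apply: big1 => c _.
have [[x [Ax [Bx e]]]|no] := pselect (exists x, (A `&` cell j c) x); last first.
  rewrite (eq_pint_set _ set0) => [|x _]; last by split=> // h; apply: no; exists x.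
  rewrite /pint -[RHS](cintegral0 mu Om mOm); apply: eq_cintegral => x _.
  by rewrite cindF ?mul0r.
rewrite (eq_pint_set _ (cell j c)) => [|y _]; last first.
  split=> [[]//|[By e']]; split => //; apply: (Aj x) => //.
  by rewrite e e'.
rewrite (eq_pint _ _ (fun x => (ms (cell j c))%:C * u x - pint (cell j c) u)).
  rewrite pintB; [|exact: mcell| |exact: cintb_cst]; last first.
    by apply: cintegrableZ; first exact: mOm.
  rewrite pintZ; [|exact: mcell|exact: iu].
  rewrite pint_cst; last exact: mcell.
  by rewrite [X in _ - X]mulrC subrr.
by move=> y _ [_ <-].
Qed.

Lemma pint_layer_const j b A u : measurable (A : set (borel K)) -> cintb u ->
  (forall x, A x -> B0 a0 k0 x -> dig j x = b) ->
  pint A (layer j u)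
  = (ms (cell j b))%:C * pint A u - pint (cell j b) u * (ms A)%:C.
Proof.
move=> mA iu Ab.
rewrite (eq_pint _ _ (fun x => (ms (cell j b))%:C * u x - pint (cell j b) u)).
  rewrite pintB//; [|by apply: cintegrableZ; first exact: mOm|exact: cintb_cst].
  by rewrite pintZ ?pint_cst.
by move=> x Ox Ax; rewrite /layer Ab//; exact: Om_sub.
Qed.

Lemma Dop_scale N u : scale N u -> scale N (Dop u).
Proof.
move=> su x y Ox Oy e; rewrite (DopE N u x su Ox) (DopE N u y su Oy).
apply: eq_bigr => j _.
have Bx := Om_sub _ Ox; have By := Om_sub _ Oy.
rewrite /layer (su x y Ox Oy e).
by rewrite (dig_coarser p_prime _ _ j N x y (ltnW (ltn_ord j)) Bx By e).
Qed.

Lemma pint_Dop N A u : measurable (A : set (borel K)) -> scale N u ->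
  pint A (Dop u) = \sum_(j < N) (wgt j / 2)%:C * pint A (layer j u).
Proof.
move=> mA su; have iu := scale_cintb N u su.
rewrite (eq_pint _ _ (fun x => \sum_(j < N) (wgt j / 2)%:C * layer j u x)).
  rewrite pint_sum//.
    by apply: eq_bigr => j _; rewrite pintZ//; exact: layer_cintb.
  by move=> j; apply: cintegrableZ; [exact: mOm|exact: layer_cintb].
by move=> x Ox _; exact: DopE.
Qed.

(** * Haar functions *)

Definition hweight (A B : set K) : R := (Num.sqrt ((ms A)^-1 + (ms B)^-1))^-1.

(** The unit vector, up to sign unique, in the span of the indicators of A and B
with integral 0. *)
Definition hfun (A B : set K) (x : K) : C :=
  (hweight A B)%:C * ((ms A)^-1%:C * cind A x - (ms B)^-1%:C * cind B x).

Lemma conj_hfun A B x : (hfun A B x)^* = hfun A B x.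
Proof.
rewrite /hfun !cind_real -!rmorphM -rmorphB -rmorphM.
exact: conjc_real.
Qed.

(** Coefficients are differences of mean values. *)
Lemma inner_hfun A B u : measurable (A : set (borel K)) ->
  measurable (B : set (borel K)) -> cintb u ->
  L2inner mu Om u (hfun A B)
  = (hweight A B)%:C * ((ms A)^-1%:C * pint A u - (ms B)^-1%:C * pint B u).
Proof.
move=> mA mB iu; have iA := cintb_cind A u mA iu; have iB := cintb_cind B u mB iu.
rewrite /L2inner /pint -!(cintegralZ mu Om mOm)// -(cintegralB mu Om mOm);
  [|by apply: cintegrableZ; first exact: mOm..].
rewrite -(cintegralZ mu Om mOm); last first.
  by apply: cintegrableB; [exact: mOm| |];
    (apply: cintegrableZ; first exact: mOm).
apply: eq_cintegral => x _.
rewrite (_ : Num.conj _ = hfun A B x); last exact: conj_hfun.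
by rewrite /hfun; ring.
Qed.

Section HaarPair.
Context (A B : set K) (mA : measurable (A : set (borel K)))
  (mB : measurable (B : set (borel K))) (AB : A `&` B = set0)
  (A0 : ms A != 0) (B0' : ms B != 0).

Lemma hfun_L2 : L2 mu Om (hfun A B).
Proof.
apply: (L2Z mOm); apply: L2B; first exact: mOm.
  by apply: (L2Z mOm); exact: L2_cind.
by apply: (L2Z mOm); exact: L2_cind.
Qed.

Lemma hfun_cintb : cintb (hfun A B).
Proof. exact/L2_cintb/hfun_L2. Qed.

Lemma pint_indic (E D : set K) : measurable (D : set (borel K)) ->
  measurable (E : set (borel K)) ->
  pint E (cind D) = (ms (E `&` D))%:C.
Proof.
move=> mD mE; rewrite -pint1; last exact: measurableI.
rewrite -pint_cindM; apply: eq_pint => x _ _; by rewrite mulr1.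
Qed.

Lemma pint_hfun E : measurable (E : set (borel K)) -> pint E (hfun A B) =
  (hweight A B)%:C * ((ms A)^-1%:C * (ms (E `&` A))%:C
    - (ms B)^-1%:C * (ms (E `&` B))%:C).
Proof.
move=> mE.
have i1 D : measurable (D : set (borel K)) -> cintb (cind D).
  by move=> mD; exact/L2_cintb/L2_cind.
rewrite pintZ//; last first.
  by apply: cintegrableB; [exact: mOm| |];
    (apply: cintegrableZ; [exact: mOm|exact: i1]).
rewrite pintB//; [|by apply: cintegrableZ; [exact: mOm|exact: i1]..].
by rewrite !pintZ ?pint_indic//; exact: i1.
Qed.

Lemma pint_hfun_sub E : measurable (E : set (borel K)) ->
  A `<=` E -> B `<=` E -> pint E (hfun A B) = 0.
Proof.
move=> mE AE BE; rewrite pint_hfun// !setIidr//.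
by rewrite -!rmorphM !mulVf// subrr mulr0.
Qed.

Lemma ms0 : ms set0 = 0.
Proof. by rewrite /ms setI0 measure0. Qed.

Lemma pint_hfun_disj E : measurable (E : set (borel K)) ->
  E `&` A = set0 -> E `&` B = set0 -> pint E (hfun A B) = 0.
Proof. by move=> mE EA EB; rewrite pint_hfun// EA EB ms0 !mulr0 subrr mulr0. Qed.

Lemma hfun_unit : L2inner mu Om (hfun A B) (hfun A B) = 1.
Proof.
rewrite inner_hfun//; last exact: hfun_cintb.
rewrite !pint_hfun// !setIid AB [B `&` A]setIC AB ms0 !mulr0 subr0 sub0r.
have e D : ms D != 0 -> (ms D)^-1%:C * (ms D)%:C = 1 :> C.
  by move=> D0; rewrite -rmorphM mulVf.
rewrite !e// !mulr1 mulrN1 mulrN opprK -!rmorphM -rmorphD -rmorphM /=.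
rewrite (_ : hweight A B * _ = 1)//.
have Ap : 0 < ms A by rewrite lt_neqAle eq_sym A0 ms_ge0.
have Bp : 0 < ms B by rewrite lt_neqAle eq_sym B0' ms_ge0.
rewrite /hweight -mulrDl mulrCA -expr2 mulrC exprVn sqr_sqrtr ?mulVf//.
  by rewrite gt_eqF// addr_gt0 ?invr_gt0.
by rewrite addr_ge0 ?invr_ge0 ?ms_ge0.
Qed.

End HaarPair.

(** The eigenvalue of the Haar functions carried by the cell b of level n and
constant on its children. *)
Definition lam (n b : nat) : R :=
  \sum_(j < n.+1) wgt j / 2 * ms (cell j (b %% p ^ j)).

Section HaarEigen.
Context (n b : nat) (A B : set K) (mA : measurable (A : set (borel K)))
  (mB : measurable (B : set (borel K))) (AB : A `&` B = set0)
  (A0 : ms A != 0) (B0' : ms B != 0)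
  (Asub : A `<=` cell n b) (Bsub : B `<=` cell n b)
  (Aun : forall x y, B0 a0 k0 x -> B0 a0 k0 y -> dig n.+1 x = dig n.+1 y ->
     A x -> A y)
  (Bun : forall x y, B0 a0 k0 x -> B0 a0 k0 y -> dig n.+1 x = dig n.+1 y ->
     B x -> B y).

Lemma cell_coarse j x : (j <= n)%N -> cell n b x -> dig j x = (b %% p ^ j)%N.
Proof. by move=> jn [Bx <-]; apply: dig_mod. Qed.

Lemma hfun_scale : scale n.+1 (hfun A B).
Proof.
move=> x y Ox Oy e; have Bx := Om_sub _ Ox; have By := Om_sub _ Oy.
have h D : (forall x y, B0 a0 k0 x -> B0 a0 k0 y -> dig n.+1 x = dig n.+1 y ->
     D x -> D y) -> cind D x = cind D y.
  move=> Du; rewrite /cind; congr (nat_of_bool _)%:R.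
  by apply/asboolP/asboolP; apply: Du.
by rewrite /hfun (h A Aun) (h B Bun).
Qed.

Lemma hfun_supp x : hfun A B x != 0 -> A x \/ B x.
Proof.
move=> h; have [Ax|nA] := pselect (A x); first by left.
have [Bx|nB] := pselect (B x); first by right.
by move: h; rewrite /hfun !cindF// !mulr0 subrr mulr0 eqxx.
Qed.

(** In every layer j <= n the integral over the cell of x is 0, because that cell
contains both A and B or meets neither; finer layers vanish by [DopE]. *)
Lemma Dop_hfun x : Om x -> Dop (hfun A B) x = (lam n b)%:C * hfun A B x.
Proof.
move=> Ox; rewrite (DopE n.+1 _ _ hfun_scale Ox) /lam rmorph_sum /= mulr_suml.
have Bx := Om_sub _ Ox.
apply: eq_bigr => j _; rewrite [(_ * ms _)%:C]rmorphM -mulrA; congr (_ * _).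
have jn : (j <= n)%N by rewrite -ltnS.
have pint0 : pint (cell j (dig j x)) (hfun A B) = 0.
  have [e|/eqP ne] := eqVneq (dig j x) (b %% p ^ j)%N.
    apply: pint_hfun_sub => //; first exact: mcell.
      move=> y /Asub h; split; first by case: h.
      by rewrite e; exact: cell_coarse.
    move=> y /Bsub h; split; first by case: h.
    by rewrite e; exact: cell_coarse.
  apply: pint_hfun_disj => //; first exact: mcell.
    apply/seteqP; split => // y [[By e] /Asub/(cell_coarse j _ jn)].
    by rewrite e.
  apply/seteqP; split => // y [[By e] /Bsub/(cell_coarse j _ jn)].
  by rewrite e.
rewrite /layer pint0 subr0.
have [->|h] := eqVneq (hfun A B x) 0; first by rewrite !mulr0.
congr ((ms (cell j _))%:C * _).
by apply: cell_coarse => //; case: (hfun_supp x h) => [/Asub|/Bsub].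
Qed.

(** Symmetry of D against a Haar function. Fine layers integrate to 0 over A and
over B; a coarse layer contributes its cell mass times u, minus a term that is
the same for A and for B and cancels in the difference of mean values. *)
Lemma inner_Dop_hfun N u : scale N u ->
  L2inner mu Om (Dop u) (hfun A B) = (lam n b)%:C * L2inner mu Om u (hfun A B).
Proof.
move=> su0; have su := scaleS _ _ _ (leq_maxr n.+1 N) su0.
(* A common scale for u and for the Haar function. *)
set M := maxn n.+1 N in su.
have iu := scale_cintb M u su.
have iDu := scale_cintb M _ (Dop_scale M u su).
have nM : (n < M)%N by rewrite /M leq_max leqnn.
have pl j D : (n < j)%N -> measurable (D : set (borel K)) ->
   (forall x y, B0 a0 k0 x -> B0 a0 k0 y -> dig n.+1 x = dig n.+1 y ->
     D x -> D y) -> pint D (layer j u) = 0.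
  move=> nj mD Du; apply: pint_layer_cells => // x y Bx By e; apply: Du => //.
  exact: (dig_coarser p_prime _ _ _ j).
have pDop D : measurable (D : set (borel K)) -> D `<=` cell n b -> ms D != 0 ->
   (forall x y, B0 a0 k0 x -> B0 a0 k0 y -> dig n.+1 x = dig n.+1 y ->
     D x -> D y) ->
   (ms D)^-1%:C * pint D (Dop u) = (lam n b)%:C * ((ms D)^-1%:C * pint D u)
     - \sum_(j < n.+1) (wgt j / 2)%:C * pint (cell j (b %% p ^ j)) u.
  move=> mD Dsub D0 Du; rewrite (pint_Dop M)// -(subnKC nM) big_split_ord /=.
  rewrite [X in _ * (_ + X)]big1 ?addr0; last first.
    by move=> j _; rewrite pl ?mulr0//= ltnS leq_addr.
  rewrite /lam rmorph_sum /= mulr_suml -sumrB mulr_sumr; apply: eq_bigr => j _.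
  have jn : (j <= n)%N by rewrite -ltnS.
  rewrite (pint_layer_const j (b %% p ^ j))//; last first.
    by move=> x /Dsub h _; exact: cell_coarse.
  have e : (ms D)^-1%:C * (ms D)%:C = 1 :> C by rewrite -rmorphM mulVf.
  rewrite [(_ / 2 * ms _)%:C]rmorphM /= mulrBr mulrBr; congr (_ - _); first ring.
  rewrite [pint _ _ * _]mulrC mulrCA; congr (_ * _).
  by rewrite mulrA e mul1r.
rewrite !inner_hfun// !pDop//; ring.
Qed.

End HaarEigen.

(** * The wavelets *)

Lemma mscale M (A : set K) : A `<=` B0 a0 k0 ->
  (forall x y, B0 a0 k0 x -> B0 a0 k0 y -> dig M x = dig M y -> A x -> A y) ->
  measurable (A : set (borel K)).
Proof.
move=> AB Au; apply: padic_open_measurable => x Ax; exists (rho M).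
  exact: rho_gt0.
move=> y yx; have Bx := AB _ Ax; have By : B0 a0 k0 y.
  apply: (pabs_dist_le x) => //.
  exact/ltW/(lt_le_trans yx)/rho_le.
apply: (Au x) => //; apply/(dig_eq p_prime _ _ _ _ _ Bx By).
by rewrite pabsC ltW.
Qed.

(** Every r > 0 is the address, at level lvl r + 1, of a cell that is not the
first child of its parent, the cell par r of level lvl r; each such cell arises
from one r. *)
Definition lvl (r : nat) : nat := trunc_log p r.
Definition par (r : nat) : nat := (r %% p ^ lvl r)%N.
(** The union of the siblings that precede the cell Cset r. *)
Definition Aset (r : nat) : set K :=
  [set x | [/\ B0 a0 k0 x, dig (lvl r) x = par r & (dig (lvl r).+1 x < r)%N]].
Definition Cset (r : nat) : set K := cell (lvl r).+1 r.

Lemma lvl_bounds r : (0 < r)%N -> (p ^ lvl r <= r < p ^ (lvl r).+1)%N.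
Proof. by move=> r0; apply: trunc_log_bounds => //; exact: prime_gt1. Qed.

Lemma Aset_sub r : Aset r `<=` cell (lvl r) (par r).
Proof. by move=> x []. Qed.

Lemma Cset_sub r : Cset r `<=` cell (lvl r) (par r).
Proof.
move=> x [Bx e]; split => //.
by rewrite (dig_mod p_prime _ _ _ (lvl r).+1)// e.
Qed.

Lemma Aset_un r x y : B0 a0 k0 x -> B0 a0 k0 y ->
  dig (lvl r).+1 x = dig (lvl r).+1 y -> Aset r x -> Aset r y.
Proof.
move=> Bx By e [_ e1 e2]; split => //; last by rewrite -e.
by rewrite -e1; apply: (dig_coarser p_prime _ _ _ (lvl r).+1).
Qed.

Lemma Cset_un r x y : B0 a0 k0 x -> B0 a0 k0 y ->
  dig (lvl r).+1 x = dig (lvl r).+1 y -> Cset r x -> Cset r y.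
Proof. by move=> Bx By e [_ e1]; split => //; rewrite -e. Qed.

Lemma mAset r : measurable (Aset r : set (borel K)).
Proof. by apply: (mscale (lvl r).+1) => [x []//|]; exact: Aset_un. Qed.

Lemma mCset r : measurable (Cset r : set (borel K)).
Proof. exact: mcell. Qed.

Lemma ACset r : Aset r `&` Cset r = set0.
Proof.
by apply/seteqP; split => // x [[_ _ h] [_ e]]; move: h; rewrite e ltnn.
Qed.

(** Om meets the two sets of the wavelet in positive mass; otherwise there is
nothing to compare. *)
Definition charged (r : nat) : bool :=
  (r == 0%N) || ((ms (Aset r) != 0) && (ms (Cset r) != 0)).

(** The normalised constant, and for each cell but the first children the
comparison with its earlier siblings: for each parent, an orthogonal basis, up to
null functions, of the functions of integral 0 that are constant on its children. *)
Definition wav (r : nat) : K -> C :=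
  if r is 0%N then fun=> (Num.sqrt (ms (B0 a0 k0)))^-1%:C
  else hfun (Aset r) (Cset r).

Definition ev (r : nat) : R :=
  if r is 0%N then 0 else lam (lvl r) (par r).

Lemma wav_scale r : scale (lvl r).+1 (wav r).
Proof.
case: r => [|r] //=; apply: (hfun_scale (lvl r.+1)).
  exact: Aset_un.
exact: Cset_un.
Qed.

Lemma wav_L2 r : L2 mu Om (wav r).
Proof. exact/scale_L2/wav_scale. Qed.

Hypothesis Om0 : Om !=set0.

Lemma ms_cell_Om x n : Om x -> (n0 <= n)%N -> ms (cell n (dig n x)) = rho n.
Proof.
move=> Ox nn; have Bx := Om_sub _ Ox.
have -> : ms (cell n (dig n x)) = fine (mu (cell n (dig n x))).
  rewrite /ms setIidr// => y [By e]; apply: (Om_scale x) => //.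
  by apply: (dig_coarser p_prime _ _ _ n).
by rewrite haar_cell.
Qed.

Lemma le_ms A B : measurable (A : set (borel K)) -> measurable (B : set (borel K)) ->
  A `<=` B -> ms A <= ms B.
Proof.
move=> mA mB AB; rewrite /ms fine_le ?fin_num_muOm//.
by apply: le_measure; rewrite ?inE;
  [apply: measurableI => //; exact: mOm..|exact: setIS].
Qed.

Lemma msB0_gt0 : 0 < ms (B0 a0 k0).
Proof.
have [x Ox] := Om0; apply: (@lt_le_trans _ _ (ms (cell n0 (dig n0 x)))).
  by rewrite ms_cell_Om// rho_gt0.
by apply: le_ms; [exact: mcell|exact: measurable_B0|move=> y []].
Qed.

Lemma inner_wav0 u : cintb u ->
  L2inner mu Om u (wav 0) = (Num.sqrt (ms (B0 a0 k0)))^-1%:C * pint (B0 a0 k0) u.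
Proof.
move=> iu; rewrite /pint -(cintegralZ mu Om mOm); last first.
  by apply: cintb_cind => //; exact: measurable_B0.
apply: eq_cintegral => x Ox.
rewrite cindT; last exact: Om_sub.
rewrite mul1r mulrC; congr (_ * _); exact: conjc_real.
Qed.

Lemma wavS r : (0 < r)%N -> wav r = hfun (Aset r) (Cset r).
Proof. by case: r. Qed.

Lemma B0_sub r : Aset r `<=` B0 a0 k0 /\ Cset r `<=` B0 a0 k0.
Proof. by split => x []. Qed.

Lemma pint_wav0 E r : charged r -> (0 < r)%N -> measurable (E : set (borel K)) ->
  (Aset r `|` Cset r `<=` E) \/ E `&` (Aset r `|` Cset r) = set0 ->
  pint E (wav r) = 0.
Proof.
move=> gr r0 mE h; move: gr; rewrite /charged gtn_eqF//= => /andP[Ar Cr].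
rewrite wavS//; case: h => [h|].
  apply: (pint_hfun_sub _ _ (mAset r) (mCset r) Ar Cr) => //.
    by move=> x Ax; apply: h; left.
  by move=> x Ax; apply: h; right.
rewrite setIUr => /seteqP[h _].
apply: (pint_hfun_disj _ _ (mAset r) (mCset r)) => //.
  by apply/seteqP; split => // x h'; apply: h; left.
by apply/seteqP; split => // x h'; apply: h; right.
Qed.

(** The later wavelet has integral 0 and the earlier one is constant on its
support, except for siblings of one parent, where the roles are exchanged. *)
Lemma wav_orth_lt r s : (r < s)%N -> charged r -> charged s ->
  L2inner mu Om (wav r) (wav s) = 0.
Proof.
move=> rs gr gs; have s0 : (0 < s)%N by apply: leq_ltn_trans rs.
have ir : cintb (wav r) by apply: scale_cintb; exact: wav_scale.
have is_ : cintb (wav s) by apply: scale_cintb; exact: wav_scale.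
have pin E mE r0 := pint_wav0 E r gr r0 mE.
have pin' E := pint_wav0 E s gs s0.
case: (posnP r) => [r0|r0].
  rewrite (inner_conj mu Om mOm _ _ (wav_L2 s) (wav_L2 r)) r0 inner_wav0//.
  rewrite pin' ?mulr0 ?conjc0//; first exact: measurable_B0.
  by left => x []; apply B0_sub.
have [ln|ln] := leqP (lvl s) (lvl r).
- (* Equal levels: either the parents differ and the supports are disjoint, or
     wav s compares cell s with a union of siblings that contains the support
     of wav r. *)
  have e : lvl r = lvl s.
    apply/eqP; rewrite eqn_leq ln andbT /lvl.
    by apply: leq_trunc_log; exact: ltnW.
  rewrite [wav s]wavS// inner_hfun//; [|exact: mAset|exact: mCset].
  have [pe|pe] := eqVneq (par r) (par s).
    rewrite pin//; [|exact: mAset|].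
      rewrite pin//; [by rewrite !mulr0 subrr mulr0|exact: mCset|].
      right; apply/seteqP; split => // x [[_ e1] [[_ _ e2]|[_ e2]]].
        by move: e2; rewrite e e1 ltnNge (ltnW rs).
      by move: rs; rewrite -e1 -e2 e ltnn.
    left => x [[Bx e1 e2]|[Bx e1]]; split => //; rewrite -?e ?e1//.
    + exact: ltn_trans rs.
    + by rewrite (dig_mod p_prime _ _ _ (lvl r).+1)// e1 -pe.
  have dj x : (Aset r `|` Cset r) x -> dig (lvl s) x = par r.
    by rewrite -e => -[/Aset_sub[]|/Cset_sub[]].
  rewrite pin//; [|exact: mAset|].
    rewrite pin//; [by rewrite !mulr0 subrr mulr0|exact: mCset|].
    right; apply/seteqP; split => // x [/Cset_sub[_ e1] /dj e2].
    by move: pe; rewrite -e1 -e2 eqxx.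
  right; apply/seteqP; split => // x [/Aset_sub[_ e1] /dj e2].
  by move: pe; rewrite -e1 -e2 eqxx.
- (* Here wav r is constant on the support of wav s, whose integral is 0. *)
  have E D : (forall x y, B0 a0 k0 x -> B0 a0 k0 y ->
      dig (lvl r).+1 x = dig (lvl r).+1 y -> D x -> D y) ->
      (Aset s `|` Cset s `<=` D) \/ D `&` (Aset s `|` Cset s) = set0.
    move=> Du; have [[x [Dx Sx]]|no] :=
        pselect (exists x, (D `&` (Aset s `|` Cset s)) x); last first.
      by right; apply/seteqP; split => // x h; apply: no; exists x.
    have S y : (Aset s `|` Cset s) y -> B0 a0 k0 y /\ dig (lvl s) y = par s.
      by case=> [/Aset_sub[]|/Cset_sub[]].
    left => y Sy; have [Bx ex] := S x Sx; have [By ey] := S y Sy.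
    apply: (Du x) => //; apply: (dig_coarser p_prime _ _ _ (lvl s)) => //.
    by rewrite ex ey.
  rewrite (inner_conj mu Om mOm _ _ (wav_L2 s) (wav_L2 r)) [wav r]wavS//.
  rewrite inner_hfun//; [|exact: mAset|exact: mCset].
  rewrite pin'; [|exact: mAset|apply: E; exact: Aset_un].
  rewrite pin'; [|exact: mCset|apply: E; exact: Cset_un].
  by rewrite !mulr0 subrr mulr0 conjc0.
Qed.

Lemma wav_orthonormal r s : charged r -> charged s ->
  L2inner mu Om (wav r) (wav s) = (r == s)%:R.
Proof.
move=> gr gs; case: (ltngtP r s) => [rs|sr|<-].
- exact: wav_orth_lt.
- rewrite (inner_conj mu Om mOm _ _ (wav_L2 s) (wav_L2 r)).
  by rewrite wav_orth_lt// conjc0.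
- case: (posnP r) => [->|r0].
    rewrite inner_wav0; last by apply: scale_cintb; exact: (wav_scale 0).
    rewrite pint_cst; last exact: measurable_B0.
    rewrite -!rmorphM /= (_ : _ * _ = 1)// mulrA -expr2 exprVn sqr_sqrtr ?ms_ge0//.
    by rewrite mulVf// gt_eqF// msB0_gt0.
  move: gr; rewrite /charged gtn_eqF//= => /andP[Ar Cr]; rewrite wavS//.
  by apply: hfun_unit => //; [exact: mAset|exact: mCset|exact: ACset].
Qed.

Lemma Dop_wav r x : charged r -> Om x -> Dop (wav r) x = (ev r)%:C * wav r x.
Proof.
case: (posnP r) => [->|r0] gr Ox.
  rewrite (DopE 0)// ?big_ord0 /= ?mul0r//.
move: gr; rewrite /charged gtn_eqF//= => /andP[Ar Cr]; rewrite wavS//.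
rewrite (Dop_hfun (lvl r) (par r))//; first by case: r r0 {Ar Cr}.
- exact: mAset.
- exact: mCset.
- exact: Aset_sub.
- exact: Cset_sub.
- exact: Aset_un.
- exact: Cset_un.
Qed.

Lemma inner_Dop_wav N u r : charged r -> scale N u ->
  L2inner mu Om (Dop u) (wav r) = (ev r)%:C * L2inner mu Om u (wav r).
Proof.
case: (posnP r) => [->|r0] gr su.
  have iDu := scale_cintb N _ (Dop_scale N u su).
  rewrite inner_wav0// (pint_Dop N)//; last exact: measurable_B0.
  rewrite big1 ?mulr0 ?mul0r// => j _.
  rewrite pint_layer_cells ?mulr0//; first exact: measurable_B0.
  exact: (scale_cintb N).
move: gr; rewrite /charged gtn_eqF//= => /andP[Ar Cr]; rewrite wavS//.
rewrite (inner_Dop_hfun (lvl r) (par r) _ _ _ _ _ _ _ _ _ _ N)//;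
  first by case: r r0 {Ar Cr}.
- exact: mAset.
- exact: mCset.
- exact: Aset_sub.
- exact: Cset_sub.
- exact: Aset_un.
- exact: Cset_un.
Qed.

(** * Completeness of the wavelets *)

Lemma pint_set0 u : pint set0 u = 0.
Proof.
rewrite /pint -[RHS](cintegral0 mu Om mOm); apply: eq_cintegral => x _.
by rewrite cindF ?mul0r.
Qed.

Lemma pint_setU A B u : measurable (A : set (borel K)) ->
  measurable (B : set (borel K)) -> cintb u -> A `&` B = set0 ->
  pint (A `|` B) u = pint A u + pint B u.
Proof.
move=> mA mB iu AB; rewrite /pint -(cintegralD mu Om mOm); [|exact: cintb_cind..].
apply: eq_cintegral => x _; rewrite -mulrDl; congr (_ * _).
have [Ax|nA] := pselect (A x).
  have nB : ~ B x by move=> Bx; have : (A `&` B) x by []; rewrite AB.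
  by rewrite cindT; [rewrite cindT// cindF// addr0|left].
rewrite [cind A x]cindF// add0r; have [Bx|nB] := pselect (B x).
  by rewrite !cindT//; right.
by rewrite !cindF// => -[].
Qed.

Section Complete.
Context (f : K -> C) (Lf : L2 mu Om f)
  (f_orth : forall r, charged r -> L2inner mu Om f (wav r) = 0).
Let if_ : cintb f. Proof. exact: L2_cintb. Qed.

(** The union of the first j children of the cell c. *)
Definition part n c j : set K :=
  [set x | cell n c x /\ (dig n.+1 x < c + j * p ^ n)%N].

Lemma part_lt n c : (c < p ^ n)%N -> part n c p = cell n c.
Proof.
move=> cn; apply/seteqP; split => [x []//|x [Bx e]]; split => //.
by rewrite -expnS ltn_addl//; exact: dig_lt.
Qed.

Lemma part0 n c : part n c 0 = set0.
Proof.
apply/seteqP; split => // x [[Bx e]]; rewrite mul0n addn0 -e.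
by rewrite (dig_mod p_prime _ _ n n.+1)// ltnNge leq_mod.
Qed.

Lemma mpart n c j : measurable (part n c j : set (borel K)).
Proof.
apply: (mscale n.+1) => [x [[]]//|x y Bx By e [[_ e1] e2]].
split; last by rewrite -e.
split => //; rewrite -e1.
by apply: (dig_coarser p_prime _ _ n n.+1).
Qed.

Lemma partS n c j : (c < p ^ n)%N ->
  part n c j.+1 = part n c j `|` cell n.+1 (c + j * p ^ n).
Proof.
move=> cn; apply/seteqP; split => [x [[Bx e] h]|x [[[Bx e] h]|[Bx e]]].
- have [l|g|e'] := ltngtP (dig n.+1 x) (c + j * p ^ n)%N.
  + by left.
  + exfalso; move: h g.
    rewrite (divn_eq (dig n.+1 x) (p ^ n)) -(dig_mod p_prime _ _ n n.+1)// e.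
    rewrite addnC !ltn_add2l !ltn_mul2r => /andP[_ h] /andP[_ g].
    by move: g; rewrite ltnNge -ltnS h.
  + by right.
- by split => //; apply: (leq_trans h); rewrite leq_add2l leq_mul2r leqnSn orbT.
- have e1 : dig n x = c.
    by rewrite (dig_mod p_prime _ _ n n.+1)// e addnC modnMDl modn_small.
  split => //; rewrite e ltn_add2l ltn_mul2r ltnSn andbT expn_gt0 prime_gt0//.
Qed.

Lemma part_disj n c j : part n c j `&` cell n.+1 (c + j * p ^ n) = set0.
Proof.
by apply/seteqP; split => // x [[_ h] [_ e]]; move: h; rewrite e ltnn.
Qed.

(** Downward induction on j. Orthogonality to the wavelet of the child j says that
f has the same mean over this child and over the union of the earlier ones; if
their sum is 0, both are. *)
Lemma pint_part n c : (c < p ^ n)%N -> pint (cell n c) f = 0 ->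
  forall j, (j <= p)%N -> pint (part n c j) f = 0.
Proof.
move=> cn f0; suff H i : (i <= p)%N -> pint (part n c (p - i)) f = 0.
  by move=> j jp; rewrite -(subKn jp); apply: H; exact: leq_subr.
elim: i => [|i IH] ip; first by rewrite subn0 part_lt.
have := IH (ltnW ip); rewrite -(subnSK ip).
set j := (p - i.+1)%N; have jp : (j < p)%N by rewrite /j ltn_subrL /= prime_gt0.
rewrite partS// pint_setU//; [|exact: mpart|exact: mcell|exact: part_disj].
have [->|j0] := posnP j; first by rewrite part0 pint_set0.
set r := (c + j * p ^ n)%N.
have lr : lvl r = n.
  apply: trunc_log_eq; first exact: prime_gt1.
  rewrite /r (leq_trans (leq_pmull _ j0)) ?leq_addl//=.
  rewrite expnS (@leq_trans (p ^ n + j * p ^ n))%N// ?ltn_add2r//.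
  by rewrite -mulSn leq_mul2r jp orbT.
have pr : par r = c by rewrite /par lr /r addnC modnMDl modn_small.
have r0 : (0 < r)%N by rewrite /r addn_gt0 muln_gt0 j0 expn_gt0 (prime_gt0 p_prime) orbT.
have eA : part n c j = Aset r.
  rewrite /part /Aset lr pr; apply/seteqP.
  by split => [x [[Bx e] h]|x [Bx e h]].
have eC : cell n.+1 r = Cset r by rewrite /Cset lr.
rewrite eC eA.
have [A0|A0] := eqVneq (ms (Aset r)) 0.
  by move=> _; apply: pint_null => //; exact: mAset.
have [C0|C0] := eqVneq (ms (Cset r)) 0.
  by rewrite [X in _ + X]pint_null ?addr0//; exact: mCset.
have := f_orth r; rewrite /charged A0 C0 orbT => /(_ isT).
rewrite wavS// inner_hfun//; [|exact: mAset|exact: mCset].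
have Ap : 0 < ms (Aset r) by rewrite lt_neqAle eq_sym A0 ms_ge0.
have Cp : 0 < ms (Cset r) by rewrite lt_neqAle eq_sym C0 ms_ge0.
have hw : (hweight (Aset r) (Cset r))%:C != 0 :> C.
  rewrite fmorph_eq0 invr_eq0 gt_eqF// sqrtr_gt0 addr_gt0 ?invr_gt0//.
move/eqP; rewrite mulf_eq0 (negbTE hw) /= => /eqP h /eqP.
rewrite addr_eq0 => /eqP h'; move: h; rewrite h' mulrN -opprD.
rewrite -mulrDl => /eqP; rewrite oppr_eq0 mulf_eq0 -rmorphD fmorph_eq0.
by rewrite gt_eqF ?addr_gt0 ?invr_gt0//= => /eqP ->; rewrite oppr0.
Qed.

(** Down the levels, from B0 through [pint_part]: a child is the difference of two
consecutive parts. *)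
Lemma pint_cell0 n c : pint (cell n c) f = 0.
Proof.
elim: n c => [|n IH] c.
  have [->|[x Bx ->]] := cell_dec a0 k0 0 c; first exact: pint_set0.
  have := f_orth 0%N isT; rewrite inner_wav0// => /eqP.
  rewrite mulf_eq0 fmorph_eq0 invr_eq0 gt_eqF ?sqrtr_gt0 ?msB0_gt0//= => /eqP <-.
  apply: eq_pint_set => y Oy; split => [[]//|By].
  by split => //; rewrite !dig0.
have [->|[x Bx ->]] := cell_dec a0 k0 n.+1 c; first exact: pint_set0.
have cn := dig_lt p_prime a0 k0 n x Bx.
have pn0 : (0 < p ^ n)%N by rewrite expn_gt0 prime_gt0.
set d := (dig n.+1 x %/ p ^ n)%N.
have dp : (d < p)%N by rewrite /d ltn_divLR// -expnS; exact: dig_lt.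
have e : dig n.+1 x = (dig n x + d * p ^ n)%N.
  by rewrite (dig_mod p_prime _ _ n n.+1)// addnC -divn_eq.
have := pint_part n (dig n x) cn (IH _) d.+1 dp.
rewrite partS// pint_setU//; [|exact: mpart|exact: mcell|exact: part_disj].
by rewrite (pint_part n _ cn (IH _))// ?add0r -?e// ltnW.
Qed.

Lemma cells0_ae0 (g : K -> R) : mu.-integrable Om (EFin \o g) ->
  (forall n c, Rintegral mu Om (fun x => (`[< cell n c x >])%:R * g x) = 0) ->
  ae_eq mu Om (EFin \o g) (cst 0%E).
Proof.
move=> ig g0.
have h n c : (\int[mu]_(x in Om `&` cell n c) (g x)%:E = 0)%E.
  have mOc : measurable (Om `&` cell n c : set (borel K)).
    by apply: measurableI; [exact: mOm|exact: mcell].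
  have iOc : mu.-integrable (Om `&` cell n c) (EFin \o g).
    by apply: (integrableS mOm mOc _ ig) => x [].
  rewrite -[LHS]fineK; last exact: integrable_fin_num.
  congr EFin; rewrite -(g0 n c) /Rintegral; congr fine.
  rewrite integral_mkcondr; apply: eq_integral => x _.
  rewrite patchE /=; have [cx|ncx] := pselect (cell n c x).
    by rewrite mem_set// asboolT// mul1r.
  by rewrite memNset// asboolF// mul0r.
apply: (integral_ae_eq mOm ig) => [|E EO mE]; first exact: measurable_cst.
rewrite integral0 -(setIidr EO).
exact: (cells_determine p_prime mu a0 k0 Om g mOm Om_sub ig h E mE).
Qed.

Lemma wav_complete : L2eq mu Om f (fun=> 0).
Proof.
have [rf imf] := if_.
have := cells0_ae0 _ rf; have := cells0_ae0 _ imf.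
have hI n c : Rintegral mu Om (fun x => (`[< cell n c x >])%:R * complex.Im (f x)) = 0.
  rewrite -[RHS]/(complex.Im (0 : C)) -(pint_cell0 n c) /=.
  by apply: eq_Rintegral => x _; rewrite cind_real ImC.
have hR n c : Rintegral mu Om (fun x => (`[< cell n c x >])%:R * complex.Re (f x)) = 0.
  rewrite -[RHS]/(complex.Re (0 : C)) -(pint_cell0 n c) /=.
  by apply: eq_Rintegral => x _; rewrite cind_real ReC.
move=> /(_ hI) aI /(_ hR) aR.
apply: filterS2 aI aR => x hi hr Ox.
by apply: complex_eqP; [case: (hr Ox)|case: (hi Ox)].
Qed.

End Complete.

(** * The heat trace of D *)

Definition Dgraph : set ((K -> C) * (K -> C)) :=
  [set fg | [/\ L2 mu Om fg.1, L2 mu Om fg.2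
  & exists u : nat -> K -> C, [/\ forall n, lconst (u n),
      L2cvg mu Om u fg.1 & L2cvg mu Om (fun n => Dop (u n)) fg.2]]].

Lemma L2cvg_cst f : L2cvg mu Om (fun=> f) f.
Proof.
rewrite /L2cvg (_ : (fun n => _) = (fun=> 0%E)); first exact: cvg_cst.
by apply/funext => n; apply: integral0_eq => x _; rewrite subrr normsq0.
Qed.

Lemma wav_Dgraph r : charged r -> Dgraph (wav r, fun x => (ev r)%:C * wav r x).
Proof.
move=> gr; split => /=; [exact: wav_L2|by apply: (L2Z mOm); exact: wav_L2|].
exists (fun=> wav r); split; first by move=> _; exact/scale_lconst/wav_scale.
  exact: L2cvg_cst.
rewrite /L2cvg (_ : (fun n => _) = (fun=> 0%E)); first exact: cvg_cst.
apply/funext => n; apply: integral0_eq => x Ox.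
by rewrite Dop_wav// subrr normsq0.
Qed.

Lemma inner_wav_le g r : charged r -> L2 mu Om g ->
  normsq (L2inner mu Om g (wav r)) <= fine (L2normsq mu Om g).
Proof.
move=> gr Lg.
have := @bessel _ _ _ mu Om mOm unit (fun=> wav r) (fun=> wav_L2 r) _ [:: tt] g Lg isT.
rewrite big_seq1; apply => -[] []; by rewrite wav_orthonormal// eqxx.
Qed.

(** Symmetry passes to the closure: along approximations u of f, the coefficients
of D u are ev r times those of u, and in the limit (k - ev r) <f, wav r> = 0. *)
Lemma Dgraph_eigenvalue f (k : R) r : charged r -> L2 mu Om f ->
  Dgraph (f, fun x => k%:C * f x) -> L2inner mu Om f (wav r) != 0 -> k = ev r.
Proof.
move=> gr Lf [_ /= Lkf [u [lu uf Duf]]] h; apply/eqP/negPn/negP => kr.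
pose I f := L2inner mu Om f (wav r).
pose X := normsq ((k - ev r)%:C * I f).
have X0 : 0 < X.
  rewrite lt_neqAle normsq_ge0 andbT eq_sym; apply/eqP => /normsq_eq0/eqP.
  by rewrite mulf_eq0 fmorph_eq0 subr_eq0 (negbTE kr) (negbTE h).
(* The error allowed for u and for D u, so that the estimate below adds up to X. *)
pose c := 2 * (1 + ev r ^+ 2).
have c0 : 0 < c by rewrite mulr_gt0// ltr_pwDl// sqr_ge0.
have e0 : 0 < X / c by rewrite divr_gt0.
have [N1 h1] := L2cvg_small _ _ _ uf e0.
have [N2 h2] := L2cvg_small _ _ _ Duf e0.
pose n := maxn N1 N2.
have {}h1 := h1 n (leq_maxl _ _); have {}h2 := h2 n (leq_maxr _ _).
have [M su] := lconst_scale _ (lu n).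
have Lu := scale_L2 _ _ su; have LDu := scale_L2 _ _ (Dop_scale _ _ su).
have L1 := L2B mu Om mOm _ _ Lu Lf; have L2' := L2B mu Om mOm _ _ LDu Lkf.
have Lw := wav_L2 r.
have e : (k - ev r)%:C * I f = (ev r)%:C * I (fun x => u n x - f x) -
    I (fun x => Dop (u n) x - k%:C * f x).
  rewrite /I !innerBl//; try exact: mOm; try exact: (L2Z mOm).
  rewrite (inner_Dop_wav M)// innerZl//; last exact: mOm.
  by rewrite rmorphB /=; ring.
have : X < X; last by rewrite ltxx.
rewrite {1}/X e; apply: (le_lt_trans (normsqD _ _)).
rewrite normsqN normsqM normsqR.
have b1 : normsq (I (fun x => u n x - f x)) < X / c.
  apply: le_lt_trans (inner_wav_le _ _ gr L1) _.
  by rewrite -lte_fin fine_nsqK.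
have b2 : normsq (I (fun x => Dop (u n) x - k%:C * f x)) < X / c.
  apply: le_lt_trans (inner_wav_le _ _ gr L2') _.
  by rewrite -lte_fin fine_nsqK.
have -> : X = 2 * (ev r ^+ 2 * (X / c) + X / c).
  by rewrite /c; field; rewrite gt_eqF ?ltr_pwDl ?sqr_ge0.
rewrite ltr_pM2l// ler_ltD// ler_wpM2l ?sqr_ge0//; exact: ltW.
Qed.

Definition wav_index := {r : nat | charged r}.

Lemma D_eigenbasis : eigenbasis mu Om (L2 mu Om) Dgraph
  (fun i : wav_index => wav (val i)) (fun i => ev (val i)).
Proof.
split.
- by move=> i; exact: wav_L2.
- by move=> i; apply: wav_Dgraph; exact: valP.
- by move=> i j; rewrite wav_orthonormal -?val_eqE//; exact: valP.
- move=> f Lf h; apply: wav_complete => // r gr.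
  exact: (h (Sub r gr)).
Qed.

Section LowerBound.
Context (alpha_ge : 1 / 2 <= alpha).

Lemma rhoS j : rho j = rho j.+1 * q.
Proof.
rewrite !rhoE// exprS invfM -!mulrA; congr (_ * _).
by rewrite [_^-1 * q]mulrC mulrA mulVf ?mul1r ?q_neq0.
Qed.

Lemma kap_rhoS j : kap (rho j.+1) = (q `^ alpha) ^+ 2 * kap (rho j).
Proof.
rewrite /kap [rho j]rhoS powRM ?ltW ?rho_gt0 ?q_gt0//.
rewrite invfM exprMn mulrCA -exprMn mulfV ?expr1n ?mulr1//.
by rewrite gt_eqF// powR_gt0 ?q_gt0.
Qed.

(** The only place where alpha >= 1/2 enters. *)
Lemma q_le_qalpha : q <= (q `^ alpha) ^+ 2.
Proof.
have q0 : 0 <= q by rewrite ltW ?q_gt0.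
rewrite -powR_mulrn ?powR_ge0// -powRrM -[X in X <= _](powRr1 q0).
apply: ler_powR; first exact/ltW/q_gt1.
by move: alpha_ge; rewrite ler_pdivrMr.
Qed.

Let k1 := kap (rho 0) * rho 0.
Let k1_gt0 : 0 < k1.
Proof. by rewrite mulr_gt0 ?kap_gt0 ?rho_gt0. Qed.

(** The product r ^ (1 - 2 alpha) does not decrease as r shrinks. *)
Lemma kap_rho_ge j : k1 <= kap (rho j) * rho j.
Proof.
elim: j => // j IH; apply: le_trans IH _.
rewrite kap_rhoS [X in _ * X <= _]rhoS mulrA mulrAC.
rewrite ler_wpM2r//; first by rewrite ltW ?rho_gt0.
by rewrite mulrC ler_wpM2r ?q_le_qalpha// ltW ?kap_gt0 ?rho_gt0.
Qed.

Lemma wgt_rho_ge j : (1 - q^-1) * k1 <= wgt j * rho j.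
Proof.
have qi : 0 <= 1 - q^-1 by rewrite subr_ge0 invf_le1 ?q_gt0// ltW ?q_gt1.
case: j => [|j] /=.
  apply: ler_piMl; first by apply/ltW; exact: k1_gt0.
  by rewrite gerBl invr_ge0 ltW ?q_gt0.
apply: (@le_trans _ _ ((1 - q^-1) * (kap (rho j.+1) * rho j.+1))).
  by rewrite ler_wpM2l// kap_rho_ge.
rewrite mulrA ler_wpM2r//; first by rewrite ltW ?rho_gt0.
have kj : 0 <= kap (rho j) by rewrite ltW ?kap_gt0 ?rho_gt0.
rewrite mulrBl mul1r lerD2l lerN2 kap_rhoS mulrA ler_peMl//.
by rewrite mulrC ler_pdivlMr ?q_gt0// mul1r q_le_qalpha.
Qed.

(** A cell meeting Om contains a cell of level max(j, n0) that lies inside Om. *)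
Lemma ms_ge j x : Om x -> rho j * q ^- n0 <= ms (cell j (dig j x)).
Proof.
move=> Ox; have Bx := Om_sub _ Ox.
have qn1 : q ^- n0 <= 1.
  by rewrite invf_le1 ?exprn_gt0 ?q_gt0// exprn_ege1// ltW ?q_gt1.
case: (leqP n0 j) => [nj|jn].
  by rewrite ms_cell_Om// ler_piMr// ltW ?rho_gt0.
apply: (@le_trans _ _ (ms (cell n0 (dig n0 x)))).
  rewrite ms_cell_Om// rhoE// rhoE// mulrAC ler_piMr//.
    by rewrite mulr_ge0 ?invr_ge0 ?exprn_ge0 ?ltW ?qX_gt0 ?q_gt0.
  by rewrite invf_le1 ?exprn_gt0 ?q_gt0// exprn_ege1// ltW ?q_gt1.
apply: le_ms; [exact: mcell|exact: mcell|move=> y [By e]].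
by split => //; apply: (dig_coarser p_prime _ _ j n0) => //; exact: ltnW.
Qed.

Definition ev_rate : R := (1 - q^-1) * k1 * q ^- n0 / 2.

Lemma ev_rate_gt0 : 0 < ev_rate.
Proof.
rewrite /ev_rate divr_gt0// mulr_gt0 ?invr_gt0 ?exprn_gt0 ?q_gt0//.
by rewrite mulr_gt0// subr_gt0 invf_lt1 ?q_gt0 ?q_gt1.
Qed.

(** Each of the lvl r + 1 levels contributes at least a constant: its weight is at
least of order r ^ (- 2 alpha) for cells of radius r, and their mass of order r,
where 1 - 2 alpha <= 0. *)
Lemma ev_ge r : charged r -> (0 < r)%N -> ev_rate * (lvl r).+1%:R <= ev r.
Proof.
move=> gr r0; move: gr; rewrite /charged gtn_eqF//= => /andP[_ C0].
have [x [Ox Cx]] : exists x, Om x /\ Cset r x.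
  apply: contrapT => no; move/eqP: C0; apply; rewrite /ms.
  rewrite (_ : _ `&` _ = set0) ?measure0//.
  by apply/seteqP; split => // x [Ox Cx]; apply: no; exists x.
have -> : ev r = lam (lvl r) (par r) by case: r r0 {C0 Cx}.
rewrite mulr_natr -[X in _ *+ X]card_ord -sumr_const /lam.
apply: ler_sum => j _; have jn : (j <= lvl r)%N by rewrite -ltnS.
rewrite -(cell_coarse (lvl r) (par r) j x jn (Cset_sub r x Cx)).
rewrite /ev_rate [leRHS]mulrAC ler_wpM2r//.
apply: le_trans (ler_wpM2l (wgt_ge0 j) (ms_ge j x Ox)).
rewrite [leRHS]mulrA ler_wpM2r ?wgt_rho_ge// invr_ge0 exprn_ge0// ltW ?q_gt0//.
Qed.

Lemma lt_plvl r : (r < p ^ (lvl r).+1)%N.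
Proof.
case: (posnP r) => [->|r0]; first by rewrite expn_gt0 prime_gt0.
by have /andP[] := lvl_bounds r r0.
Qed.

Lemma ev_finite_multiplicities :
  finite_multiplicities wav_index (fun i => ev (val i)).
Proof.
move=> c; pose N := (Num.bound (c / ev_rate)).+1.
exists (pmap insub (iota 0 (p ^ N))) => -[r gr] /= e.
rewrite mem_pmap_sub /= mem_iota /= add0n.
case: (posnP r) => [->|r0]; first by rewrite expn_gt0 prime_gt0.
apply: (leq_trans (lt_plvl r)); rewrite leq_exp2l ?prime_gt1//.
have := ev_ge r gr r0; rewrite e mulrC -ler_pdivlMr ?ev_rate_gt0// => h.
have : 0 <= c / ev_rate by rewrite (le_trans _ h).
move/archi_boundP => hb; have := le_lt_trans h hb.
by rewrite ltr_nat /N => /ltnW/leq_trans; apply.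
Qed.

Lemma D_heat_trace t : heat_trace mu Om (L2 mu Om) Dgraph t
  = (\esum_(i in [set: wav_index]) (expR (- (ev (val i) * t)))%:E)%E.
Proof.
apply: (heat_traceE mu Om mOm) => //.
- by move=> f g c Lf Lg; apply: L2B => //; [exact: mOm|exact: (L2Z mOm)].
- exact: D_eigenbasis.
- exact: ev_finite_multiplicities.
- by move=> f k [r gr] Lf; exact: Dgraph_eigenvalue.
Qed.

Lemma sum_uniq_le (F : nat -> R) (B : R) (s : seq nat) : (forall r, 0 <= F r) ->
  (forall M, \sum_(r < M) F r <= B) -> uniq s -> \sum_(r <- s) F r <= B.
Proof.
move=> F0 FB us; pose M := (\max_(r <- s) r).+1.
apply: le_trans (FB M); rewrite -(big_mkord xpredT) [leRHS](bigID (mem s)) /=.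
rewrite -[leLHS]addr0; apply: lerD; last exact: sumr_ge0.
rewrite le_eqVlt; apply/orP; left; apply/eqP; rewrite -[RHS]big_filter.
apply: perm_big; apply: uniq_perm => //; first exact/filter_uniq/iota_uniq.
move=> r; rewrite mem_filter mem_index_iota /=.
case: (boolP (r \in s)) => //= rs; have rm : (r <= \max_(i <- s) i)%N.
  exact: (@leq_bigmax_seq _ s xpredT (fun i => i) r rs isT).
by rewrite /M ltnS rm.
Qed.

(** Telescoping against 1 / r - 1 / (r + 1). *)
Lemma sum_inv_sq M : \sum_(r < M) (if r == 0%N :> nat then 0 else (r.+1%:R : R) ^- 2) <= 1.
Proof.
case: M => [|M]; first by rewrite big_ord0.
suff : \sum_(r < M.+1) (if r == 0%N :> nat then 0 else (r.+1%:R : R) ^- 2)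
    <= 1 - M.+1%:R^-1 by move/le_trans; apply; rewrite gerBl invr_ge0.
elim: M => [|M IH]; first by rewrite big_ord1 /= invr1 subrr.
rewrite big_ord_recr /=; apply: (le_trans (lerD IH (lexx _))).
have ap : 0 < (M.+1%:R : R) by [].
rewrite -[M.+2]addn1 natrD; set a := M.+1%:R in ap *.
have a1 : 0 < a + 1 by rewrite addr_gt0.
rewrite -subr_ge0.
have -> : 1 - (a + 1)^-1 - (1 - a^-1 + (a + 1) ^- 2) = a^-1 * (a + 1) ^- 2.
  by field; rewrite !gt_eqF.
by rewrite mulr_ge0 ?invr_ge0 ?exprn_ge0// ltW.
Qed.

Lemma trace_ge1 t : (1 <= \esum_(i in [set: wav_index]) (expR (- (ev (val i) * t)))%:E)%E.
Proof.
pose i0 : wav_index := Sub 0%N isT.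
apply: esum_ge; exists [set i0]; first by split.
by rewrite fsbig_set1 /= mul0r oppr0 expR0.
Qed.

(** With y = e ^ (- c t) the wavelet r of level n contributes at most y ^ (n + 1).
Once y <= p ^ (-2), this is at most y p ^ 2 / (p ^ (n + 1)) ^ 2, and r + 1 is at
most p ^ (n + 1): the sum over r converges like that of 1 / r ^ 2. *)
Lemma trace_le t : 0 <= t -> expR (- (ev_rate * t)) <= q ^- 2 ->
  (\esum_(i in [set: wav_index]) (expR (- (ev (val i) * t)))%:E
   <= (1 + expR (- (ev_rate * t)) * q ^+ 2)%:E)%E.
Proof.
move=> t0; set y := expR _ => yq.
apply: ge_ereal_sup => _ [X [finX _] <-].
rewrite fsbig_finite//=; have := fset_uniq (fset_set X).
move: (enum_fset _) => s us; rewrite sumEFin lee_fin.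
rewrite -(big_map val xpredT (fun r => expR (- (ev r * t)))).
have gs : all charged (map val s) by apply/allP => _ /mapP[i _ ->]; exact: valP.
have {us} : uniq (map val s) by rewrite map_inj_uniq//; exact: val_inj.
move: (map val s) gs => s' /allP gs us.
(* A majorant of the term of each wavelet; the constant has eigenvalue 0. *)
pose F r : R := if r == 0%N then 1 else y * q ^+ 2 * r.+1%:R ^- 2.
have y0 : 0 <= y by exact: expR_ge0.
apply: (@le_trans _ _ (\sum_(r <- s') F r)).
  rewrite big_seq [leRHS]big_seq; apply: ler_sum => r /gs gr.
  rewrite /F; case: ifPn => [/eqP -> /=|]; first by rewrite mul0r oppr0 expR0.
  rewrite -lt0n => r0; set n := lvl r.
  apply: (@le_trans _ _ (y ^+ n.+1)).
    rewrite -expRM_natl ler_expR mulrN lerN2 mulrA; apply: ler_wpM2r => //.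
    by rewrite mulrC; exact: ev_ge.
  apply: (@le_trans _ _ (y * (q ^- 2) ^+ n)).
    by rewrite exprS ler_wpM2l// lerXn2r ?nnegrE ?invr_ge0 ?exprn_ge0// ltW ?q_gt0.
  rewrite -mulrA ler_wpM2l//.
  have -> : (q ^- 2) ^+ n = q ^+ 2 * (q ^+ n.+1) ^- 2.
    rewrite exprVn -!exprM [(n.+1 * 2)%N]mulnC mulnS exprD invfM mulrA mulfV ?mul1r//.
    by rewrite expf_neq0// q_neq0.
  apply: ler_wpM2l; first by rewrite exprn_ge0// ltW ?q_gt0.
  rewrite lef_pV2 ?posrE ?exprn_gt0 ?(q_gt0 p_prime)//.
  apply: lerXn2r; rewrite ?nnegrE ?exprn_ge0//.
  by rewrite -natrX ler_nat lt_plvl.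
apply: (sum_uniq_le F (1 + y * q ^+ 2) s') => // [r|M].
  by rewrite /F; case: ifP => // _; rewrite !mulr_ge0 ?invr_ge0 ?exprn_ge0// ltW ?q_gt0.
apply: (@le_trans _ _ (\sum_(r < M) ((r == 0%N :> nat)%:R +
    y * q ^+ 2 * (if r == 0%N :> nat then 0 else (r.+1%:R : R) ^- 2)))).
  apply: ler_sum => r _; rewrite /F.
  by case: ifP => _ /=; rewrite ?mulr0 ?addr0 ?add0r.
rewrite big_split /= -mulr_sumr; apply: lerD; last first.
  rewrite ler_piMr ?sum_inv_sq// mulr_ge0// exprn_ge0// ltW ?q_gt0//.
case: M => [|M]; first by rewrite big_ord0.
by rewrite big_ord_recl /= big1 ?addr0.
Qed.

Lemma D_trace_cvg :
  heat_trace mu Om (L2 mu Om) Dgraph t @[t --> +oo] --> (1%E : \bar R).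
Proof.
have c0 := ev_rate_gt0.
have y0 : expR (- (ev_rate * t)) @[t --> +oo] --> (0 : R).
  have h : ev_rate * t @[t --> +oo] --> +oo.
    by apply: gt0_cvgMry => //; exact: cvg_id.
  exact: (cvg_comp _ _ h (@cvgr_expR R)).
apply: (@squeeze_cvge _ _ _ _ (fun=> 1%E) _
  (fun t => (1 + expR (- (ev_rate * t)) * q ^+ 2)%:E)).
- near=> t; apply/andP; split; rewrite D_heat_trace; first exact: trace_ge1.
  apply: trace_le.
    by near: t; apply: nbhs_pinfty_ge; exact: num_real.
  near: t; apply: filterS (cvgr_lt _ y0 (q ^- 2) _) => [x|]; first exact: ltW.
  by rewrite invr_gt0 exprn_gt0// q_gt0.
- exact: cvg_cst.
- apply: cvg_EFin; first exact: nearW.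
  rewrite -[X in _ --> X]addr0; apply: cvgD; first exact: cvg_cst.
  by rewrite -(mul0r (q ^+ 2)); apply: cvgMl.
Unshelve. all: by end_near. Qed.

End LowerBound.

(** * Square-integrable functions of two variables *)

Local Notation OmE := (Om `*` Om).
Local Notation mE := (muE mu).

Lemma mOmE : measurable (OmE : set (borel K * borel K)).
Proof. by apply: measurableX; exact: mOm. Qed.

Lemma muEX (A B : set (borel K)) : measurable A -> measurable B ->
  mE (A `*` B) = (mu A * mu B)%E.
Proof. by move=> mA mB; exact: product_measure1E. Qed.

Lemma fubiniE_F (k : K * K -> \bar R) x : Om x ->
  fubini_F (T1 := borel K) mu (k \_ OmE) x = (\int[mu]_(y in Om) k (x, y))%E.
Proof.
move=> Ox; rewrite /fubini_F [RHS]integral_mkcond; apply: eq_integral => y _.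
rewrite !patchE; have [Oy|nOy] := pselect (Om y).
  by rewrite !mem_set.
by rewrite !memNset// => -[].
Qed.

(** Tonelli on a product set, obtained by extending the integrand by 0. *)
Lemma tonelliE (k : K * K -> \bar R) : measurable_fun (OmE : set (borel K * borel K)) k ->
  (forall z, (0 <= k z)%E) ->
  (\int[mE]_(z in OmE) k z = \int[mu]_(x in Om) \int[mu]_(y in Om) k (x, y))%E.
Proof.
move=> mk kp; rewrite integral_mkcond /muE fubini_tonelli1; first last.
- by move=> z; rewrite patchE; case: ifP.
- by apply/(measurable_restrictT _ mOmE).
rewrite [RHS]integral_mkcond; apply: eq_integral => x _.
rewrite [RHS]patchE; case: ifPn => [/set_mem Ox|/negP nOx].
  exact: fubiniE_F.
apply: integral0_eq => y _; rewrite patchE memNset// => -[/= Ox _].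
by apply: nOx; exact: mem_set.
Qed.

Lemma measurable_fubiniE (k : K * K -> \bar R) :
  measurable_fun (OmE : set (borel K * borel K)) k -> (forall z, (0 <= k z)%E) ->
  measurable_fun (Om : set (borel K)) (fun x => (\int[mu]_(y in Om) k (x, y))%E).
Proof.
move=> mk kp.
have m1 : measurable_fun setT (fubini_F (T1 := borel K) mu (k \_ OmE)).
  apply: measurable_fun_fubini_tonelli_F => [|z].
    by apply/(measurable_restrictT _ mOmE).
  by rewrite patchE; case: ifP.
have := measurable_funTS (D := (Om : set (borel K))) m1.
by apply: eq_measurable_fun => x /set_mem Ox; rewrite fubiniE_F.
Qed.

Lemma measurable_fstE (g : K -> R) : measurable_fun (Om : set (borel K)) g ->
  measurable_fun (OmE : set (borel K * borel K)) (fun z => g z.1).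
Proof.
move=> mg; apply: (measurable_comp mOm _ mg).
- by move=> _ [z [Oz _] <-].
- by apply: measurable_funTS; exact: measurable_fst.
Qed.

Lemma measurable_sndE (g : K -> R) : measurable_fun (Om : set (borel K)) g ->
  measurable_fun (OmE : set (borel K * borel K)) (fun z => g z.2).
Proof.
move=> mg; apply: (measurable_comp mOm _ mg).
- by move=> _ [z [_ Oz] <-].
- by apply: measurable_funTS; exact: measurable_snd.
Qed.

Lemma nsq_fst (g : K -> C) : L2 mu Om g ->
  L2normsq mE OmE (fun z => g z.1) = (L2normsq mu Om g * mu Om)%E.
Proof.
move=> [rg ig _]; rewrite /L2normsq tonelliE.
- transitivity (\int[mu]_(x in Om) ((normsq (g x))%:E * mu Om))%E.
    by apply: eq_integral => x _; exact: (integral_cst mu mOm (normsq (g x))%:E).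
  rewrite (ge0_integralZr mu mOm)//; first exact: (measurable_normsq (T := borel K) Om g rg ig).
  by move=> x _; rewrite lee_fin normsq_ge0.
- by apply: measurable_normsq; [exact: (measurable_fstE _ rg)|exact: (measurable_fstE _ ig)].
- by move=> z; rewrite lee_fin normsq_ge0.
Qed.

Lemma nsq_snd (g : K -> C) : L2 mu Om g ->
  L2normsq mE OmE (fun z => g z.2) = (L2normsq mu Om g * mu Om)%E.
Proof.
move=> Lg; have [rg ig _] := Lg; rewrite /L2normsq tonelliE.
- rewrite -[(\int[mu]_(x in Om) (normsq (g x))%:E)%E]/(L2normsq mu Om g).
  rewrite -(fine_nsqK mu Om _ Lg) -(integral_cst mu mOm).
  by apply: eq_integral => x _; rewrite fine_nsqK.
- by apply: measurable_normsq; [exact: (measurable_sndE _ rg)|exact: (measurable_sndE _ ig)].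
- by move=> z; rewrite lee_fin normsq_ge0.
Qed.

Lemma L2_fst (g : K -> C) : L2 mu Om g -> L2 mE OmE (fun z => g z.1).
Proof.
move=> Lg; have [rg ig ng] := Lg; split; [exact: (measurable_fstE _ rg)|exact: (measurable_fstE _ ig)|].
by rewrite nsq_fst// lte_mul_pinfty ?nsq_ge0 ?Om_fin// ge0_fin_numE ?nsq_ge0.
Qed.

Lemma L2_snd (g : K -> C) : L2 mu Om g -> L2 mE OmE (fun z => g z.2).
Proof.
move=> Lg; have [rg ig ng] := Lg; split; [exact: (measurable_sndE _ rg)|exact: (measurable_sndE _ ig)|].
by rewrite nsq_snd// lte_mul_pinfty ?nsq_ge0 ?Om_fin// ge0_fin_numE ?nsq_ge0.
Qed.

(** The two-variable analogue of [scale]. *)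
Definition scale2 (N : nat) (h : K * K -> C) :=
  forall x x' y y', Om x -> Om x' -> Om y -> Om y' -> dig N x = dig N x' ->
    dig N y = dig N y' -> h (x, y) = h (x', y').

Lemma L2_indE A B : measurable (A : set (borel K)) -> measurable (B : set (borel K)) ->
  L2 mE OmE (fun z => cind A z.1 * cind B z.2).
Proof.
move=> mA mB; have LA := L2_fst _ (L2_cind A mA); have LB := L2_snd _ (L2_cind B mB).
have := L2_mul_conj mE OmE mOmE _ _ LA LB => -[ri ii]; split.
- have := measurable_int _ ri => /measurable_EFinP; apply: eq_measurable_fun.
  by move=> z _ /=; congr complex.Re; congr (_ * _); exact: conj_cind.
- have := measurable_int _ ii => /measurable_EFinP; apply: eq_measurable_fun.
  by move=> z _ /=; congr complex.Im; congr (_ * _); exact: conj_cind.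
- have [ra ia na] := LA; apply: le_lt_trans na; apply: ge0_le_integral.
  + exact: mOmE.
  + by move=> z _; rewrite lee_fin normsq_ge0.
  + apply: measurable_normsq.
      have := measurable_int _ ri => /measurable_EFinP; apply: eq_measurable_fun.
      by move=> z _ /=; congr complex.Re; congr (_ * _); exact: conj_cind.
    have := measurable_int _ ii => /measurable_EFinP; apply: eq_measurable_fun.
    by move=> z _ /=; congr complex.Im; congr (_ * _); exact: conj_cind.
  + exact: measurable_normsq.
  + move=> z _; rewrite lee_fin normsqM ler_piMr ?normsq_ge0//.
    by rewrite cind_real normsqR; case: asboolP => _; rewrite ?expr1n ?expr0n.
Qed.

Definition step_value2 (N : nat) (h : K * K -> C) (c c' : nat) : C :=
  h (xget a0 (Om `&` cell N c), xget a0 (Om `&` cell N c')).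

Lemma scale2_sum N h : scale2 N h -> forall z, OmE z ->
  \sum_(c < p ^ N) \sum_(c' < p ^ N)
    step_value2 N h c c' * (cind (cell N c) z.1 * cind (cell N c') z.2) = h z.
Proof.
move=> sh [x y] [/= Ox Oy].
have sx : scale N (fun x => h (x, y)) by move=> ? ? ? ? ?; apply: sh.
rewrite -(scale_sum N _ sx x Ox); apply: eq_bigr => c _.
set x' := xget a0 (Om `&` cell N c).
have [cx|nc] := pselect (cell N c x); last first.
  by rewrite cindF// mulr0 big1// => c' _; rewrite mul0r mulr0.
have Ox' : Om x' by rewrite /x'; case: xgetP => [z _ []//|/(_ x)[]].
have sy : scale N (fun y => h (x', y)) by move=> ? ? ? ? ?; apply: sh.
rewrite /step_value -/x' -(scale_sum N _ sy y Oy) mulr_suml.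
by apply: eq_bigr => c' _; rewrite [cind (cell N c) x * _]mulrC mulrA.
Qed.

Lemma scale2_L2 N h : scale2 N h -> L2 mE OmE h.
Proof.
move=> sh; apply: (eq_L2 mE OmE _ _ (scale2_sum N h sh)).
apply: (L2_sum mOmE) => c; apply: (L2_sum mOmE) => c'.
by apply: (L2Z mOmE); apply: L2_indE; exact: mcell.
Qed.

(** * The kernel of d *)

Definition dE (u : K -> C) (z : K * K) : C :=
  (u z.1 - u z.2) / (2 * pabs (z.1 - z.2) `^ alpha)%:C.

(** Off the diagonal cells, moving x and y within cells of level N does not change
|x - y|; on them u x - u y is 0. *)
Lemma dE_scale2 N u : scale N u -> scale2 N (dE u).
Proof.
move=> su x x' y y' Ox Ox' Oy Oy' ex ey; rewrite /dE /=.
rewrite (su x x' Ox Ox' ex) (su y y' Oy Oy' ey).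
have [e|/eqP ne] := eqVneq (dig N x) (dig N y).
  by rewrite (su x' y')// ?subrr ?mul0r// -ex -ey.
congr (_ / (2 * _ `^ _)%:C).
have [Bx Bx' By By'] : [/\ B0 a0 k0 x, B0 a0 k0 x', B0 a0 k0 y & B0 a0 k0 y'].
  by split; exact: Om_sub.
have dx := (dig_eq p_prime _ _ _ _ _ Bx Bx').1 ex.
have dy := (dig_eq p_prime _ _ _ _ _ By By').1 ey.
have xy : rho N < pabs (x - y).
  by rewrite ltNge; apply/negP => /(dig_eq p_prime _ _ _ _ _ Bx By).
have -> : x' - y' = (x' - x + (y - y')) + (x - y) by ring.
rewrite [RHS]pabs_isosceles//; apply: le_lt_trans xy.
by apply: pabs_ultra_le => //; rewrite pabsC.
Qed.

(** rho 0 bounds |x - y| on Om. *)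
Lemma dE_bound N u : scale N u ->
  (L2normsq mE OmE (fun z => u z.1 - u z.2)%R <=
   ((2 * rho 0 `^ alpha) ^+ 2)%:E * L2normsq mE OmE (dE u))%E.
Proof.
move=> su; have [rd id nd] := scale2_L2 N _ (dE_scale2 N u su).
have [r i n] := L2B _ _ mOmE _ _ (L2_fst _ (scale_L2 N u su)) (L2_snd _ (scale_L2 N u su)).
rewrite /L2normsq -ge0_integralZl; first last.
- by rewrite lee_fin sqr_ge0.
- by move=> z _; rewrite lee_fin normsq_ge0.
- exact: measurable_normsq.
- exact: mOmE.
apply: ge0_le_integral.
- exact: mOmE.
- by move=> z _; rewrite lee_fin normsq_ge0.
- exact: measurable_normsq.
- apply: emeasurable_funM; first exact: measurable_cst.
  exact: measurable_normsq.
move=> [x y] [/= Ox Oy]; rewrite -EFinM lee_fin /dE /=.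
have [->|xy] := eqVneq x y.
  by rewrite subrr normsq0 mul0r normsq0 mulr0.
have d0 : 0 < pabs (x - y) by rewrite pabs_neq0 ?subr_eq0.
rewrite normsqM mulrCA ler_peMr ?normsq_ge0//.
rewrite -fmorphV normsqR -exprMn; apply: exprn_ege1.
have t0 : 0 < 2 * pabs (x - y) `^ alpha by rewrite mulr_gt0// powR_gt0.
rewrite ler_pdivlMr// mul1r ler_pM2l//.
apply: ge0_ler_powR; rewrite ?nnegrE; [exact: ltW|exact: ltW| |].
  by rewrite ltW ?rho_gt0.
by apply/(dig_eq p_prime _ _ _ _ _ (Om_sub _ Ox) (Om_sub _ Oy)); rewrite !dig0//; exact: Om_sub.
Qed.

Definition dgraph : set ((K -> C) * (K * K -> C)) :=
  [set fh | [/\ L2 mu Om fh.1,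
     L2 mE OmE fh.2 /\ L2eq mE OmE fh.2 (fun z => - fh.2 (z.2, z.1))
  & exists u : nat -> K -> C, [/\ forall n, lconst (u n),
      L2cvg mu Om u fh.1 & L2cvg mE OmE (fun n => dE (u n)) fh.2]]].

Definition d_kernel : set (K -> C) := [set f | dgraph (f, fun=> 0)].

Lemma cst_d_kernel (c : C) : d_kernel (fun=> c).
Proof.
split => /=.
- by apply: (scale_L2 0).
- split; first exact: L20.
  by apply: filterE => z _; rewrite oppr0.
- exists (fun _ _ => c); split; first by move=> n; exact: (scale_lconst 0).
    exact: L2cvg_cst.
  rewrite /L2cvg (_ : (fun n => _) = (fun=> 0%E)); first exact: cvg_cst.
  apply/funext => n; apply: integral0_eq => z _.
  by rewrite /dE subrr mul0r subrr normsq0.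
Qed.

(** Split f x - f y through an approximation u n; the three differences tend to 0
in L2, the middle one by [dE_bound]. So f x = f y for almost all (x, y), and by
Tonelli some x serves almost all y. *)
Lemma d_kernel_cst f : d_kernel f -> exists c : C, L2eq mu Om f (fun=> c).
Proof.
move=> [/= Lf _ [u [lu uf duf]]].
pose F z : C := f z.1 - f z.2.
have LF : L2 mE OmE F by apply: (L2B _ _ mOmE); [exact: L2_fst|exact: L2_snd].
have bound n : (L2normsq mE OmE F <=
    (4 * fine (mu Om) + 4 * fine (mu Om))%:E * L2normsq mu Om (fun x => u n x - f x)%R +
    (2 * (2 * rho 0 `^ alpha) ^+ 2)%:E * L2normsq mE OmE (fun z => dE (u n) z - 0)%R)%E.
  have [N su] := lconst_scale _ (lu n); have Lu := scale_L2 N _ su.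
  have Lg : L2 mu Om (fun x => u n x - f x) by apply: L2B => //; exact: mOm.
  have Lg' : L2 mu Om (fun x => -1 * (u n x - f x)) by apply: (L2Z mOm).
  have L1 := L2_fst _ Lg'; have L2' := L2_snd _ Lg.
  have L3 := L2D _ _ mOmE _ _ L1 L2'.
  have L4 := L2B _ _ mOmE _ _ (L2_fst _ Lu) (L2_snd _ Lu).
  rewrite (eq_nsq mE OmE F (fun z => (-1 * (u n z.1 - f z.1) + (u n z.2 - f z.2)) +
      (u n z.1 - u n z.2))); last by move=> z _; rewrite /F; ring.
  have [r3 i3 _] := L3; have [r4 i4 _] := L4.
  apply: (le_trans (nsqD_le _ _ mOmE _ _ r3 i3 r4 i4)).
  have muf : mu Om = (fine (mu Om))%:E.
    by rewrite fineK// ge0_fin_numE// Om_fin.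
  have [r1 i1 _] := L1; have [r2 i2 _] := L2'.
  rewrite ge0_muleDr; [|exact: nsq_ge0|exact: nsq_ge0].
  apply: leeD.
    apply: (le_trans (lee_wpmul2l _ (nsqD_le _ _ mOmE _ _ r1 i1 r2 i2))) => //.
    rewrite (nsq_fst (fun x => -1 * (u n x - f x)) Lg').
    rewrite (nsq_snd (fun x => u n x - f x) Lg) nsqZ//; [|exact: mOm|by case: Lg|by case: Lg].
    rewrite normsqN normsqR expr1n mul1e muf -(fine_nsqK mu Om _ Lg).
    rewrite -?EFinM -?EFinD -?EFinM lee_fin.
    rewrite le_eqVlt; apply/orP; left; apply/eqP; ring.
  rewrite (eq_nsq mE OmE (fun z => dE (u n) z - 0) (dE (u n))); last first.
    by move=> z _; rewrite subr0.
  by rewrite EFinM -muleA lee_wpmul2l// (dE_bound N).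
pose a := fine (mu Om); pose b := 2 * (2 * rho 0 `^ alpha) ^+ 2.
have age : 0 <= a by rewrite fine_ge0.
have bge : 0 <= b by rewrite mulr_ge0// sqr_ge0.
have F0 : L2normsq mE OmE F = 0%E.
  apply/eqP; rewrite eq_le nsq_ge0 andbT leNgt; apply/negP => Fp.
  have l0 : 0 < fine (L2normsq mE OmE F) by rewrite -lte_fin fine_nsqK.
  set l := fine _ in l0.
  (* The 1 makes the final inequality strict. *)
  pose c := 4 * a + 4 * a + b + 1.
  have c0 : 0 < c by rewrite ltr_wpDl// !addr_ge0// mulr_ge0.
  have e0 : 0 < l / c by rewrite divr_gt0.
  have [N1 h1] := L2cvg_small _ _ _ uf e0.
  have [N2 h2] := L2cvg_small _ _ _ duf e0.
  have := bound (maxn N1 N2); rewrite leNgt => /negP; apply.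
  have {}h1 := ltW (h1 _ (leq_maxl N1 N2)); have {}h2 := ltW (h2 _ (leq_maxr N1 N2)).
  apply: (@le_lt_trans _ _ ((4 * a + 4 * a)%:E * (l / c)%:E + b%:E * (l / c)%:E)%E).
    by apply: leeD; apply: lee_wpmul2l => //; rewrite lee_fin// addr_ge0// mulr_ge0.
  rewrite -!EFinM -EFinD -(fine_nsqK mE OmE _ LF) lte_fin -/l -mulrDl.
  rewrite mulrCA gtr_pMr// ltr_pdivrMr// mul1r /c ltrDl//.
have [x [Ox x0]] : exists x, Om x /\
    (\int[mu]_(y in Om) (normsq (f x - f y))%:E = 0)%E.
  apply: contrapT => no.
  have [rF iF _] := LF.
  have mF : measurable_fun (OmE : set (borel K * borel K)) (fun z => (normsq (F z))%:E).
    exact: (measurable_normsq _ _ rF iF).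
  have Fp z : (0 <= (normsq (F z))%:E)%E by rewrite lee_fin normsq_ge0.
  have mG := measurable_fubiniE _ mF Fp.
  have G0 : ae_eq mu Om (fun x => \int[mu]_(y in Om) (normsq (F (x, y)))%:E)%E (cst 0%E).
    apply/(ae_eq_integral_abs mu mOm mG); rewrite -F0 /L2normsq tonelliE//.
    apply: eq_integral => x _; rewrite gee0_abs//.
    by apply: integral_ge0 => y _; exact: Fp.
  have [B [mB B0_ subB]] := G0.
  have OB : Om `<=` B.
    move=> x Ox; apply: subB => /= /(_ Ox) e; apply: no; exists x; split => //.
  have := msB0_gt0; rewrite /ms setIidl//.
  have : (mu Om <= 0)%E by rewrite -B0_; apply: le_measure; rewrite ?inE//; exact: mOm.
  rewrite le_eqVlt => /orP[/eqP -> /=|]; first by rewrite ltxx.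
  by rewrite ltNge measure_ge0.
exists (f x).
have Lc : L2 mu Om (fun y => f y - f x).
  by apply: (L2B _ _ mOm) => //; apply: (scale_L2 0).
have /nsq0_L2eq : L2normsq mu Om (fun y => f y - f x) = 0%E.
  rewrite -x0; apply: eq_integral => y _.
  by rewrite -normsqN opprB.
move=> /(_ mOm Lc); apply: filterS => y + Oy => /(_ Oy) /eqP.
by rewrite subr_eq0 => /eqP.
Qed.

(** Two elements are almost everywhere constants, say v0 and v1, and v1 times the
first minus v0 times the second is null. *)
Lemma dimension_d_kernel : dimension mu Om d_kernel = 1%E.
Proof.
have cst_L2 (c : C) : L2 mu Om (fun=> c) by apply: (scale_L2 0).
have nonnull (c : C) : L2eq mu Om (fun=> c) (fun=> 0) -> c = 0.
  move=> c0; have := L2eq0_inner mu Om mOm _ _ (cst_L2 c) (cst_L2 1) c0.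
  rewrite /L2inner (eq_cintegral mu Om _ (fun x => cind setT x * c)); last first.
    by move=> x _; rewrite cindT// mul1r; rewrite -[RHS]mulr1; congr (_ * _); exact: conjc1.
  rewrite -/(pint _ _) pint_cst// => /eqP; rewrite mulf_eq0 fmorph_eq0.
  rewrite [ms _ == 0]gt_eqF ?orbF; first by move/eqP.
  apply: (lt_le_trans msB0_gt0); apply: le_ms => //; exact: measurable_B0.
apply/eqP; rewrite eq_le; apply/andP; split.
  apply: ge_ereal_sup => _ [n [b [bk bi]] <-]; rewrite lee_fin -[1]/(1%:R) ler_nat.
  rewrite leqNgt; apply/negP => n1.
  have [v vP] : {v : 'I_n -> C & forall i, L2eq mu Om (b i) (fun=> v i)}.
    by apply: (choice (fun i => d_kernel_cst (b i) (bk i))).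
  pose i0 : 'I_n := Ordinal (ltnW n1); pose i1 : 'I_n := Ordinal n1.
  have i01 : i0 != i1 by [].
  (* The relation v1 b0 - v0 b1 = 0; it gives v1 = 0, so that b1 itself is null. *)
  pose c (i : 'I_n) : C := if i == i0 then v i1 else if i == i1 then - v i0 else 0.
  have sumc (w : 'I_n -> C) : \sum_i c i * w i = v i1 * w i0 - v i0 * w i1.
    rewrite (bigD1 i0)//= (bigD1 i1)//= big1 ?addr0; last first.
      by move=> i /andP[/negbTE h0 /negbTE h1]; rewrite /c h0 h1 mul0r.
    by rewrite /c eqxx [i1 == i0]eq_sym (negbTE i01) eqxx mulNr.
  have c0 : forall i, c i = 0.
    apply: bi; have := vP i0; have := vP i1; apply: filterS2 => x h1 h0 Ox.
    by rewrite (sumc (fun i => b i x)) h0// h1// mulrC subrr.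
  have v1 : v i1 = 0 by have := c0 i0; rewrite /c eqxx.
  have := bi (fun i => (i == i1)%:R); move=> /(_ _ i1); rewrite eqxx.
  suff : L2eq mu Om (fun x => \sum_(i < n) (i == i1)%:R * b i x) (fun=> 0).
    by move=> h /(_ h)/eqP; rewrite oner_eq0.
  have := vP i1; apply: filterS => x h Ox.
  rewrite (bigD1 i1)//= big1 ?addr0; last by move=> i /negbTE ->; rewrite mul0r.
  by rewrite (h Ox) v1 mulr0.
apply: ereal_sup_ubound; exists 1%N => //.
exists (fun _ _ => 1); split; first by move=> _; exact: cst_d_kernel.
move=> c c0 i; rewrite (ord1 i); apply: nonnull.
by apply: filterS c0 => x h Ox; rewrite -(h Ox) big_ord1 mulr1.
Qed.

(** * Coordinates on the edge space *)

Section Edges.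
Context (n : nat) (U : 'I_n -> set K) (M : nat)
  (UOm : forall x, Om x <-> exists v, U v x)
  (Udisj : forall v w x, U v x -> U w x -> v = w)
  (Uscale : forall v x y, U v x -> B0 a0 k0 y -> dig M x = dig M y -> U v y)
  (U0 : forall v, U v !=set0)
  (dist : 'I_n -> 'I_n -> R)
  (Udist : forall v w x y, v != w -> U v x -> U w y -> pabs (x - y) = dist v w).

Definition mass (v : 'I_n) : R := ms (U v).
(** Any point of U v would do. *)
Definition base_pt (v : 'I_n) : K := xget a0 (U v).
Definition pair_wgt (v w : 'I_n) : R := dist v w `^ (- alpha).

Lemma base_ptP v : U v (base_pt v).
Proof. by have [x Ux] := U0 v; rewrite /base_pt; case: xgetP => [//|/(_ x)]. Qed.

Lemma U_Om v x : U v x -> Om x.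
Proof. by move=> Ux; apply/UOm; exists v. Qed.

Lemma mU v : measurable (U v : set (borel K)).
Proof.
apply: (mscale M) => [x /U_Om/Om_sub//|x y Bx By e Ux].
exact: (Uscale v x).
Qed.

Lemma mass_gt0 v : 0 < mass v.
Proof.
have Ux := base_ptP v; set x := base_pt v in Ux; have Ox := U_Om _ _ Ux.
have Bx := Om_sub _ Ox.
apply: (@lt_le_trans _ _ (ms (cell (maxn n0 M) (dig (maxn n0 M) x)))).
  by rewrite ms_cell_Om ?rho_gt0// leq_maxl.
apply: le_ms; [exact: mcell|exact: mU|move=> y [By e]].
apply: (Uscale v x) => //; apply/esym.
by apply: (dig_coarser p_prime _ _ M (maxn n0 M)) => //; exact: leq_maxr.
Qed.

Lemma mass_neq0 v : mass v != 0.
Proof. by rewrite gt_eqF// mass_gt0. Qed.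

Lemma base_pt_neq v w : v != w -> base_pt v - base_pt w != 0.
Proof.
move=> vw; rewrite subr_eq0; apply: contraNN vw => /eqP e; apply/eqP.
by apply: (Udisj _ _ (base_pt v)); [exact: base_ptP|rewrite e; exact: base_ptP].
Qed.

Lemma dist_gt0 v w : v != w -> 0 < dist v w.
Proof.
move=> vw; rewrite -(Udist v w (base_pt v) (base_pt w) vw (base_ptP v) (base_ptP w)).
by apply: pabs_neq0; exact: base_pt_neq.
Qed.

Lemma distC v w : v != w -> dist v w = dist w v.
Proof.
move=> vw; rewrite -(Udist v w (base_pt v) (base_pt w) vw (base_ptP v) (base_ptP w)).
rewrite -(Udist w v (base_pt w) (base_pt v) _ (base_ptP w) (base_ptP v)); last by rewrite eq_sym.
exact: pabsC.
Qed.

Lemma cindU v w x : U v x -> cind (U w) x = (v == w)%:R.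
Proof.
move=> Ux; have [<-|vw] := eqVneq v w; first by rewrite cindT.
by rewrite cindF// => Uw; move/eqP: vw; apply; exact: Udisj Ux Uw.
Qed.

Lemma U_scale v x y : Om x -> Om y -> dig M x = dig M y -> U v x -> U v y.
Proof. by move=> Ox Oy e Ux; apply: (Uscale v x) => //; exact: Om_sub. Qed.

(** Pairs of distinct vertices, oriented by the numbering; an
antisymmetric function that is constant on a loop vanishes there. *)
Definition pair_index := {x : 'I_n * 'I_n | (x.1 < x.2)%N}.
Definition nb_pairs : nat := #|{: pair_index}|.
Definition src (k : 'I_nb_pairs) : 'I_n := (val (enum_val k : pair_index)).1.
Definition tgt (k : 'I_nb_pairs) : 'I_n := (val (enum_val k : pair_index)).2.

Lemma src_lt_tgt k : (src k < tgt k)%N.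
Proof. exact: (valP (enum_val k : pair_index)). Qed.

Lemma src_neq_tgt k : src k != tgt k.
Proof. by apply: contraTneq (src_lt_tgt k) => ->; rewrite ltnn. Qed.

Lemma pair_inj k l : src k = src l -> tgt k = tgt l -> k = l.
Proof.
move=> e1 e2; apply: enum_val_inj; apply: val_inj.
by apply/eqP; rewrite -pair_eqE; apply/andP; split; apply/eqP.
Qed.

Lemma pair_ex (v w : 'I_n) : (v < w)%N -> exists k, src k = v /\ tgt k = w.
Proof.
move=> vw; exists (enum_rank (Sub (v, w) vw : pair_index)).
by rewrite /src /tgt enum_rankK.
Qed.

(** The square is the disjoint union of two triangles and the diagonal. *)
Lemma card_pairs : (2 * nb_pairs + n = n ^ 2)%N.
Proof.
have eN : nb_pairs = (\sum_(i < n) \sum_(j < n) (i < j))%N.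
  rewrite /nb_pairs card_sub -sum1_card big_mkcond pair_bigA /=.
  by apply: eq_bigr => -[i j] _; rewrite inE /=; case: (i < j)%N.
have eN' : nb_pairs = (\sum_(i < n) \sum_(j < n) (j < i))%N by rewrite eN exchange_big.
have en : n = (\sum_(i < n) \sum_(j < n) (i == j))%N.
  rewrite -{1}[n]card_ord -sum1_card; apply: eq_bigr => i _.
  by rewrite (bigD1 i)//= eqxx big1// => j; rewrite eq_sym => /negbTE ->.
transitivity (\sum_(i < n) \sum_(j < n) (i < j) + \sum_(i < n) \sum_(j < n) (j < i)
    + \sum_(i < n) \sum_(j < n) (i == j))%N.
  by rewrite -eN -eN' -en mul2n addnn.
rewrite -!big_split -mulnn.
transitivity (\sum_(i < n) n)%N; last by rewrite sum_nat_const card_ord.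
apply: eq_bigr => i _; rewrite -!big_split /=.
transitivity (\sum_(j < n) 1)%N; last by rewrite sum1_card card_ord.
apply: eq_bigr => j _; by rewrite -val_eqE /=; case: ltngtP.
Qed.

(** Normalises [eE]: both orientations of a pair have mass mass v times mass w. *)
Definition pair_norm (k : 'I_nb_pairs) : R := (Num.sqrt (2 * mass (src k) * mass (tgt k)))^-1.

Lemma pair_norm_gt0 k : 0 < pair_norm k.
Proof. by rewrite invr_gt0 sqrtr_gt0 !mulr_gt0 ?mass_gt0. Qed.

Lemma pair_norm_sq k : pair_norm k ^+ 2 * (2 * mass (src k) * mass (tgt k)) = 1.
Proof.
have h : 0 < 2 * mass (src k) * mass (tgt k) by rewrite !mulr_gt0 ?mass_gt0.
by rewrite /pair_norm exprVn sqr_sqrtr ?mulVf ?gt_eqF// ltW.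
Qed.

(** The orthonormal basis of the edge space. *)
Definition eE (k : 'I_nb_pairs) (z : K * K) : C := (pair_norm k)%:C *
  (cind (U (src k)) z.1 * cind (U (tgt k)) z.2
   - cind (U (tgt k)) z.1 * cind (U (src k)) z.2).

(** Synthesis of an edge function from its coordinates. *)
Definition synE (c : 'rV[C]_nb_pairs) (z : K * K) : C := \sum_k c 0 k * eE k z.

(** Synthesis of a function constant on each U v from coordinates in the
orthonormal basis of normalised indicators. *)
Definition synV (f : 'rV[C]_n) (x : K) : C :=
  \sum_v f 0 v * ((Num.sqrt (mass v))^-1%:C * cind (U v) x).

Lemma eE_val k v w x y : U v x -> U w y -> eE k (x, y) =
  (pair_norm k)%:C * (((v == src k) && (w == tgt k))%:R
    - ((v == tgt k) && (w == src k))%:R).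
Proof.
move=> Ux Uy; rewrite /eE /= !(cindU v _ x Ux) !(cindU w _ y Uy).
by rewrite -!natrM !mulnb.
Qed.

Lemma synE_diag c v x y : U v x -> U v y -> synE c (x, y) = 0.
Proof.
move=> Ux Uy; apply: big1 => k _; rewrite (eE_val k v v)//.
by rewrite andbC subrr !mulr0.
Qed.

Lemma synE_lt c k x y : U (src k) x -> U (tgt k) y ->
  synE c (x, y) = c 0 k * (pair_norm k)%:C.
Proof.
move=> Ux Uy; rewrite /synE (bigD1 k)//= big1 ?addr0 => [|l lk].
  rewrite (eE_val k (src k) (tgt k))// !eqxx (negbTE (src_neq_tgt k)) /=.
  by rewrite subr0 mulr1.
rewrite (eE_val l (src k) (tgt k))//.
have -> : (src k == src l) && (tgt k == tgt l) = false.
  by apply: contraNF lk => /andP[/eqP e1 /eqP e2]; apply/eqP/pair_inj.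
have -> : (src k == tgt l) && (tgt k == src l) = false.
  apply/negP => /andP[/eqP e1 /eqP e2].
  have := src_lt_tgt k; rewrite e1 e2 => h.
  by have := ltn_trans h (src_lt_tgt l); rewrite ltnn.
by rewrite subrr !mulr0.
Qed.

Lemma eE_anti k x y : eE k (x, y) = - eE k (y, x).
Proof. by rewrite /eE /=; ring. Qed.

Lemma synE_anti c x y : synE c (x, y) = - synE c (y, x).
Proof.
rewrite /synE -sumrN; apply: eq_bigr => k _.
by rewrite eE_anti mulrN.
Qed.

Definition edge_const (h : K * K -> C) :=
  forall v w x x' y y', U v x -> U v x' -> U w y -> U w y' -> h (x, y) = h (x', y').

Lemma edge_const_scale2 h : edge_const h -> scale2 M h.
Proof.
move=> hc x x' y y' Ox Ox' Oy Oy' ex ey.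
have [v Ux] := (UOm x).1 Ox; have [w Uy] := (UOm y).1 Oy.
by apply: (hc v w) => //; [exact: (U_scale v x)|exact: (U_scale w y)].
Qed.

Lemma synE_const c : edge_const (synE c).
Proof.
move=> v w x x' y y' Ux Ux' Uy Uy'; apply: eq_bigr => k _.
by rewrite (eE_val k v w x y)// (eE_val k v w x' y').
Qed.

Lemma L2_synE c : L2 mE OmE (synE c).
Proof. exact/(scale2_L2 M)/edge_const_scale2/synE_const. Qed.

Definition coefE (h : K * K -> C) : 'rV[C]_nb_pairs :=
  \row_k ((pair_norm k)^-1%:C * h (base_pt (src k), base_pt (tgt k))).

(** On U v `*` U v antisymmetry and constancy force the value 0; elsewhere one of
the two orientations is that of a basis vector. *)
Lemma synE_coef h : edge_const h ->
  (forall x y, OmE (x, y) -> h (x, y) = - h (y, x)) ->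
  forall z, OmE z -> h z = synE (coefE h) z.
Proof.
move=> hc ha.
have lt (v w : 'I_n) x y : (v < w)%N -> U v x -> U w y -> h (x, y) = synE (coefE h) (x, y).
  move=> vw Ux Uy; have [k [kv kw]] := pair_ex v w vw.
  rewrite (synE_lt _ k) ?kv ?kw// mxE kv kw.
  rewrite mulrAC -rmorphM mulVf ?gt_eqF ?pair_norm_gt0// mul1r.
  by apply: (hc v w) => //; exact: base_ptP.
move=> [x y] [/= Ox Oy].
have [v Ux] := (UOm x).1 Ox; have [w Uy] := (UOm y).1 Oy.
case: (ltngtP v w) => [vw|wv|/val_inj e].
- exact: (lt v w).
- rewrite ha// (lt w v)// [RHS]synE_anti//.
- rewrite -e in Uy; rewrite (synE_diag _ v)//.
  have h0 : h (x, y) = - h (x, y).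
    rewrite {1}ha//; congr (- _); exact: (hc v v).
  have : h (x, y) + h (x, y) = 0 by rewrite {2}h0 subrr.
  rewrite -mulr2n -mulr_natl => /eqP; rewrite mulf_eq0 => /orP[|/eqP//].
  by rewrite pnatr_eq0.
Qed.

Lemma cintegral_indE A B : measurable (A : set (borel K)) ->
  measurable (B : set (borel K)) ->
  cintegral mE OmE (fun z => cind A z.1 * cind B z.2) = (ms A * ms B)%:C.
Proof.
move=> mA mB; apply: complex_eqP => /=.
  have mAB : measurable (A `*` B : set (borel K * borel K)) by exact: measurableX.
  have -> : ms A * ms B = fine (mE ((A `*` B) `&` OmE)).
    rewrite -setXI setIC [B `&` _]setIC muEX; [|apply: measurableI => //; exact: mOm..].
    by rewrite fineM ?fin_num_muOm.
  rewrite /Rintegral; congr fine.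
  rewrite -(integral_indic mE mOmE mAB).
  apply: eq_integral => z _; rewrite !cind_real -rmorphM /= indicE -natrM mulnb.
  congr ((nat_of_bool _)%:R%:E); apply/andP/idP.
    by move=> [/asboolP ? /asboolP ?]; apply/mem_set.
  by move/set_mem => -[/= ? ?]; split; apply/asboolP.
rewrite /Rintegral integral0_eq// => z _.
by rewrite !cind_real -rmorphM /=.
Qed.

Lemma conj_eE k z : Num.conj (eE k z) = eE k z.
Proof.
rewrite /eE !cind_real -!rmorphM -rmorphB -rmorphM.
exact: conjc_real.
Qed.

Lemma eE_prod k l z : OmE z -> eE k z * (eE l z)^* = (k == l)%:R * ((pair_norm k ^+ 2)%:C *
  (cind (U (src k)) z.1 * cind (U (tgt k)) z.2
   + cind (U (tgt k)) z.1 * cind (U (src k)) z.2)).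
Proof.
rewrite conj_eE; case: z => x y [/= Ox Oy].
have [v Ux] := (UOm x).1 Ox; have [w Uy] := (UOm y).1 Oy.
rewrite !(cindU v _ x Ux) !(cindU w _ y Uy) -!natrM !mulnb.
rewrite (eE_val k v w)// (eE_val l v w)//.
have [<-|kl] := eqVneq k l; last first.
  have z1 : ((v == src k) && (w == tgt k)) && ((v == src l) && (w == tgt l)) = false.
    apply/negP => /andP[/andP[/eqP e1 /eqP e2] /andP[/eqP e3 /eqP e4]].
    by move/eqP: kl; apply; apply: pair_inj; congruence.
  have z2 : ((v == tgt k) && (w == src k)) && ((v == tgt l) && (w == src l)) = false.
    apply/negP => /andP[/andP[/eqP e1 /eqP e2] /andP[/eqP e3 /eqP e4]].
    by move/eqP: kl; apply; apply: pair_inj; congruence.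
  have z3 : ((v == src k) && (w == tgt k)) && ((v == tgt l) && (w == src l)) = false.
    apply/negP => /andP[/andP[/eqP e1 /eqP e2] /andP[/eqP e3 /eqP e4]].
    have := src_lt_tgt k; have := src_lt_tgt l.
    by rewrite -e1 -e2 e3 e4 => h1 h2; have := ltn_trans h1 h2; rewrite ltnn.
  have z4 : ((v == tgt k) && (w == src k)) && ((v == src l) && (w == tgt l)) = false.
    apply/negP => /andP[/andP[/eqP e1 /eqP e2] /andP[/eqP e3 /eqP e4]].
    have := src_lt_tgt k; have := src_lt_tgt l.
    by rewrite -e1 -e2 e3 e4 => h1 h2; have := ltn_trans h1 h2; rewrite ltnn.
  rewrite mul0r; move: z1 z2 z3 z4.
  move: ((v == src k) && _) ((v == tgt k) && _) ((v == src l) && _)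
    ((v == tgt l) && _) => [] [] [] [] //= _ _ _ _;
  by rewrite ?subrr ?mulr0 ?mul0r.
have z : ((v == src k) && (w == tgt k)) && ((v == tgt k) && (w == src k)) = false.
  apply/negP => /andP[/andP[/eqP e1 _] /andP[/eqP e3 _]].
  by move/eqP: (src_neq_tgt k); apply; rewrite -e1 -e3.
rewrite mul1r expr2 rmorphM /=; move: z.
move: ((v == src k) && _) ((v == tgt k) && _) => [] [] //= _;
  by rewrite ?subr0 ?sub0r ?addr0 ?add0r; ring.
Qed.

Lemma inner_eE k l : L2inner mE OmE (eE k) (eE l) = (k == l)%:R.
Proof.
rewrite /L2inner (eq_cintegral mE OmE _ _ (eE_prod k l)).
have i1 A B : measurable (A : set (borel K)) -> measurable (B : set (borel K)) ->
    cintegrable mE OmE (fun z => cind A z.1 * cind B z.2).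
  move=> mA mB; have LA := L2_fst _ (L2_cind A mA); have LB := L2_snd _ (L2_cind B mB).
  apply: (eq_cintegrable mOmE _ _ _ (L2_mul_conj mE OmE mOmE _ _ LA LB)).
  by move=> z _; congr (_ * _); exact: conj_cind.
have iU v w := i1 _ _ (mU v) (mU w).
have i2 := cintegrableD mOmE _ _ (iU (src k) (tgt k)) (iU (tgt k) (src k)).
rewrite (cintegralZ mE OmE mOmE); last exact: (cintegrableZ mOmE _ _ i2).
rewrite (cintegralZ mE OmE mOmE)// (cintegralD mE OmE mOmE)//.
rewrite !cintegral_indE; try exact: mU.
rewrite -rmorphD -rmorphM /=.
have -> : pair_norm k ^+ 2 * (ms (U (src k)) * ms (U (tgt k)) +
    ms (U (tgt k)) * ms (U (src k))) = 1 by rewrite -(pair_norm_sq k) /mass; ring.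
by rewrite mulr1.
Qed.

Lemma L2_eE k : L2 mE OmE (eE k).
Proof.
apply: (eq_L2 mE OmE (synE (delta_mx 0 k))); last exact: L2_synE.
move=> z _; rewrite /synE (bigD1 k)//= big1 ?addr0 => [|l lk].
  by rewrite mxE !eqxx mul1r.
by rewrite mxE (negbTE lk) andbF mul0r.
Qed.

Lemma inner_synE_eE c k : L2inner mE OmE (synE c) (eE k) = c 0 k.
Proof.
rewrite inner_lin; [|exact: mOmE|exact: L2_eE|exact: L2_eE].
rewrite (bigD1 k)//= inner_eE eqxx mulr1 big1 ?addr0// => l lk.
by rewrite inner_eE (negbTE lk) mulr0.
Qed.

Lemma inner_synE c c' : L2inner mE OmE (synE c) (synE c') = \sum_k c 0 k * (c' 0 k)^*.
Proof.
rewrite inner_lin; [|exact: mOmE|exact: L2_eE|exact: L2_synE].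
apply: eq_bigr => k _; congr (_ * _).
by rewrite (inner_conj mE OmE mOmE _ _ (L2_synE c') (L2_eE k)) inner_synE_eE.
Qed.

(** * The operators d and delta as matrices *)

Definition delta_edge (h : K * K -> C) (x : K) : C :=
  cintegral mu Om (fun y => h (x, y) * (pabs (x - y) `^ (- alpha))%:C).

(** The entries of delta from the basis [eE] to the normalised indicators. *)
Definition Dreal (k : 'I_nb_pairs) (v : 'I_n) : R :=
  pair_norm k * pair_wgt (src k) (tgt k) * Num.sqrt (mass v) *
  ((v == src k)%:R * mass (tgt k) - (v == tgt k)%:R * mass (src k)).
Definition Dmx : 'M[C]_(nb_pairs, n) := \matrix_(k, v) (Dreal k v)%:C.

Lemma sqrt_mass_gt0 v : 0 < Num.sqrt (mass v).
Proof. by rewrite sqrtr_gt0 mass_gt0. Qed.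
Lemma sqrt_mass_neq0 v : Num.sqrt (mass v) != 0.
Proof. by rewrite gt_eqF ?sqrt_mass_gt0. Qed.
Lemma sqrt_mass_sq v : Num.sqrt (mass v) * Num.sqrt (mass v) = mass v.
Proof. by rewrite -expr2 sqr_sqrtr// ltW ?mass_gt0. Qed.

Lemma synV_val f v x : U v x -> synV f x = f 0 v * (Num.sqrt (mass v))^-1%:C.
Proof.
move=> Ux; rewrite /synV (bigD1 v)//= big1 ?addr0 => [|w wv].
  by rewrite (cindU v v x)// eqxx mulr1.
by rewrite (cindU v w x)// eq_sym (negbTE wv) !mulr0.
Qed.

Lemma synV_scale f : scale M (synV f).
Proof.
move=> x y Ox Oy e; have [v Ux] := (UOm x).1 Ox.
by rewrite !(synV_val f v)//; exact: (U_scale v x).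
Qed.

Lemma eE_kernel k v x y : U v x -> Om y ->
  eE k (x, y) * (pabs (x - y) `^ (- alpha))%:C =
  (pair_norm k * pair_wgt (src k) (tgt k))%:C *
   ((v == src k)%:R * cind (U (tgt k)) y - (v == tgt k)%:R * cind (U (src k)) y).
Proof.
move=> Ux Oy; have [w Uy] := (UOm y).1 Oy.
rewrite (eE_val k v w)// !(cindU w _ y Uy) -!natrM !mulnb rmorphM /= -!mulrA.
congr (_ * _).
have kst := src_neq_tgt k.
have [/andP[/eqP e1 /eqP e2]|_] := boolP ((v == src k) && (w == tgt k)).
  rewrite -e1 -e2 in kst *; rewrite (Udist v w x y)//.
  exact: mulrC.
have [/andP[/eqP e1 /eqP e2]|_] := boolP ((v == tgt k) && (w == src k)).
  rewrite -e1 -e2 in kst *; rewrite (Udist v w x y) 1?eq_sym//.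
  by rewrite /pair_wgt (distC w v)//; exact: mulrC.
by rewrite subrr mulr0 mul0r.
Qed.

Lemma delta_edge_synE c x : Om x -> delta_edge (synE c) x = synV (c *m Dmx) x.
Proof.
move=> Ox; have [v Ux] := (UOm x).1 Ox.
have iU w : cintb (cind (U w)) by apply: L2_cintb; apply: L2_cind; exact: mU.
have iZ w (a : C) : cintb (fun y => a * cind (U w) y).
  by apply: cintegrableZ; [exact: mOm|exact: iU].
have pU w : cintegral mu Om (cind (U w)) = (mass w)%:C.
  rewrite /mass -pint1; last exact: mU.
  by apply: eq_cintegral => y _; rewrite mulr1.
rewrite (synV_val _ v)// mxE mulr_suml.
transitivity (cintegral mu Om (fun y => \sum_k c 0 k *
   ((pair_norm k * pair_wgt (src k) (tgt k))%:C *
   ((v == src k)%:R * cind (U (tgt k)) y - (v == tgt k)%:R * cind (U (src k)) y)))).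
  apply: eq_cintegral => y Oy; rewrite /synE mulr_suml; apply: eq_bigr => k _.
  by rewrite -mulrA (eE_kernel k v).
have iD k : cintb (fun y => (v == src k)%:R * cind (U (tgt k)) y -
    (v == tgt k)%:R * cind (U (src k)) y).
  by apply: cintegrableB; [exact: mOm|exact: iZ|exact: iZ].
have iD' k : cintb (fun y => (pair_norm k * pair_wgt (src k) (tgt k))%:C *
    ((v == src k)%:R * cind (U (tgt k)) y - (v == tgt k)%:R * cind (U (src k)) y)).
  by apply: cintegrableZ; [exact: mOm|exact: iD].
rewrite (cintegral_sum mu Om mOm); last first.
  by move=> k; apply: cintegrableZ; [exact: mOm|exact: iD'].
apply: eq_bigr => k _; rewrite !(cintegralZ mu Om mOm)//.
rewrite (cintegralB mu Om mOm)// !(cintegralZ mu Om mOm)// !pU mxE -mulrA.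
congr (_ * _); rewrite -[X in X * _ - _](rmorph_nat (real_complex R)).
rewrite -[X in _ - X * _](rmorph_nat (real_complex R)).
rewrite -!rmorphM -rmorphB -!rmorphM /=; congr (_%:C); rewrite /Dreal.
have := sqrt_mass_neq0 v; set t := Num.sqrt _; set B := (_ - _) => t0.
by rewrite [_ * t * B]mulrAC mulfK.
Qed.

Lemma dE_anti u x y : dE u (x, y) = - dE u (y, x).
Proof. by rewrite /dE /= pabsC -mulNr opprB. Qed.

Lemma mulmx_Dmx (f : 'rV[C]_n) k : (f *m Dmx^T) 0 k =
  (pair_norm k * pair_wgt (src k) (tgt k))%:C *
   (f 0 (src k) * (Num.sqrt (mass (src k)) * mass (tgt k))%:C
    - f 0 (tgt k) * (Num.sqrt (mass (tgt k)) * mass (src k))%:C).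
Proof.
have kst := src_neq_tgt k.
rewrite mxE (bigD1 (src k))//= (bigD1 (tgt k)) 1?eq_sym//= big1 ?addr0.
  rewrite !mxE /Dreal !eqxx (negbTE kst) [tgt k == src k]eq_sym (negbTE kst).
  rewrite mul0r mul1r subr0 mul0r mul1r sub0r.
  rewrite mulrBr mulrN rmorphN mulrN; congr (_ - _); rewrite mulrCA -rmorphM;
  by congr (_ * _%:C); rewrite mulrA.
move=> v /andP[/negbTE vs /negbTE vt].
by rewrite !mxE /Dreal vs vt !mul0r subrr mulr0 mulr0.
Qed.

Lemma pair_norm_sqrt k : pair_norm k ^+ 2 * (Num.sqrt (mass (src k)) * mass (tgt k))
    = (Num.sqrt (mass (src k)))^-1 / 2 /\
  pair_norm k ^+ 2 * (Num.sqrt (mass (tgt k)) * mass (src k)) = (Num.sqrt (mass (tgt k)))^-1 / 2.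
Proof.
have h := pair_norm_sq k.
have := sqrt_mass_neq0 (src k); have := sqrt_mass_neq0 (tgt k).
have := sqrt_mass_sq (src k); have := sqrt_mass_sq (tgt k).
move: (Num.sqrt _) (Num.sqrt _) => b a eb ea bn an.
move: h; rewrite -eb -ea; move: (pair_norm k) => c h.
set X := 2 * _ * _ in h; have X0 : X != 0.
  by apply/eqP => e; move: h; rewrite e mulr0 => /esym/eqP; rewrite oner_eq0.
have c2 : c ^+ 2 = X^-1 by apply: (mulIf X0); rewrite mulVf.
by split; rewrite c2 /X; field; rewrite an bn.
Qed.

(** That d is given by the transpose of the matrix of delta says that the two are
adjoint: the factor 1/2 in d compensates for integrating over both orientations
of a pair. *)
Lemma dE_synV f z : OmE z -> dE (synV f) z = synE (f *m Dmx^T) z.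
Proof.
have lt (v w : 'I_n) x y : (v < w)%N -> U v x -> U w y ->
    dE (synV f) (x, y) = synE (f *m Dmx^T) (x, y).
  move=> vw Ux Uy; have [k [kv kw]] := pair_ex v w vw.
  have vw' : v != w by rewrite -val_eqE /= neq_ltn vw.
  rewrite (synE_lt _ k) ?kv ?kw// mulmx_Dmx kv kw /dE /=.
  rewrite (Udist v w x y)// (synV_val f v x)// (synV_val f w y)//.
  rewrite -fmorphV invfM -powRN -/(pair_wgt v w).
  have [] := pair_norm_sqrt k; rewrite kv kw => h1 h2.
  transitivity ((pair_wgt v w)%:C * (f 0 v * ((Num.sqrt (mass v))^-1 / 2)%:C -
      f 0 w * ((Num.sqrt (mass w))^-1 / 2)%:C)).
    by rewrite !rmorphM /=; ring.
  by rewrite -h1 -h2 !rmorphM /=; ring.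
move=> Oz; case: z Oz => x y [/= Ox Oy].
have [v Ux] := (UOm x).1 Ox; have [w Uy] := (UOm y).1 Oy.
case: (ltngtP v w) => [vw|wv|/val_inj e].
- exact: (lt v w).
- by rewrite dE_anti synE_anti (lt w v).
- rewrite -e in Uy; rewrite (synE_diag _ v)// /dE /=.
  by rewrite (synV_val f v x)// (synV_val f v y)// subrr mul0r.
Qed.

Lemma eq_delta_edge h h' x : (forall z, OmE z -> h z = h' z) -> Om x -> delta_edge h x = delta_edge h' x.
Proof. by move=> hh Ox; apply: eq_cintegral => y Oy; rewrite hh. Qed.

Lemma dE_eq u u' z : (forall x, Om x -> u x = u' x) -> OmE z -> dE u z = dE u' z.
Proof. by move=> uu [Ox Oy]; rewrite /dE !uu. Qed.

Lemma dE_delta_edge h z : (forall z, OmE z -> h z = synE (coefE h) z) -> OmE z ->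
  dE (delta_edge h) z = synE (coefE h *m (Dmx *m Dmx^T)) z.
Proof.
move=> hh Oz; rewrite mulmxA -dE_synV//; apply: dE_eq => // x Ox.
by rewrite -delta_edge_synE//; apply: eq_delta_edge.
Qed.

(** * Kernel and heat trace on the edge space *)

Definition sigmaE : set (K * K -> C) :=
  [set h | L2 mE OmE h /\ L2eq mE OmE h (fun z => - h (z.2, z.1))].
Definition edge_space : set (K * K -> C) :=
  [set h | [/\ sigmaE h, forall x y, OmE (x, y) -> h (x, y) = - h (y, x)
    & edge_const h]].
Definition edge_Laplacian : set ((K * K -> C) * (K * K -> C)) :=
  [set hk | [/\ edge_space hk.1, edge_space hk.2 & L2eq mE OmE hk.2 (dE (delta_edge hk.1))]].
Definition ker_delta_edge : set (K * K -> C) :=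
  [set h | edge_space h /\ L2eq mu Om (delta_edge h) (fun=> 0)].

Lemma edge_space_synE c : edge_space (synE c).
Proof.
split; last exact: synE_const.
  split; first exact: L2_synE.
  by apply: filterE => -[x y] _; exact: synE_anti.
by move=> x y _; exact: synE_anti.
Qed.

Lemma edge_space_coef h : edge_space h -> forall z, OmE z -> h z = synE (coefE h) z.
Proof. by move=> [_ ha hc]; exact: synE_coef. Qed.

Lemma synEZ (a : C) c : synE (a *: c) = (fun z => a * synE c z).
Proof.
apply/funext => z; rewrite /synE mulr_sumr; apply: eq_bigr => k _.
by rewrite mxE mulrA.
Qed.

Lemma synEB c c' z : synE (c - c') z = synE c z - synE c' z.
Proof.
by rewrite /synE -sumrB; apply: eq_bigr => k _; rewrite !mxE mulrBl.
Qed.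

Lemma synE_sum (J : finType) (a : J -> C) (c : J -> 'rV[C]_nb_pairs) z :
  \sum_j a j * synE (c j) z = synE (\sum_j a j *: c j) z.
Proof.
rewrite /synE; under eq_bigr do rewrite mulr_sumr.
rewrite exchange_big; apply: eq_bigr => k _; rewrite summxE mulr_suml.
by apply: eq_bigr => j _; rewrite mxE mulrA.
Qed.

Lemma synE_ae0 c : L2eq mE OmE (synE c) (fun=> 0) -> c = 0.
Proof.
move=> c0; apply/rowP => k; rewrite mxE -inner_synE_eE.
by apply: L2eq0_inner => //; [exact: mOmE|exact: L2_synE|exact: L2_eE].
Qed.

Lemma synE_ae_eq c c' : L2eq mE OmE (synE c) (synE c') -> c = c'.
Proof.
move=> e; apply/eqP; rewrite -subr_eq0; apply/eqP/synE_ae0.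
by apply: filterS e => z e Oz; rewrite synEB e// subrr.
Qed.

Lemma synV_ae0 f : L2eq mu Om (synV f) (fun=> 0) -> f = 0.
Proof.
move=> f0; apply/rowP => v; rewrite mxE.
have iu := scale_cintb M _ (synV_scale f).
have : pint (U v) (synV f) = 0.
  rewrite /pint -(cintegral0 mu Om mOm); apply: ae_eq_cintegral.
  - exact: mOm.
  - by apply: cintb_cind => //; exact: mU.
  - exact: cintegrable0.
  - by apply: filterS f0 => x e Ox; rewrite e// mulr0.
rewrite (eq_pint _ _ (fun=> f 0 v * (Num.sqrt (mass v))^-1%:C)); last first.
  by move=> x _ Ux; exact: synV_val.
rewrite pint_cst; last exact: mU.
move/eqP; rewrite mulf_eq0 fmorph_eq0 (negbTE (mass_neq0 v)) orbF.
by rewrite mulf_eq0 fmorph_eq0 invr_eq0 (negbTE (sqrt_mass_neq0 v)) orbF => /eqP.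
Qed.

Lemma n_gt0 : (0 < n)%N.
Proof. by have [x /UOm[v _]] := Om0; case: v => i h; exact: leq_ltn_trans h. Qed.

Lemma pair_wgt_gt0 v w : v != w -> 0 < pair_wgt v w.
Proof. by move=> vw; rewrite powR_gt0// dist_gt0. Qed.

(** All pairs being edges, a function killed by d takes the same value on any two
vertices. *)
Lemma ker_DmxT (f : 'rV[C]_n) : f *m Dmx^T = 0 ->
  forall v w, f 0 v * (Num.sqrt (mass v))^-1%:C = f 0 w * (Num.sqrt (mass w))^-1%:C.
Proof.
move=> f0.
have lt (v w : 'I_n) : (v < w)%N ->
    f 0 v * (Num.sqrt (mass v))^-1%:C = f 0 w * (Num.sqrt (mass w))^-1%:C.
  move=> vw; have [k [kv kw]] := pair_ex v w vw.
  have vw' : v != w by rewrite -val_eqE /= neq_ltn vw.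
  have := mulmx_Dmx f k; rewrite f0 mxE kv kw => /esym/eqP.
  rewrite mulf_eq0 fmorph_eq0 gt_eqF /=; last by rewrite mulr_gt0 ?pair_norm_gt0 ?pair_wgt_gt0.
  rewrite subr_eq0 => /eqP h.
  have mm : (mass v * mass w)%:C != 0 :> C by rewrite fmorph_eq0 mulf_neq0 ?mass_neq0.
  apply: (mulIf mm).
  have e (a b : R) : 0 < Num.sqrt a -> a = Num.sqrt a * Num.sqrt a ->
      (Num.sqrt a)^-1 * (a * b) = Num.sqrt a * b.
    by move=> ap e; rewrite {2}e -!mulrA mulKf// gt_eqF.
  rewrite -!mulrA -!rmorphM /= (e _ (mass w) (sqrt_mass_gt0 v) (esym (sqrt_mass_sq v))).
  by rewrite [mass v * mass w]mulrC (e _ (mass v) (sqrt_mass_gt0 w) (esym (sqrt_mass_sq w))).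
move=> v w; case: (ltngtP v w) => [vw|wv|/val_inj ->//].
- exact: lt.
- by rewrite (lt w v).
Qed.

(** The kernel of the transpose is the line spanned by the coordinates of the
constant function 1. *)
Lemma rank_Dmx : \rank Dmx = n.-1.
Proof.
pose sq : 'rV[C]_n := \row_v (Num.sqrt (mass v))%:C.
pose i0 : 'I_n := Ordinal n_gt0.
have sq0 : sq *m Dmx^T = 0.
  apply/rowP => k; rewrite mulmx_Dmx !mxE -!rmorphM !mulrA !sqrt_mass_sq.
  by rewrite [mass (tgt k) * _]mulrC subrr mulr0.
have kersq : \rank (kermx Dmx^T) = 1%N.
  transitivity (\rank sq).
    apply/eqP; rewrite eqn_leq; apply/andP; split; apply: mxrankS; last first.
      exact/sub_kermxP.
    apply/row_subP => i; set f := row i _.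
    have f0 : f *m Dmx^T = 0 by rewrite /f -row_mul mulmx_ker row0.
    have -> : f = (f 0 i0 * (Num.sqrt (mass i0))^-1%:C) *: sq.
      apply/rowP => v; rewrite [RHS]mxE [sq 0 v]mxE (ker_DmxT f f0 i0 v).
      by rewrite -mulrA -rmorphM mulVf ?sqrt_mass_neq0// mulr1.
    exact: scalemx_sub.
  rewrite rank_rV (_ : sq != 0)//; apply/eqP => /rowP/(_ i0)/eqP.
  by rewrite !mxE fmorph_eq0 (negbTE (sqrt_mass_neq0 i0)).
have := mxrank_ker Dmx^T; rewrite kersq mxrank_tr => e.
have h := rank_leq_col Dmx.
by rewrite -subn1 e subKn.
Qed.

Lemma DmxJ : map_mx Num.conj Dmx^T = Dmx^T.
Proof. by apply/matrixP => i j; rewrite !mxE; exact: conjc_real. Qed.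

Lemma ker_delta_edge_coef h : ker_delta_edge h <-> edge_space h /\ coefE h *m Dmx = 0.
Proof.
split=> -[rh h0]; split => //.
  apply: synV_ae0; apply: filterS h0 => x e Ox.
  rewrite -delta_edge_synE// -e//; apply: eq_delta_edge => // z Oz.
  by rewrite -edge_space_coef.
apply: filterE => x Ox; rewrite (eq_delta_edge _ (synE (coefE h)))//; last exact: edge_space_coef.
rewrite delta_edge_synE// h0 /synV big1// => v _; by rewrite mxE mul0r.
Qed.

Lemma coef_synE c : coefE (synE c) = c.
Proof.
apply/rowP => k; rewrite mxE (synE_lt _ k); [|exact: base_ptP..].
by rewrite mulrCA -rmorphM mulVf ?mulr1// gt_eqF ?pair_norm_gt0.
Qed.

(** Independent families correspond to matrices of full row rank whose rows lie in
the left kernel of the matrix of delta. *)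
Lemma dimension_ker_delta_edge : dimension mE OmE ker_delta_edge = ((nb_pairs - n.-1)%N%:R : R)%:E.
Proof.
have <- : \rank (kermx Dmx) = (nb_pairs - n.-1)%N by rewrite mxrank_ker rank_Dmx.
apply/eqP; rewrite eq_le; apply/andP; split.
  apply: ge_ereal_sup => _ [d [b [bk bi]] <-]; rewrite lee_fin ler_nat.
  pose H : 'M[C]_(d, nb_pairs) := \matrix_(i, k) coefE (b i) 0 k.
  have rH i : row i H = coefE (b i) by apply/rowP => k; rewrite !mxE.
  have HK : (H <= kermx Dmx)%MS.
    apply/row_subP => i; rewrite rH; apply/sub_kermxP.
    by have /ker_delta_edge_coef[] := bk i.
  have : row_free H.
    apply: inj_row_free => v v0; apply/rowP => i; rewrite mxE.
    apply: (bi (fun i => v 0 i)); apply: filterE => z Oz.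
    rewrite (eq_bigr (fun j => v 0 j * synE (coefE (b j)) z)); last first.
      by move=> j _; rewrite -edge_space_coef//; have [] := bk j.
    rewrite synE_sum; have -> : \sum_(j < d) v 0 j *: coefE (b j) = 0.
      by rewrite -[RHS]v0 mulmx_sum_row; apply: eq_bigr => j _; rewrite rH.
    by have -> : synE 0 z = 0 by rewrite /synE big1// => k _; rewrite mxE mul0r.
  by rewrite /row_free => /eqP <-; exact: mxrankS.
apply: ereal_sup_ubound; exists (\rank (kermx Dmx)) => //.
exists (fun i => synE (row i (row_base (kermx Dmx)))); split.
  move=> i; apply/ker_delta_edge_coef; split; first exact: edge_space_synE.
  rewrite coef_synE; apply/sub_kermxP.
  by apply: (submx_trans (row_sub _ _)); rewrite eq_row_base.
move=> c c0 i.
have : (\row_i c i) *m row_base (kermx Dmx) = 0.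
  apply: synE_ae0; apply: filterS c0 => z e Oz; rewrite -(e Oz) synE_sum.
  congr synE; rewrite mulmx_sum_row; apply: eq_bigr => j _; by rewrite mxE.
have /row_free_inj inj := row_base_free (kermx Dmx).
by rewrite -(mul0mx _ (row_base (kermx Dmx))) => /inj/rowP/(_ i); rewrite !mxE.
Qed.

(** With Q the inverse of P, the coefficients of a row c in the eigenbasis are c Q,
and those of c A are then c Q S. *)
Lemma conj_intertwine k (A P Q S : 'M[R[i]]_k) : Q *m P = 1%:M ->
  P *m Q = 1%:M -> P *m A = S *m P -> A *m Q = Q *m S.
Proof.
move=> QP PQ PA.
by rewrite -[LHS]mul1mx -QP -mulmxA (mulmxA P A) PA -mulmxA PQ mulmx1.
Qed.

(** In coordinates Delta_rho is right multiplication by the Gram matrix of the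
matrix of delta, which is real, so [gram_spectral] applies to it. *)
Lemma edge_trace : exists lambda : 'I_nb_pairs -> R,
  [/\ forall i, 0 <= lambda i, #|[pred i | lambda i == 0]| = (nb_pairs - n.-1)%N &
   forall t, heat_trace mE OmE edge_space edge_Laplacian t
     = (\sum_i expR (- (lambda i * t)))%:E].
Proof.
have [P [sp [PP PA sp0 spz]]] := gram_spectral nb_pairs n Dmx.
rewrite DmxJ in PA.
pose A := Dmx *m Dmx^T; rewrite -/A in PA.
pose lambda i := complex.Re (sp 0 i).
have spE i : sp 0 i = (lambda i)%:C.
  by rewrite /lambda RRe_real// ger0_real.
have l0 i : 0 <= lambda i by have := sp0 i; rewrite spE ler0c.
have rowPA i : row i P *m A = (lambda i)%:C *: row i P.
  rewrite -row_mul PA row_mul row_diag_mx -scalemxAl -rowE spE.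
  by [].
have PP' : map_mx Num.conj P^T *m P = 1%:M by apply: mulmx1C.
have AP : A *m map_mx Num.conj P^T = map_mx Num.conj P^T *m diag_mx sp.
  exact: conj_intertwine PP' PP PA.
have inn c i : L2inner mE OmE (synE c) (synE (row i P)) =
    (c *m map_mx Num.conj P^T) 0 i.
  by rewrite inner_synE mxE; apply: eq_bigr => k _; rewrite !mxE.
have innf h i : edge_space h -> L2inner mE OmE h (synE (row i P)) =
    (coefE h *m map_mx Num.conj P^T) 0 i.
  by move=> rh; rewrite -inn; apply: eq_inner => // z Oz; rewrite -edge_space_coef.
exists lambda; split => //.
  rewrite -rank_Dmx -spz; apply: eq_card => i; rewrite !inE spE.
  by rewrite fmorph_eq0.
move=> t.
have eb : eigenbasis mE OmE edge_space edge_Laplacian (fun i => synE (row i P)) lambda.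
  split.
  - by move=> i; exact: edge_space_synE.
  - move=> i; split => /=; [exact: edge_space_synE|by rewrite -synEZ; exact: edge_space_synE|].
    apply: filterE => z Oz; rewrite dE_delta_edge//; last first.
      by move=> z' Oz'; rewrite -edge_space_coef//; exact: edge_space_synE.
    by rewrite coef_synE rowPA synEZ.
  - move=> i j; rewrite inn -row_mul PP mxE.
    by rewrite mxE.
  - move=> h rh h0; have c0 : coefE h *m map_mx Num.conj P^T = 0.
      by apply/rowP => i; rewrite -innf// h0 mxE.
    have e : coefE h = 0 by rewrite -[coefE h]mulmx1 -PP' mulmxA c0 mul0mx.
    apply: filterE => z Oz; rewrite edge_space_coef// e /synE big1// => k _.
    by rewrite mxE mul0r.
rewrite (heat_traceE mE OmE mOmE edge_space edge_Laplacian _ _ _ _ lambda t eb).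
- by rewrite esum_ord// => i; exact: expR_ge0.
- by move=> h [[]].
- move=> f g c [[Lf af] fa fc] [[Lg ag] ga gc].
  have La : L2 mE OmE (fun z => f z - c * g z).
    by apply: L2B => //; [exact: mOmE|exact: (L2Z mOmE)].
  split; [split => //| |].
  + by apply: filterS2 af ag => -[x y] e1 e2 Oz /=; rewrite e1// e2//=; ring.
  + by move=> x y Oz; rewrite fa// ga//; ring.
  + move=> v w x x' y y' Ux Ux' Uy Uy'.
    by rewrite (fc v w x x' y y')// (gc v w x x' y y').
- by move=> c; exists (enum 'I_nb_pairs) => i _; rewrite mem_enum.
- move=> f k i rf [_ /= rkf kf]; rewrite innf// => h.
  have e : k%:C *: coefE f = coefE f *m A.
    apply: synE_ae_eq; apply: filterS kf => z e Oz.
    rewrite synEZ -edge_space_coef// (e Oz) dE_delta_edge//.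
    by move=> z' Oz'; exact: edge_space_coef.
  have : (coefE f *m A *m map_mx Num.conj P^T) 0 i =
      k%:C * (coefE f *m map_mx Num.conj P^T) 0 i.
    by rewrite -e -scalemxAl mxE.
  rewrite -mulmxA AP mulmxA mul_mx_diag mxE mulrC spE.
  by move/(mulIf h)/complexI.
Qed.

Lemma edge_trace_cvg :
  heat_trace mE OmE edge_space edge_Laplacian t @[t --> +oo] --> (((nb_pairs - n.-1)%N%:R : R)%:E : \bar R).
Proof.
have [lambda [l0 lz tr]] := edge_trace.
rewrite (_ : (fun t => _) = (fun t => (\sum_i expR (- (lambda i * t)))%:E)); last first.
  by apply/funext => t; exact: tr.
apply: cvg_EFin; first exact: nearW.
rewrite -lz -sum1_card natr_sum big_mkcond /=.
apply: cvg_big => [|i _]; first exact: add_continuous.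
rewrite inE; case: eqP => [->|/eqP li].
  under eq_fun do rewrite mul0r oppr0 expR0.
  exact: cvg_cst.
have lp : 0 < lambda i by rewrite lt_neqAle eq_sym li l0.
have h : lambda i * t @[t --> +oo] --> +oo by apply: gt0_cvgMry => //; exact: cvg_id.
exact: (cvg_comp _ _ h (@cvgr_expR R)).
Qed.

End Edges.
End Kernel.
End Clopen.

(** * The tree of a good fundamental domain *)

Section Balls.
Context {R : realType} {p : nat} (p_prime : prime p) {K : padic_field R p}.
Local Notation q := (p%:R : R).
Implicit Types (c x y : K) (l : int).

Lemma ball_self c l : padic_ball c l c.
Proof. by rewrite /padic_ball /= subrr pabs0 ltW// qX_gt0. Qed.

Lemma ball_center {c x l} : padic_ball c l x -> padic_ball c l = padic_ball x l.
Proof.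
move=> xc; apply/seteqP; split => y yl.
  by apply: (pabs_dist_le c) => //; rewrite pabsC.
exact: (pabs_dist_le x).
Qed.

Lemma ball_sub c l l' : l <= l' -> padic_ball c l `<=` padic_ball c l'.
Proof. by move=> ll y yl; apply: le_trans yl _; rewrite le_qX. Qed.

(** The radius is determined by the set: c + pi_pow (- l) is at distance exactly
p ^ l from c. *)
Lemma ball_edge c l l' : padic_ball c l' (c + pi_pow (- l)) -> l <= l'.
Proof.
by rewrite /padic_ball /= addrC addKr pabs_pi_pow// opprK le_qX.
Qed.

Lemma ball_edge_in c l : padic_ball c l (c + pi_pow (- l)).
Proof. by rewrite /padic_ball /= addrC addKr pabs_pi_pow// opprK. Qed.

End Balls.

Section Tree.
Context {R : realType} {p : nat} (p_prime : prime p) {K : padic_field R p}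
  {X : mumford_curve K} (F : good_fundamental_domain X)
  (h0 : bool * 'I_(genus X)) (a : K) (k : int) (h0E : hole F h0 = CoDisc a k).
Local Notation q := (p%:R : R).
Local Notation tree := (tree_vertices F).

(** Centre and radius exponent of an inner hole. *)
Definition ctr h : K := if hole F h is Disc b _ then b else 0.
Definition rad h : int := if hole F h is Disc _ j then j else 0.

Lemma hole_infty_unique h : open_disc (hole F h) None -> h = h0.
Proof.
move=> hN; apply: contrapT => /(hole_disjoint F) hh.
have : (closed_disc (hole F h) `&` closed_disc (hole F h0)) None.
  by split; [case: (hole F h) hN|rewrite h0E].
by rewrite hh.
Qed.

Lemma innerE h : h <> h0 -> hole F h = Disc (ctr h) (rad h).
Proof.
rewrite /ctr /rad; case E: (hole F h) => [//|b j] hh.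
by case: hh; apply: hole_infty_unique; rewrite E.
Qed.

(** The closed disc of an inner hole avoids the closed disc at infinity: test this
on the centre and on a point at distance exactly p ^ rad h from the centre. *)
Lemma inner_bounds h : h <> h0 -> pabs (ctr h - a) < q ^ k /\ rad h < k.
Proof.
move=> hh; have dj := hole_disjoint F hh; rewrite (innerE _ hh) h0E in dj.
have out x : padic_ball (ctr h) (rad h) x -> pabs (x - a) < q ^ k.
  move=> xb; rewrite ltNge; apply/negP => ax.
  suff : (set0 : set (option K)) (Some x) by [].
  by rewrite -dj.
have c_in := out _ (ball_self p_prime _ _); split=> //.
rewrite ltNge; apply/negP => kj.
have := out _ (ball_edge_in p_prime (ctr h) (rad h)); rewrite addrAC.
have e : pabs (pi_pow (- rad h) : K) = q ^ rad h by rewrite pabs_pi_pow// opprK.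
rewrite pabs_isosceles e; first by rewrite lt_qX// ltNge kj.
by apply: lt_le_trans c_in _; rewrite le_qX.
Qed.

(** The tree is a union of finite ascending chains, from each inner hole up to the
complement of the hole at infinity. *)
Lemma vertexP v : tree v <->
  exists h l, [/\ h <> h0, rad h <= l <= k & v = padic_ball (ctr h) l].
Proof.
split=> [[[c [l vE]] [h [hN hv]] avoid]|[h [l [hh /andP[jl lk] vE]]]].
  have hh : h <> h0 by move=> e; apply: hN; rewrite e h0E.
  have [ca jk] := inner_bounds _ hh; rewrite (innerE _ hh) /= in hv.
  exists h, l; have vc := hv _ (ball_self p_prime _ _).
  have vE' : v = padic_ball (ctr h) l by move: vc; rewrite vE => /ball_center.
  split=> //; apply/andP; split.
    apply: (@ball_edge _ _ p_prime K (ctr h)); rewrite -vE'; apply: hv.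
    exact: ball_edge_in.
  rewrite leNgt; apply/negP => kl.
  apply: (avoid h0 _ (ctr h + pi_pow (- l))); rewrite ?h0E//=.
    by rewrite vE'; exact: ball_edge_in.
  have e : pabs (pi_pow (- l) : K) = q ^ l by rewrite pabs_pi_pow// opprK.
  rewrite addrAC pabs_isosceles e; first by rewrite lt_qX.
  by apply: lt_trans ca _; rewrite lt_qX.
have [ca jk] := inner_bounds _ hh; split; first by exists (ctr h), l.
  exists h; rewrite (innerE _ hh); split => // x /= xh.
  by rewrite vE; exact: (ball_sub p_prime _ _ _ jl).
move=> h' /hole_infty_unique -> x; rewrite h0E vE /= => xl.
apply/negP; rewrite -leNgt; apply: (pabs_dist_le (ctr h)); last exact: ltW.
by apply: le_trans xl _; rewrite le_qX.
Qed.

Lemma vertex_sub v : tree v -> v `<=` B0 a k.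
Proof.
move=> [_ _ avoid] x vx; rewrite /B0 /padic_ball /= leNgt; apply/negP => ax.
by apply: (avoid h0 _ x vx); rewrite h0E.
Qed.

(** One digit more than the differences of exponents, since an inner hole is the
open disc of radius p ^ rad h. *)
Definition depth : nat := (\max_h `|k - rad h|%N).+1.

Lemma depth_rad h : h <> h0 -> k - depth%:Z < rad h.
Proof.
move=> hh; have [_ jk] := inner_bounds _ hh.
have := leq_bigmax (F := fun h => `|k - rad h|%N) h; rewrite -ltnS -/depth.
by lia.
Qed.

Lemma tree_finite : finite_set tree.
Proof.
pose f (x : (bool * 'I_(genus X)) * 'I_depth) : set K :=
  padic_ball (ctr x.1) (k - (x.2 : nat)%:Z).
apply: (@sub_finite_set _ _ (f @` setT)); last exact/finite_image/finite_finset.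
move=> v /vertexP[h [l [hh jlk ->]]].
have d := depth_rad _ hh.
have ld : (`|k - l| < depth)%N by lia.
exists (h, Ordinal ld) => //; rewrite /f /=; congr (padic_ball _ _).
by lia.
Qed.

Lemma tree_nonempty : exists v, tree v.
Proof.
pose h1 := (~~ h0.1, h0.2).
have hh : h1 <> h0 by rewrite /h1; case: (h0) => -[] i.
exists (padic_ball (ctr h1) k); apply/vertexP; exists h1, k; split=> //.
by rewrite lexx andbT ltW//; exact: (inner_bounds _ hh).2.
Qed.

Lemma OmegaV_sub : OmegaV F `<=` B0 a k.
Proof. by move=> x [v tv [vx _ _]]; exact: (vertex_sub v). Qed.

Section Stable.
Context (x y : K) (Bx : B0 a k x) (By : B0 a k y)
  (exy : dig a k depth x = dig a k depth y).

Let xy_small h : h <> h0 -> pabs (y - x) < q ^ rad h.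
Proof.
move=> hh; have := (dig_eq p_prime a k depth y x By Bx).1 (esym exy).
by move/le_lt_trans; apply; rewrite lt_qX// depth_rad.
Qed.

Lemma vertex_stable v : tree v -> v x -> v y.
Proof.
move=> /vertexP[h [l [hh /andP[jl _] ->]]]; apply: pabs_dist_le.
by apply: le_trans (ltW (xy_small _ hh)) _; rewrite le_qX.
Qed.

Lemma hole_stable h : open_disc (hole F h) (Some x) -> open_disc (hole F h) (Some y).
Proof.
have [->|hh] := pselect (h = h0).
  by rewrite h0E /= ltNge; move: Bx; rewrite /B0 /padic_ball /= => ->.
by rewrite innerE//= => xh; apply: (pabs_dist_lt x) => //; exact: xy_small.
Qed.

End Stable.

(** Moving a point within a cell of level [depth] leaves no vertex and enters or
leaves no hole, and U_v is a Boolean combination of these. *)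
Lemma holed_stable v x y : tree v -> holed_disc F v x -> B0 a k y ->
  dig a k depth x = dig a k depth y -> holed_disc F v y.
Proof.
move=> tv [vx dx wx] By e; have Bx := vertex_sub _ tv _ vx; split.
- exact: (vertex_stable x y Bx By e).
- by move=> h hy; apply: (dx h); exact: (hole_stable y x By Bx (esym e)).
- move=> w tw wv wNv wy; apply: (wx w tw wv wNv).
  exact: (vertex_stable y x By Bx (esym e)).
Qed.

Lemma vertex_nested v w x : tree v -> tree w -> v x -> w x ->
  v `<=` w \/ w `<=` v.
Proof.
move=> /vertexP[h [l [_ _ ->]]] /vertexP[h' [l' [_ _ ->]]].
move=> /ball_center-> /ball_center->; case: (leP l l') => ll.
  by left; exact: ball_sub.
by right; apply: ball_sub => //; exact: ltW.
Qed.

(** Of two nested vertices, the holed disc of the larger avoids the smaller. *)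
Lemma holed_disjoint v w x : tree v -> tree w -> holed_disc F v x ->
  holed_disc F w x -> v = w.
Proof.
move=> tv tw [vx _ nv] [wx _ nw]; apply: contrapT => vw.
have [s|s] := vertex_nested _ _ _ tv tw vx wx; first exact: (nw v).
by apply: (nv w) => // e; exact: vw.
Qed.

(** If y is outside v, all points of v are equally far from it. Otherwise w is
properly contained in v, and the child of v around y is a vertex between the
two: U_v avoids it, so its points are at the largest distance possible in v. *)
Lemma holed_dist_left v w x x' y : tree v -> tree w -> v <> w ->
  holed_disc F v x -> holed_disc F v x' -> holed_disc F w y ->
  pabs (x - y) = pabs (x' - y).
Proof.
move=> tv tw vw [vx dx nx] [vx' dx' nx'] [wy dy ny].
have [h [l [hh /andP[jl lk] vE]]] := (vertexP v).1 tv.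
have [vy|vy] := pselect (v y).
  have [h' [l' [hh' /andP[jl' lk'] wE]]] := (vertexP w).1 tw.
  have vEy : v = padic_ball y l by rewrite vE; apply: ball_center; rewrite -vE.
  have wEy : w = padic_ball y l' by rewrite wE; apply: ball_center; rewrite -wE.
  have ll : l' < l.
    rewrite ltNge; apply/negP => ll; apply: (ny v) => //.
    by rewrite vEy wEy; exact: ball_sub.
  (* The child of v that contains w. *)
  pose w' := padic_ball y (l - 1).
  have tw' : tree w'.
    apply/vertexP; exists h', (l - 1); split=> //; first by lia.
    apply/esym/ball_center; apply: (@ball_sub _ _ p_prime _ _ l'); first by lia.
    by rewrite -wE.
  have w'v : w' `<=` v by rewrite vEy; apply: ball_sub => //; lia.
  have w'Nv : w' <> v.
    move=> e; have := ball_edge_in p_prime y l; rewrite -vEy -e.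
    by move=> /(ball_edge p_prime); lia.
  have far z : v z -> ~ w' z -> pabs (z - y) = q ^ l.
    rewrite vEy /w' /padic_ball /= => zl zw; apply/eqP.
    by rewrite eq_le zl /= leNgt pabs_lt_le//; apply/negP.
  by rewrite !far//; [exact: (nx' w')|exact: (nx w')].
have vEx : v = padic_ball x l by rewrite vE; apply: ball_center; rewrite -vE.
have xx : pabs (x' - x) <= q ^ l by move: vx'; rewrite vEx.
have xy : q ^ l < pabs (x - y).
  by rewrite ltNge; apply/negP => h1; apply: vy; rewrite vEx /padic_ball /= pabsC.
have -> : x' - y = (x' - x) + (x - y) by rewrite addrA subrK.
by rewrite [RHS]pabs_isosceles //; exact: le_lt_trans xx xy.
Qed.

Lemma holed_dist v w x x' y y' : tree v -> tree w -> v <> w ->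
  holed_disc F v x -> holed_disc F v x' -> holed_disc F w y -> holed_disc F w y' ->
  pabs (x - y) = pabs (x' - y').
Proof.
move=> tv tw vw vx vx' wy wy'.
rewrite (holed_dist_left v w x x' y)// pabsC [RHS]pabsC.
by rewrite (holed_dist_left w v y y' x')//; exact/nesym.
Qed.

Definition vertex (i : 'I_(card_vertices F)) : set K :=
  nth set0 (fset_set tree) i.

Lemma mem_tree v : (v \in fset_set tree) = (v \in tree).
Proof. by rewrite in_fset_set//; exact: tree_finite. Qed.

Lemma vertex_tree i : tree (vertex i).
Proof. by apply/set_mem; rewrite -mem_tree mem_nth. Qed.

Lemma vertex_surj v : tree v -> exists i, vertex i = v.
Proof.
move=> tv; have vs : v \in fset_set tree by rewrite mem_tree; exact/mem_set.
have hi : (index v (fset_set tree) < card_vertices F)%N by rewrite index_mem.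
by exists (Ordinal hi); rewrite /vertex /= nth_index.
Qed.

Lemma vertex_inj : injective vertex.
Proof.
by move=> i j /eqP; rewrite nth_uniq ?fset_uniq// => /eqP/val_inj.
Qed.

Lemma card_vertices_gt0 : (0 < card_vertices F)%N.
Proof.
by have [v /vertex_surj[i _]] := tree_nonempty; exact: leq_ltn_trans (ltn_ord i).
Qed.

End Tree.

(** * The index *)

Section Identification.
Context {R : realType} {p : nat} (p_prime : prime p) {K : padic_field R p}
  (mu : {sigma_finite_measure set (borel K) -> \bar R})
  (mu_haar : haar_measure mu)
  {X : mumford_curve K} (F : good_fundamental_domain X)
  (h0 : bool * 'I_(genus X)) (a : K) (k : int) (h0E : hole F h0 = CoDisc a k)
  (U_nonempty : forall v, tree_vertices F v -> holed_disc F v !=set0)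
  (alpha : R) (alpha_gt0 : 0 < alpha).
Local Notation n := (card_vertices F).

Definition piece (i : 'I_n) : set K := holed_disc F (vertex F i).

Let vt (i : 'I_n) : tree_vertices F (vertex F i).
Proof. exact: (vertex_tree p_prime F h0 a k h0E). Qed.

Let vsurj v : tree_vertices F v -> exists i, vertex F i = v.
Proof. exact: (vertex_surj p_prime F h0 a k h0E). Qed.

Lemma piece_cover x : OmegaV F x <-> exists i, piece i x.
Proof.
split=> [[v /vsurj[i <-] vx]|[i ix]]; first by exists i.
by exists (vertex F i).
Qed.

Lemma piece_disjoint i j x : piece i x -> piece j x -> i = j.
Proof.
move=> ix jx; apply: (vertex_inj F).
exact: (holed_disjoint p_prime F h0 a k h0E _ _ x).
Qed.

Lemma piece_stable i x y : piece i x -> B0 a k y ->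
  dig a k (depth F k) x = dig a k (depth F k) y -> piece i y.
Proof. by move=> ix; exact: (holed_stable p_prime F h0 a k h0E _ x). Qed.

Lemma piece_nonempty i : piece i !=set0.
Proof. exact: U_nonempty. Qed.

Definition piece_dist (i j : 'I_n) : R :=
  pabs (xget a (piece i) - xget a (piece j)).

Lemma piece_distP i j x y : i != j -> piece i x -> piece j y ->
  pabs (x - y) = piece_dist i j.
Proof.
move=> /eqP ij ix jy.
apply: (holed_dist p_prime F h0 a k h0E (vertex F i) (vertex F j)) => //.
- by move/(vertex_inj F).
- by case: (xgetPex a (piece_nonempty i)).
- by case: (xgetPex a (piece_nonempty j)).
Qed.

Lemma OmegaV_stable x y : OmegaV F x -> B0 a k y ->
  dig a k (depth F k) x = dig a k (depth F k) y -> OmegaV F y.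
Proof.
move=> /piece_cover[i ix] By e; apply/piece_cover; exists i.
exact: (piece_stable i x).
Qed.

Lemma OmegaV_nonempty : OmegaV F !=set0.
Proof.
have [v tv] := tree_nonempty p_prime F h0 a k h0E.
by have [x vx] := U_nonempty v tv; exists x, v.
Qed.

Lemma L2E_rho_edge_space : L2E_rho mu F = edge_space mu (OmegaV F) n piece.
Proof.
apply/seteqP; split => h [hs ha hc]; split => //.
  by move=> i j x x' y y'; exact: hc.
move=> v w /vsurj[i <-] /vsurj[j <-] x x' y y'; exact: hc.
Qed.

Lemma Delta_rho_edge_Laplacian : Delta_rho_graph mu F alpha = edge_Laplacian mu (OmegaV F) alpha n piece.
Proof. by rewrite /Delta_rho_graph L2E_rho_edge_space. Qed.

Lemma ker_delta_rhoE :
  ker_delta_rho mu F alpha = ker_delta_edge mu (OmegaV F) alpha n piece.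
Proof. by rewrite /ker_delta_rho L2E_rho_edge_space. Qed.

Lemma n_pos : (0 < n)%N.
Proof. exact: (card_vertices_gt0 p_prime F h0 a k h0E). Qed.

Let Omsub : OmegaV F `<=` B0 a k.
Proof. exact: (OmegaV_sub F h0 a k h0E). Qed.

Lemma dim_ker_d : dimension mu (OmegaV F) (ker_d mu F alpha) = 1%E.
Proof.
exact: (dimension_d_kernel p_prime mu mu_haar a k (OmegaV F) Omsub (depth F k)
  OmegaV_stable alpha alpha_gt0 OmegaV_nonempty).
Qed.

Lemma dim_ker_delta : dimension (muE mu) (OmegaE F) (ker_delta_rho mu F alpha)
  = ((nb_pairs n - n.-1)%N%:R)%:E.
Proof.
rewrite ker_delta_rhoE.
exact: (dimension_ker_delta_edge p_prime mu mu_haar a k (OmegaV F) Omsub (depth F k)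
  OmegaV_stable alpha OmegaV_nonempty n piece (depth F k) piece_cover
  piece_disjoint piece_stable piece_nonempty piece_dist piece_distP).
Qed.

Lemma trace_D_cvg : 1 / 2 <= alpha -> trace_D mu F alpha t @[t --> +oo] --> 1%E.
Proof.
exact: (D_trace_cvg p_prime mu mu_haar a k (OmegaV F) Omsub (depth F k)
  OmegaV_stable alpha alpha_gt0 OmegaV_nonempty).
Qed.

Lemma trace_Delta_cvg : trace_Delta_rho mu F alpha t @[t --> +oo]
  --> (((nb_pairs n - n.-1)%N%:R : R)%:E : \bar R).
Proof.
rewrite /trace_Delta_rho Delta_rho_edge_Laplacian L2E_rho_edge_space.
exact: (edge_trace_cvg p_prime mu mu_haar a k (OmegaV F) Omsub (depth F k)
  OmegaV_stable alpha OmegaV_nonempty n piece (depth F k) piece_cover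
  piece_disjoint piece_stable piece_nonempty piece_dist piece_distP).
Qed.

Lemma index_value : index_d mu F alpha =
  (- (1 / 2) * n%:R ^+ 2 + 3 / 2 * n%:R)%:E.
Proof.
rewrite /index_d dim_ker_d dim_ker_delta -EFinB; congr EFin.
have cp := card_pairs n; have np := n_pos.
(* The truncated subtraction is a true one. *)
have nN : (n.-1 <= nb_pairs n)%N by nia.
have -> : ((nb_pairs n - n.-1)%N%:R : R) = (nb_pairs n)%:R - n%:R + 1.
  by rewrite natrB// -subn1 natrB//; ring.
have : 2 * (nb_pairs n)%:R + n%:R = n%:R ^+ 2 :> R by rewrite -natrM -natrD cp natrX.
by move=> e; lra.
Qed.

Lemma index_limit : 1 / 2 <= alpha ->
  (trace_D mu F alpha t - trace_Delta_rho mu F alpha t)%E @[t --> +oo]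
    --> index_d mu F alpha.
Proof.
move=> ha; rewrite /index_d dim_ker_d dim_ker_delta.
by apply: cvgeB => //; [exact: trace_D_cvg|exact: trace_Delta_cvg].
Qed.

End Identification.

Theorem corollary5p4 (R : realType) (p : nat) (p_prime : prime p)
    (Qp : padic_field R p)
    (mu : {sigma_finite_measure set (borel Qp) -> \bar R})
    (mu_haar : haar_measure mu)
    (X : mumford_curve Qp) (genus_gt0 : (0 < genus X)%N)
    (F : good_fundamental_domain X)
    (U_nonempty : forall v, tree_vertices F v -> holed_disc F v !=set0)
    (alpha : R) (alpha_gt0 : 0 < alpha) :
  index_d mu F alpha
    = (- (1 / 2) * (card_vertices F)%:R ^+ 2
       + 3 / 2 * (card_vertices F)%:R)%:E /\
  (1 / 2 <= alpha ->
   (trace_D mu F alpha t - trace_Delta_rho mu F alpha t)%E @[t --> +oo]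
     --> index_d mu F alpha).
Proof.
have [h0] := hole_infty F; case h0E: (hole F h0) => [//|a k] _.
by split; [exact: (index_value p_prime mu mu_haar F h0 a k)
          |exact: (index_limit p_prime mu mu_haar F h0 a k)].
Qed.
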